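(* Let $R$ be a perfectoid ring of characteristic $0$, let $\pi$ be a perfectoid element of $R$ and choose an element $\pi^{\flat}$ of $R^{\flat}$ such that $\pi^{\flat\sharp}$ is a unit multiple of $\pi$ in $R$ (this is always possible). Let $I$ be a $p^{\flat}$-adically closed (or, equivalently, $\pi^{\flat}$-adically closed) radical ideal of $R^{\flat}$ such that $R^{\flat}/I$ is $\pi^{\flat}$-torsion-free. Endow the perfectoid Tate ring $R[1/\pi]$ (respectively, $(R[1/\pi])^{\flat}=R^{\flat}[1/\pi^{\flat}]$) with a power-multiplicative norm $\|\cdot\|$ defining its topology such that the element $\pi\in R[1/\pi]$ (respectively, $\pi^{\flat}\in(R[1/\pi])^{\flat}$) is a multiplicative element with respect to $\|\cdot\|$ (such a power-multiplicative norm always exists). Then $$I^{\sharp}=\bigcap_{\substack{\phi\in\mathcal{M}(R^{\flat}[1/\pi^{\flat}])\\ \ker(\phi)\supseteq I}}\ker(\phi^{\sharp})\cap R.$$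
   Context: Fix a prime number $p$. Perfectoid rings are meant in the (integral) sense of Bhatt–Morrow–Scholze: a ring $R$ is perfectoid if there is $\pi\in R$ such that $R$ is $\pi$-adically complete (and separated), $\pi^p$ divides $p$ in $R$, the Frobenius on $R/pR$ is surjective, and the kernel of the theta map $\theta_R\colon W(R^{\flat})\to R$, $\sum_{n\ge 0}[x_n]p^n\mapsto\sum_{n\ge 0}x_n^{\sharp}p^n$, is principal. A perfectoid element of a perfectoid ring $R$ is any $\pi\in R$ such that $R$ is $\pi$-adically complete and $\pi^p$ divides $p$ in $R$. For a $p$-adically complete ring $R$, the tilt is $R^{\flat}:=\varprojlim_F R/pR$ ($F$ the Frobenius), whose underlying multiplicative monoid is identified with $\varprojlim_{x\mapsto x^p}R$, so elements of $R^{\flat}$ are sequences $x=(x^{(n)})_{n\ge 0}$ in $R$ with $(x^{(n+1)})^p=x^{(n)}$; $x^{\sharp}:=x^{(0)}$. For $R$ perfectoid of characteristic $0$ there is a unit $v\in R^{\times}$ such that $vp$ admits a compatible system of $p$-power roots in $R$; one fixes such a system and lets $p^{\flat}:=((vp)^{1/p^n})_n\in R^{\flat}$. An ideal of a ring $B$ is $a$-adically closed ($a\in B$) if it is closed in the $a$-adic topology of $B$. Untilt of an ideal $I\subseteq R^{\flat}$: $I^{\sharp}:=\theta_R(W(I))$, where $W(I):=\{\sum_{n\ge 0}[x_n]p^n\in W(R^{\flat})\mid x_n\in I\text{ for all }n\}$. For a ring $A_0$ and $t\in A_0$, $A_0[1/t]$ is regarded as the Tate ring with pair of definition $(A_0/A_0[t^{\infty}],(t))$,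 where $A_0[t^{\infty}]$ is the ideal of $t$-power-torsion elements. For $R$ and $\pi$ as in the claim, $A=R[1/\pi]$ is a perfectoid Tate ring (in the sense of Fontaine); its tilt $A^{\flat}$ has underlying multiplicative monoid $\varprojlim_{x\mapsto x^p}A$, with $f^{\sharp}$ the $0$-th component of $f\in A^{\flat}$ and addition $(f+g)^{(n)}=\lim_{k}(f^{(n+k)}+g^{(n+k)})^{p^k}$, and it is identified with $R^{\flat}[1/\pi^{\flat}]$. A norm is power-multiplicative if $\|f^n\|=\|f\|^n$ for all $f$ and $n\ge1$; an element $t$ is multiplicative if $\|tf\|=\|t\|\,\|f\|$ for all $f$. For a seminormed ring $(A,\|\cdot\|)$, the Berkovich spectrum $\mathcal{M}(A)$ is the space of bounded multiplicative seminorms $\phi\colon A\to\mathbb{R}_{\ge0}$, with the weakest topology making all maps $\phi\mapsto\phi(f)$, $f\in A$, continuous. For a perfectoid Tate ring $A$, viewed as a uniform Banach ring by choosing a power-multiplicative norm defining its topology, there is a canonical map $\mathcal{M}(A)\to\mathcal{M}(A^{\flat})$, $\phi\mapsto\phi^{\flat}$, with $\phi^{\flat}(f):=\phi(f^{\sharp})$ for $f\in A^{\flat}$; this map is a homeomorphism, and $\phi\mapsto\phi^{\sharp}$ denotes its inverse. Here $\ker(\phi)\supseteq I$ means that $\ker(\phi)$ contains the image of $I$ in $R^{\flat}[1/\pi^{\flat}]$, and $\cap R$ means taking the preimage under $R\to R[1/\pi]$.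
   Formalization: I is assumed π^♭-adically closed: p^♭-closedness is weaker in general (e.g. when R has a characteristic-p factor) and the claim then fails. The two norms are assumed to satisfy ‖π‖ = ‖π^♭‖, without which φ ↦ φ^♭ does not map into M(R^♭[1/π^♭]). *)

(* Defs.v *)
From HB Require Import structures.
From mathcomp Require Import all_boot all_algebra.
From mathcomp Require Import finmap monalg.
From mathcomp Require Import boolp classical_sets functions reals.

Set Implicit Arguments.
Unset Strict Implicit.
Unset Printing Implicit Defensive.

Import GRing.Theory Num.Theory.
Local Open Scope classical_set_scope.
Local Open Scope ring_scope.
Local Open Scope quotient_scope.

Definition rdvd (A : comPzRingType) (a x : A) : Prop := exists y, x = a * y.

Section Rdvd.
Variables (A : comPzRingType).
Implicit Types a b x y : A.

Lemma rdvd0 a : rdvd a 0. Proof. by exists 0; rewrite mulr0. Qed.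

Lemma rdvdD a x y : rdvd a x -> rdvd a y -> rdvd a (x + y).
Proof. by move=> [u ->] [v ->]; exists (u + v); rewrite mulrDr. Qed.

Lemma rdvdN a x : rdvd a x -> rdvd a (- x).
Proof. by move=> [u ->]; exists (- u); rewrite mulrN. Qed.

Lemma rdvdB a x y : rdvd a x -> rdvd a y -> rdvd a (x - y).
Proof. by move=> ax ay; apply/rdvdD/rdvdN. Qed.

Lemma rdvd_mulr a x y : rdvd a x -> rdvd a (x * y).
Proof. by move=> [u ->]; exists (u * y); rewrite mulrA. Qed.

Lemma rdvd_mull a x y : rdvd a y -> rdvd a (x * y).
Proof. by rewrite mulrC; exact: rdvd_mulr. Qed.

Lemma rdvd_mul a b x y : rdvd a x -> rdvd b y -> rdvd (a * b) (x * y).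
Proof. by move=> [u ->] [v ->]; exists (u * v); rewrite mulrACA. Qed.

Lemma rdvd_sum a (I : Type) (r : seq I) (P : pred I) (F : I -> A) :
  (forall i, P i -> rdvd a (F i)) -> rdvd a (\sum_(i <- r | P i) F i).
Proof. by move=> h; elim/big_ind: _ => //; [exact: rdvd0|exact: rdvdD]. Qed.

Lemma rdvd_sub_mul a x y u v :
  rdvd a (x - y) -> rdvd a (u - v) -> rdvd a (x * u - y * v).
Proof.
move=> h1 h2; have -> : x * u - y * v = (x - y) * u + y * (u - v).
  by rewrite mulrBl mulrBr addrA subrK.
by apply: rdvdD; [exact: rdvd_mulr|exact: rdvd_mull].
Qed.

Lemma rdvd_sub_exp a x y n : rdvd a (x - y) -> rdvd a (x ^+ n - y ^+ n).
Proof. by move=> h; rewrite subrXX; exact: rdvd_mulr. Qed.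

Lemma rdvd_rmorph (B : comPzRingType) (f : {rmorphism A -> B}) a x :
  rdvd a x -> rdvd (f a) (f x).
Proof. by move=> [u ->]; exists (f u); rewrite rmorphM. Qed.

Variables (p : nat) (p_pr : prime p).
Let P : A := p%:R.

Lemma rdvd_freshman x y : rdvd P ((x + y) ^+ p - (x ^+ p + y ^+ p)).
Proof.
have p0 := prime_gt0 p_pr.
rewrite exprDn; case: p p_pr @P p0 => // q q_pr PP _.
rewrite big_ord_recl big_ord_recr /= bin0 binn subnn !mulr1n !expr0 mulr1 mul1r.
rewrite subn0 addrCA addrAC -[bump 0 q]/(q.+1) -addrA addNr addr0.
apply: rdvd_sum => i _; rewrite /bump /= add1n.
have /dvdnP[k ->] : (q.+1 %| 'C(q.+1, i.+1))%N.
  by apply: prime_dvd_bin => //=; rewrite ltnS ltn_ord.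
exists (x ^+ (q.+1 - i.+1) * y ^+ i.+1 *+ k).
by rewrite mulrnA mulr_natl.
Qed.

Lemma rdvd_frobD x y u v : rdvd P (u - x ^+ p) -> rdvd P (v - y ^+ p) ->
  rdvd P (u + v - (x + y) ^+ p).
Proof.
move=> hu hv; have := rdvdB (rdvdD hu hv) (rdvd_freshman x y).
by rewrite addrACA -opprD opprB addrA subrK.
Qed.

Lemma rdvd_frob0 : rdvd P (0 - 0 ^+ p).
Proof.
by rewrite expr0n -[(p == 0)%N]negbK -lt0n prime_gt0 //= subr0; exact: rdvd0.
Qed.

Lemma rdvd_frobN x u : rdvd P (u - x ^+ p) -> rdvd P (- u - (- x) ^+ p).
Proof.
move=> hu; have := rdvdB (rdvdB rdvd_frob0 hu) (rdvdN (rdvd_freshman x (- x))).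
rewrite opprK subrr opprB; set a := 0 ^+ p; set b := x ^+ p; set c := (- x) ^+ p.
by rewrite sub0r addrACA addNr add0r opprD addrACA subrr add0r.
Qed.

Lemma rdvd_lift n x y : rdvd (P ^+ n.+1) (x - y) ->
  rdvd (P ^+ n.+2) (x ^+ p - y ^+ p).
Proof.
move=> h; rewrite subrXX [_ ^+ n.+2]exprSr; apply: rdvd_mul => //.
have hp : rdvd P (x - y).
  by case: h => u ->; exists (P ^+ n * u); rewrite exprS mulrA.
rewrite -[X in rdvd _ X](subrK (\sum_(i < p) y ^+ p.-1)); apply: rdvdD.
  rewrite -sumrB; apply: rdvd_sum => i _.
  have {2}-> : p.-1 = (p.-1 - i + i)%N.
    by rewrite subnK // -ltnS prednK ?prime_gt0.
  rewrite exprD; apply: rdvd_sub_mul; first exact: rdvd_sub_exp.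
  by rewrite subrr; exact: rdvd0.
by rewrite sumr_const card_ord; exists (y ^+ p.-1); rewrite mulr_natl.
Qed.

Lemma rdvd_lift_iter n x y : rdvd P (x - y) ->
  rdvd (P ^+ n.+1) (x ^+ (p ^ n) - y ^+ (p ^ n)).
Proof.
move=> h; elim: n => [|n IH]; first by rewrite expn0 !expr1.
by rewrite expnSr !exprM; exact: rdvd_lift.
Qed.

End Rdvd.

Section FreeRing.
Variable I : choiceType.

Definition pmon (m : cmonom I) : {malg int[cmonom I]} := << m >>.

Definition pvar (i : I) : {malg int[cmonom I]} := pmon (ucm i).

Section Eval.
Variables (A : comPzRingType) (v : I -> A).

Definition mon_eval (m : cmonom I) : A :=
  \prod_(i <- finsupp m) v i ^+ m i.

Definition peval (g : {malg int[cmonom I]}) : A :=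
  \sum_(m <- msupp g) (g@_m)%:~R * mon_eval m.

Lemma mon_evalEw (d : {fset I}) (m : cmonom I) : (finsupp m `<=` d)%fset ->
  mon_eval m = \prod_(i <- d) v i ^+ m i.
Proof.
move=> le; rewrite [LHS](big_fset_incl _ le) => //= i _.
by rewrite -cmE_eq0 => /eqP ->.
Qed.

Lemma mon_evalM m1 m2 : mon_eval (mmul m1 m2) = mon_eval m1 * mon_eval m2.
Proof.
set d := (finsupp m1 `|` finsupp m2)%fset.
rewrite (@mon_evalEw d) ?mdomD // (@mon_evalEw d m1) ?fsubsetUl //.
rewrite (@mon_evalEw d m2) ?fsubsetUr // -big_split /=.
by apply: eq_bigr => i _; rewrite cmM exprD.
Qed.

Lemma mon_eval1 : mon_eval mone = 1.
Proof. by rewrite /mon_eval mdom1 big_seq_fset0. Qed.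

Lemma pevalEw (d : {fset cmonom I}) g :
  (msupp g `<=` d)%fset -> peval g = \sum_(m <- d) (g@_m)%:~R * mon_eval m.
Proof.
move=> le; rewrite [LHS](big_fset_incl _ le) => //= m _ /mcoeff_outdom ->.
by rewrite mulr0z mul0r.
Qed.

Lemma pevalB : {morph peval : f g / f - g}.
Proof.
move=> f g; set d := (msupp f `|` msupp g)%fset.
rewrite (@pevalEw d) ?msuppB_le // (@pevalEw d f) ?fsubsetUl //.
rewrite (@pevalEw d g) ?fsubsetUr // -sumrB.
by apply: eq_bigr => m _; rewrite mcoeffB rmorphB /= mulrBl.
Qed.

HB.instance Definition _ := GRing.isZmodMorphism.Build {malg int[cmonom I]} A peval pevalB.

Lemma pevalU c m : peval << c *g m >> = c%:~R * mon_eval m.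
Proof. by rewrite (pevalEw msuppU_le) big_seq_fset1 mcoeffUU. Qed.

Lemma pevalM : GRing.monoid_morphism peval.
Proof.
split; first by rewrite -[1]mpolyC1E pevalU mon_eval1 mulr1.
move=> f g; rewrite malgME raddf_sum mulr_suml /=; apply: eq_bigr => i _.
rewrite raddf_sum mulr_sumr /=; apply: eq_bigr => j _.
by rewrite pevalU rmorphM mon_evalM /= mulrACA.
Qed.

HB.instance Definition _ :=
  GRing.isMonoidMorphism.Build {malg int[cmonom I]} A peval pevalM.

Lemma peval_var i : peval (pvar i) = v i.
Proof.
by rewrite /pvar /pmon pevalU mul1r /mon_eval mdomU big_seq_fset1 cmUU expr1.
Qed.

End Eval.

Lemma pmonM m1 m2 : pmon m1 * pmon m2 = pmon (mmul m1 m2).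
Proof. by rewrite /pmon malgM_def fgmulUU mulr1. Qed.

Lemma pmon1 : pmon mone = 1. Proof. by rewrite /pmon mpolyC1E. Qed.

Lemma pmonX m n : pmon m ^+ n = pmon (iter n (mmul m) mone).
Proof.
elim: n => [|n IH]; first by rewrite expr0 pmon1.
rewrite exprS IH pmonM; reflexivity.
Qed.

Lemma peval_id f : peval pvar f = f.
Proof.
have mon_id m : mon_eval pvar m = pmon m.
  rewrite /mon_eval (eq_bigr (fun i => pmon (iter (m i) (mmul (ucm i)) mone))).
    rewrite -(big_morph pmon (fun x y => esym (pmonM x y)) pmon1).
    congr pmon; apply/eqP/cmP => j.
    have itE (k : cmonom I) n : (iter n (mmul k) mone : cmonom I) j = (n * k j)%N.
      by elim: n => [|n IH]; rewrite ?cm1 // iterS cmM IH mulSn.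
    rewrite (big_morph (fun k : cmonom I => k j) (cmM j) (cm1 j)).
    under eq_bigr do rewrite itE cmU.
    have [jm|jm] := boolP (j \in finsupp m).
      rewrite (big_fsetD1 j) //= eqxx muln1 big1_fset ?addn0 // => i.
      by rewrite in_fsetD1 => /andP[/negPf ->]; rewrite muln0.
    rewrite big1_fset => [|i im _].
      by move: jm; rewrite -cmE_eq0 => /eqP ->.
    by case: eqVneq im jm => [-> ->|_]; rewrite ?muln0.
  by move=> i _; rewrite pmonX.
rewrite /peval [RHS]monalgE; apply: eq_bigr => m _; rewrite mon_id.
rewrite -(rmorph_int (@malgC _ int)) intz.
by rewrite /pmon malgM_def fgmulUU mulr1 mul1m.
Qed.

Lemma peval_comp (A B : comPzRingType) (h : {rmorphism A -> B}) v f :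
  h (peval v f) = peval (h \o v) f.
Proof.
rewrite /peval rmorph_sum; apply: eq_bigr => m _.
rewrite rmorphM rmorph_int rmorph_prod; congr (_ * _).
by apply: eq_bigr => i _; rewrite rmorphXn.
Qed.

Lemma pmulnI n (f g : {malg int[cmonom I]}) :
  (0 < n)%N -> n%:R * f = n%:R * g -> f = g.
Proof.
move=> n0; rewrite !mulr_natl => /malgP fg; apply/malgP => m.
move: (fg m); rewrite !mcoeffMn => /eqP; rewrite eqr_pMn2r // => /eqP; exact.
Qed.

End FreeRing.

Section Ghost.
Variables (p : nat) (A : comPzRingType).

Definition ghost (x : nat -> A) (n : nat) : A :=
  \sum_(i < n.+1) p%:R ^+ i * x i ^+ (p ^ (n - i)).

Lemma ghost0 x : ghost x 0 = x 0.
Proof. by rewrite /ghost big_ord1 expr0 mul1r subnn expn0 expr1. Qed.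

Lemma ghostS x n :
  ghost x n.+1 = ghost (fun i => x i ^+ p) n + p%:R ^+ n.+1 * x n.+1.
Proof.
rewrite /ghost big_ord_recr /= subnn expr1; congr (_ + _).
apply: eq_bigr => i _; rewrite -exprM -expnS subSn // -ltnS; exact: ltn_ord.
Qed.

Lemma eq_ghost x y n : (forall i, (i <= n)%N -> x i = y i) ->
  ghost x n = ghost y n.
Proof. by move=> xy; apply: eq_bigr => i _; rewrite xy // -ltnS. Qed.

End Ghost.

Lemma ghost_rmorph p (A B : comPzRingType) (f : {rmorphism A -> B}) x n :
  f (ghost p x n) = ghost p (f \o x) n.
Proof.
rewrite rmorph_sum; apply: eq_bigr => i _.
by rewrite rmorphM !rmorphXn rmorph_nat.
Qed.

Section FrobeniusLift.
Variables (p : nat) (p_pr : prime p).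

Lemma rdvd_frob_peval (I : choiceType) (A : comPzRingType) (v : I -> A)
    (F : {rmorphism A -> A}) (f : {malg int[cmonom I]}) :
  (forall i, F (v i) = v i ^+ p) ->
  rdvd p%:R (F (peval v f) - peval v f ^+ p).
Proof.
move=> Fv; pose Q (a : A) := rdvd p%:R (F a - a ^+ p).
have QD a b : Q a -> Q b -> Q (a + b).
  by rewrite /Q rmorphD => *; exact: rdvd_frobD.
have Q0 : Q 0 by rewrite /Q rmorph0; exact: rdvd_frob0.
have QM a b : Q a -> Q b -> Q (a * b).
  by rewrite /Q rmorphM exprMn => *; exact: rdvd_sub_mul.
have Q1 : Q 1 by rewrite /Q rmorph1 expr1n subrr; exact: rdvd0.
have QN a : Q a -> Q (- a) by rewrite /Q rmorphN; exact: rdvd_frobN.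
have QX a n : Q a -> Q (a ^+ n).
  by move=> h; elim: n => [|n IH]; rewrite ?expr0 // exprS; exact: QM.
have Qn n : Q n%:R by elim: n => [|n IH] //; rewrite -addn1 natrD; exact: QD.
have Qv i : Q (v i) by rewrite /Q Fv subrr; exact: rdvd0.
have Qz (z : int) : Q z%:~R.
  by case: z => n; [exact: Qn|rewrite NegzE mulrNz; apply: QN; exact: Qn].
have Qm m : Q (mon_eval v m).
  by apply: (big_ind Q) => // i _; exact: QX.
by apply: (big_ind Q) => // m _; exact: QM.
Qed.

Definition pFrob (I : choiceType) :
    {malg int[cmonom I]} -> {malg int[cmonom I]} :=
  peval (fun i => pvar i ^+ p).

HB.instance Definition _ I := GRing.RMorphism.copy (@pFrob I)
  (peval (fun i : I => pvar i ^+ p)).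

Lemma pFrobP (I : choiceType) (f : {malg int[cmonom I]}) :
  rdvd p%:R (pFrob f - f ^+ p).
Proof.
have := @rdvd_frob_peval _ _ (@pvar I) (@pFrob I) f (peval_var _).
by rewrite (peval_id f).
Qed.

End FrobeniusLift.

Section GhostMorph.
Variables (p : nat) (A B : comPzRingType) (f : {rmorphism A -> B}).
Implicit Types s t u : nat -> A.

Lemma ghost_morphD s t u n : ghost p s n = ghost p t n + ghost p u n ->
  ghost p (f \o s) n = ghost p (f \o t) n + ghost p (f \o u) n.
Proof. by rewrite -!ghost_rmorph -rmorphD => ->. Qed.

Lemma ghost_morphM s t u n : ghost p s n = ghost p t n * ghost p u n ->
  ghost p (f \o s) n = ghost p (f \o t) n * ghost p (f \o u) n.
Proof. by rewrite -!ghost_rmorph -rmorphM => ->. Qed.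

Lemma ghost_morphN s t n : ghost p s n = - ghost p t n ->
  ghost p (f \o s) n = - ghost p (f \o t) n.
Proof. by rewrite -!ghost_rmorph -rmorphN => ->. Qed.

End GhostMorph.

Section Dwork.
Variables (p : nat) (p_pr : prime p) (U : comPzRingType) (Frob : {rmorphism U -> U}).
Hypothesis FrobP : forall f : U, rdvd p%:R (Frob f - f ^+ p).
Hypothesis pI : forall f g : U, p%:R * f = p%:R * g -> f = g.
Implicit Types (f : U) (x g : nat -> U).

Lemma ghost_inj x y : ghost p x =1 ghost p y -> x =1 y.
Proof.
move=> xy n; elim/ltn_ind: n => n IH; move: (xy n).
case: n IH => [_|n IH]; first by rewrite !ghost0.
have xyE : ghost p (fun i => x i ^+ p) n = ghost p (fun i => y i ^+ p) n.
  by apply: eq_ghost => i lin; rewrite IH.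
rewrite (ghostS p x) (ghostS p y) xyE => /addrI.
move: n.+1 (x _) (y _) => k u v; elim: k => [|k IHk]; first by rewrite !mul1r.
by rewrite exprS -!mulrA => /pI/IHk.
Qed.

Lemma ghost_exp_Frob x n :
  rdvd (p%:R ^+ n.+1) (ghost p (fun i => x i ^+ p) n - Frob (ghost p x n)).
Proof.
rewrite ghost_rmorph /ghost -sumrB; apply: rdvd_sum => i _ /=.
have le : (i <= n)%N by rewrite -ltnS.
rewrite -mulrBr; have {1}-> : n.+1 = (i + (n - i).+1)%N.
  by rewrite addnS subnKC.
rewrite exprD; apply: rdvd_mul; first by exists 1; rewrite mulr1.
by rewrite -opprB; apply/rdvdN/rdvd_lift_iter/FrobP.
Qed.

Lemma ghost_Frob x n :
  rdvd (p%:R ^+ n.+1) (ghost p x n.+1 - Frob (ghost p x n)).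
Proof.
rewrite ghostS addrAC; apply: rdvdD; last by exists (x n.+1).
exact: ghost_exp_Frob.
Qed.

Lemma dwork g :
  (forall n, rdvd (p%:R ^+ n.+1) (g n.+1 - Frob (g n))) ->
  exists x, forall n, ghost p x n = g n.
Proof.
move=> gF.
pose quo n (a : U) : U := xget 0 [set q | a = p%:R ^+ n * q].
have quoP n a : rdvd (p%:R ^+ n) a -> a = p%:R ^+ n * quo n a.
  by move=> h; exact: (@xgetPex _ 0 [set q | a = p%:R ^+ n * q] h).
pose next (s : seq U) : U :=
  let n := size s in
  quo n (g n - \sum_(i < n) p%:R ^+ i * s`_i ^+ (p ^ (n - i))).
pose xs := fix xs n := if n is m.+1 then rcons (xs m) (next (xs m)) else [::].
have size_xs n : size (xs n) = n.
  by elim: n => //= n IH; rewrite size_rcons IH.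
pose x n := (xs n.+1)`_n.
have xsE n i : (i < n)%N -> (xs n)`_i = x i.
  elim: n => // n IH; rewrite ltnS leq_eqVlt => /orP[/eqP -> //|lin].
  by rewrite /= nth_rcons size_xs lin IH.
have xE n : x n = quo n (g n - \sum_(i < n) p%:R ^+ i * x i ^+ (p ^ (n - i))).
  rewrite /x /= nth_rcons size_xs ltnn eqxx /next size_xs; congr (quo _ (_ - _)).
  by apply: eq_bigr => i _; rewrite xsE.
exists x => n; elim: n => [|n IH].
  rewrite ghost0 xE big_ord0 subr0.
  by rewrite [RHS](quoP 0%N) ?mul1r //; exists (g 0); rewrite mul1r.
have sumE : \sum_(i < n.+1) p%:R ^+ i * x i ^+ (p ^ (n.+1 - i)) =
    ghost p (fun i => x i ^+ p) n.
  apply: eq_bigr => i _; rewrite -exprM -expnS subSn // -ltnS; exact: ltn_ord.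
suff : g n.+1 - ghost p (fun i => x i ^+ p) n = p%:R ^+ n.+1 * x n.+1.
  by rewrite ghostS => <-; rewrite addrC subrK.
rewrite xE sumE; apply: quoP.
rewrite -(subrK (Frob (g n)) (g n.+1)) -addrA; apply: rdvdD => //.
by rewrite -opprB -IH; apply: rdvdN; exact: ghost_exp_Frob.
Qed.

Lemma ghostD_ex x y : exists s, forall n, ghost p s n = ghost p x n + ghost p y n.
Proof.
apply: dwork => n; rewrite rmorphD opprD addrACA.
by apply: rdvdD; exact: ghost_Frob.
Qed.

Lemma ghostN_ex x : exists s, forall n, ghost p s n = - ghost p x n.
Proof.
by apply: dwork => n; rewrite rmorphN -opprD; apply/rdvdN/ghost_Frob.
Qed.

Lemma ghostM_ex x y : exists s, forall n, ghost p s n = ghost p x n * ghost p y n.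
Proof.
by apply: dwork => n; rewrite rmorphM; apply: rdvd_sub_mul; exact: ghost_Frob.
Qed.

End Dwork.

Definition widx : choiceType := (nat * nat)%type.

Section WittOps.
Variables (p : nat) (p_pr : prime p) (U : comPzRingType).
Variables (ev : forall A : comPzRingType, (widx -> A) -> {rmorphism U -> A}).
Variables (X : nat -> nat -> U) (SD SM SN : nat -> U).
Arguments ev {A} _.
Hypothesis evX : forall (A : comPzRingType) (v : widx -> A) k i,
  ev v (X k i) = v (k, i).
Hypothesis ev_comp : forall (A B : comPzRingType) (f : {rmorphism A -> B}) v g,
  f (ev v g) = ev (f \o v) g.
Hypothesis pI : forall f g : U, p%:R * f = p%:R * g -> f = g.
Hypothesis SDP : forall n, ghost p SD n = ghost p (X 0) n + ghost p (X 1) n.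
Hypothesis SMP : forall n, ghost p SM n = ghost p (X 0) n * ghost p (X 1) n.
Hypothesis SNP : forall n, ghost p SN n = - ghost p (X 0) n.

Section Ops.
Variable A : comPzRingType.
Implicit Types x y z : nat -> A.

Definition wsubst x y : widx -> A := fun ki => (if ki.1 is 0 then x else y) ki.2.

Definition wadd x y : nat -> A := ev (wsubst x y) \o SD.
Definition wmul x y : nat -> A := ev (wsubst x y) \o SM.
Definition wopp x : nat -> A := ev (wsubst x x) \o SN.
Definition wone : nat -> A := fun n => (n == 0)%:R.
Definition wzero : nat -> A := fun=> 0.

Lemma wsubst0 x y : ev (wsubst x y) \o X 0 = x.
Proof. by apply/funext => i; rewrite /comp evX. Qed.

Lemma wsubst1 x y : ev (wsubst x y) \o X 1 = y.
Proof. by apply/funext => i; rewrite /comp evX. Qed.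

Lemma ghost_wadd x y n : ghost p (wadd x y) n = ghost p x n + ghost p y n.
Proof.
have := ghost_morphD (ev (wsubst x y)) (SDP n).
by rewrite wsubst0 wsubst1.
Qed.

Lemma ghost_wmul x y n : ghost p (wmul x y) n = ghost p x n * ghost p y n.
Proof.
have := ghost_morphM (ev (wsubst x y)) (SMP n).
by rewrite wsubst0 wsubst1.
Qed.

Lemma ghost_wopp x n : ghost p (wopp x) n = - ghost p x n.
Proof.
have := ghost_morphN (ev (wsubst x x)) (SNP n).
by rewrite wsubst0.
Qed.

Lemma ghost_wone n : ghost p wone n = 1.
Proof.
rewrite /ghost big_ord_recl big1 => [|i _]; last first.
  by rewrite expr0n expn_eq0 -[(p == 0)%N]negbK -lt0n prime_gt0 //= mulr0.
by rewrite expr1n mulr1 addr0.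
Qed.

Lemma ghost_wzero n : ghost p wzero n = 0.
Proof.
rewrite /ghost big1 // => i _.
by rewrite expr0n expn_eq0 -[(p == 0)%N]negbK -lt0n prime_gt0 //= mulr0.
Qed.

End Ops.

Section Natural.
Variables (A B : comPzRingType) (f : {rmorphism A -> B}).
Implicit Types x y : nat -> A.

Lemma ev_wsubst x y g :
  f (ev (wsubst x y) g) = ev (wsubst (f \o x) (f \o y)) g.
Proof.
by rewrite ev_comp; congr (ev _ g); apply/funext => -[[|k] i].
Qed.

Lemma wadd_natural x y : f \o wadd x y = wadd (f \o x) (f \o y).
Proof. by apply/funext => n; exact: ev_wsubst. Qed.

Lemma wmul_natural x y : f \o wmul x y = wmul (f \o x) (f \o y).
Proof. by apply/funext => n; exact: ev_wsubst. Qed.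

Lemma wopp_natural x : f \o wopp x = wopp (f \o x).
Proof. by apply/funext => n; exact: ev_wsubst. Qed.

Lemma wone_natural : f \o wone A = wone B.
Proof. by apply/funext => n /=; rewrite rmorph_nat. Qed.

Lemma wzero_natural : f \o wzero A = wzero B.
Proof. by apply/funext => n /=; rewrite rmorph0. Qed.

End Natural.

Section Laws.
Variable A : comPzRingType.
Implicit Types x y z : nat -> A.

Definition wev x y z : widx -> A :=
  fun ki => (if ki.1 is k.+1 then if k is 0 then y else z else x) ki.2.

Lemma wev0 x y z : ev (wev x y z) \o X 0 = x.
Proof. by apply/funext => n /=; rewrite evX. Qed.

Lemma wev1 x y z : ev (wev x y z) \o X 1 = y.
Proof. by apply/funext => n /=; rewrite evX. Qed.

Lemma wev2 x y z : ev (wev x y z) \o X 2 = z.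
Proof. by apply/funext => n /=; rewrite evX. Qed.

Lemma U_inj (s t : nat -> U) : ghost p s =1 ghost p t -> s = t.
Proof. by move=> st; apply/funext/(ghost_inj pI st). Qed.

Definition ghostE :=
  (ghost_wadd, ghost_wmul, ghost_wopp, ghost_wone, ghost_wzero).

Definition wnat := (wadd_natural, wmul_natural, wopp_natural,
  wone_natural, wzero_natural, wev0, wev1, wev2).

Lemma wlift x y z (s t : nat -> U) : ghost p s =1 ghost p t ->
  ev (wev x y z) \o s = ev (wev x y z) \o t.
Proof. by move/U_inj ->. Qed.

Lemma waddA : associative (@wadd A).
Proof.
move=> x y z.
have := @wlift x y z (wadd (X 0) (wadd (X 1) (X 2)))
  (wadd (wadd (X 0) (X 1)) (X 2)).
by rewrite !wnat; apply=> n; rewrite !ghostE addrA.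
Qed.

Lemma waddC : commutative (@wadd A).
Proof.
move=> x y.
have := @wlift x y y (wadd (X 0) (X 1)) (wadd (X 1) (X 0)).
by rewrite !wnat; apply=> n; rewrite !ghostE addrC.
Qed.

Lemma wadd0 : left_id (@wzero A) (@wadd A).
Proof.
move=> x; have := @wlift x x x (wadd (wzero _) (X 0)) (X 0).
by rewrite !wnat; apply=> n; rewrite !ghostE add0r.
Qed.

Lemma waddN : left_inverse (@wzero A) (@wopp A) (@wadd A).
Proof.
move=> x; have := @wlift x x x (wadd (wopp (X 0)) (X 0)) (wzero _).
by rewrite !wnat; apply=> n; rewrite !ghostE addNr.
Qed.

Lemma wmulA : associative (@wmul A).
Proof.
move=> x y z.
have := @wlift x y z (wmul (X 0) (wmul (X 1) (X 2)))
  (wmul (wmul (X 0) (X 1)) (X 2)).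
by rewrite !wnat; apply=> n; rewrite !ghostE mulrA.
Qed.

Lemma wmulC : commutative (@wmul A).
Proof.
move=> x y.
have := @wlift x y y (wmul (X 0) (X 1)) (wmul (X 1) (X 0)).
by rewrite !wnat; apply=> n; rewrite !ghostE mulrC.
Qed.

Lemma wmul1 : left_id (@wone A) (@wmul A).
Proof.
move=> x; have := @wlift x x x (wmul (wone _) (X 0)) (X 0).
by rewrite !wnat; apply=> n; rewrite !ghostE mul1r.
Qed.

Lemma wmulDl : left_distributive (@wmul A) (@wadd A).
Proof.
move=> x y z.
have := @wlift x y z (wmul (wadd (X 0) (X 1)) (X 2))
  (wadd (wmul (X 0) (X 2)) (wmul (X 1) (X 2))).
by rewrite !wnat; apply=> n; rewrite !ghostE mulrDl.
Qed.

End Laws.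
End WittOps.

Definition wpoly : comPzRingType := {malg int[cmonom widx]}.

Definition weval (A : comPzRingType) (v : widx -> A) : {rmorphism wpoly -> A} :=
  peval v.

Definition wvar (k : nat) : nat -> wpoly := fun i => pvar ((k, i) : widx).

Lemma weval_var (A : comPzRingType) (v : widx -> A) k i :
  weval v (wvar k i) = v (k, i).
Proof. exact: peval_var. Qed.

Lemma weval_comp (A B : comPzRingType) (f : {rmorphism A -> B}) v g :
  f (weval v g) = weval (f \o v) g.
Proof. exact: peval_comp. Qed.

Section WittPoly.
Variables (p : nat) (p_pr : prime p).

Definition wFrob : {rmorphism wpoly -> wpoly} := @pFrob p widx.

Lemma wFrobP (f : wpoly) : rdvd p%:R (wFrob f - f ^+ p).
Proof. exact: (@pFrobP p p_pr widx f). Qed.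

Lemma wpoly_pI (f g : wpoly) : p%:R * f = p%:R * g -> f = g.
Proof. exact: (@pmulnI widx p f g (prime_gt0 p_pr)). Qed.

(* The universal Witt polynomials for the sum, the product and the opposite;
   the ghost equations determine them, as Z[X] has no p-torsion. *)
Fact wittD_sig : {S : nat -> wpoly | forall n,
  ghost p S n = ghost p (wvar 0) n + ghost p (wvar 1) n}.
Proof. exact/cid/(ghostD_ex p_pr wFrobP). Qed.

Fact wittM_sig : {P : nat -> wpoly | forall n,
  ghost p P n = ghost p (wvar 0) n * ghost p (wvar 1) n}.
Proof. exact/cid/(ghostM_ex p_pr wFrobP). Qed.

Fact wittN_sig : {N : nat -> wpoly | forall n,
  ghost p N n = - ghost p (wvar 0) n}.
Proof. exact/cid/(ghostN_ex p_pr wFrobP). Qed.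

Definition wittD_poly := sval wittD_sig.
Definition wittM_poly := sval wittM_sig.
Definition wittN_poly := sval wittN_sig.

End WittPoly.

(* Sequences of Witt coordinates. [p_pr] is a parameter of the type because
   the ring structure depends on it. *)
Record witt (p : nat) (p_pr : prime p) (A : comPzRingType) :=
  Witt { wcoord : nat -> A }.

Section WittRing.
Variables (p : nat) (p_pr : prime p) (A : comPzRingType).
Local Notation W := (witt p_pr A).
Implicit Types x y z : W.

HB.instance Definition _ := gen_eqMixin W.
HB.instance Definition _ := gen_choiceMixin W.

Definition witt_zero : W := Witt p_pr (wzero A).
Definition witt_one : W := Witt p_pr (wone A).
Definition witt_opp x : W := Witt p_pr (wopp (@weval) (wittN_poly p_pr) (wcoord x)).
Definition witt_add x y : W := Witt p_pr 
  (wadd (@weval) (wittD_poly p_pr) (wcoord x) (wcoord y)).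
Definition witt_mul x y : W := Witt p_pr 
  (wmul (@weval) (wittM_poly p_pr) (wcoord x) (wcoord y)).

Let evX := @weval_var.
Let evC := @weval_comp.
Let pI := wpoly_pI p_pr.
Let SDP := svalP (wittD_sig p_pr).
Let SMP := svalP (wittM_sig p_pr).
Let SNP := svalP (wittN_sig p_pr).

Lemma witt_addA : associative witt_add.
Proof. by move=> x y z; congr Witt; exact: (waddA evX evC pI SDP). Qed.

Lemma witt_addC : commutative witt_add.
Proof. by move=> x y; congr Witt; exact: (waddC evX evC pI SDP). Qed.

Lemma witt_add0 : left_id witt_zero witt_add.
Proof. by move=> [x]; congr Witt; exact: (wadd0 p_pr evX evC pI SDP). Qed.

Lemma witt_addN : left_inverse witt_zero witt_opp witt_add.
Proof. by move=> x; congr Witt; exact: (waddN p_pr evX evC pI SDP SNP). Qed.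

HB.instance Definition _ :=
  GRing.isZmodule.Build W witt_addA witt_addC witt_add0 witt_addN.

Lemma witt_mulA : associative witt_mul.
Proof. by move=> x y z; congr Witt; exact: (wmulA evX evC pI SMP). Qed.

Lemma witt_mulC : commutative witt_mul.
Proof. by move=> x y; congr Witt; exact: (wmulC evX evC pI SMP). Qed.

Lemma witt_mul1 : left_id witt_one witt_mul.
Proof. by move=> [x]; congr Witt; exact: (wmul1 p_pr evX evC pI SMP). Qed.

Lemma witt_mulDl : left_distributive witt_mul witt_add.
Proof. by move=> x y z; congr Witt; exact: (wmulDl evX evC pI SDP SMP). Qed.

HB.instance Definition _ := GRing.Zmodule_isComPzRing.Build W
  witt_mulA witt_mulC witt_mul1 witt_mulDl.

Lemma witt_ghostD x y n : ghost p (wcoord (x + y)) n =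
  ghost p (wcoord x) n + ghost p (wcoord y) n.
Proof. exact: (ghost_wadd evX SDP). Qed.

Lemma witt_ghostM x y n : ghost p (wcoord (x * y)) n =
  ghost p (wcoord x) n * ghost p (wcoord y) n.
Proof. exact: (ghost_wmul evX SMP). Qed.

Definition teich (a : A) : W := Witt p_pr (fun n => if n is 0 then a else 0).

End WittRing.

Section PrincipalQuotient.
Variables (R : comPzRingType) (a : R).

Definition pquot_rel (x y : R) : bool := `[< rdvd a (x - y) >].

Lemma pquot_rel_refl : reflexive pquot_rel.
Proof. by move=> x; apply/asboolP; rewrite subrr; exact: rdvd0. Qed.

Lemma pquot_rel_sym : symmetric pquot_rel.
Proof.
by move=> x y; apply/asboolP/asboolP => /rdvdN; rewrite opprB.
Qed.

Lemma pquot_rel_trans : transitive pquot_rel.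
Proof.
move=> y x z /asboolP xy /asboolP yz; apply/asboolP.
by rewrite -(subrK y x) -addrA; exact: rdvdD.
Qed.

Canonical pquot_equiv :=
  EquivRel pquot_rel pquot_rel_refl pquot_rel_sym pquot_rel_trans.

Definition pquot := {eq_quot pquot_rel}.

HB.instance Definition _ : EqQuotient R pquot_rel pquot := EqQuotient.on pquot.
HB.instance Definition _ := Choice.on pquot.

Definition pq (x : R) : pquot := (\pi_pquot x)%qT.

Lemma pqP x y : pq x = pq y <-> rdvd a (x - y).
Proof. by split=> [/eqquotP/asboolP|h] //; apply/eqquotP/asboolP. Qed.

Lemma pqK (u : pquot) : pq (repr u) = u. Proof. exact: reprK. Qed.

Definition pquot_add (u v : pquot) := pq (repr u + repr v).
Definition pquot_mul (u v : pquot) := pq (repr u * repr v).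
Definition pquot_opp (u : pquot) := pq (- repr u).

Lemma rdvd_repr x : rdvd a (repr (pq x) - x).
Proof. by apply/pqP; rewrite pqK. Qed.

Lemma pq_addE x y : pquot_add (pq x) (pq y) = pq (x + y).
Proof.
by apply/pqP; rewrite opprD addrACA; apply: rdvdD; exact: rdvd_repr.
Qed.

Lemma pq_mulE x y : pquot_mul (pq x) (pq y) = pq (x * y).
Proof. by apply/pqP; apply: rdvd_sub_mul; exact: rdvd_repr. Qed.

Lemma pq_oppE x : pquot_opp (pq x) = pq (- x).
Proof. by apply/pqP; rewrite -opprD; apply/rdvdN/rdvd_repr. Qed.

Lemma pquot_ind (P : pquot -> Prop) : (forall x, P (pq x)) -> forall u, P u.
Proof. by move=> h u; rewrite -(pqK u). Qed.

Lemma pquot_addA : associative pquot_add.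
Proof.
by do 3 elim/pquot_ind => ?; rewrite !pq_addE addrA.
Qed.

Lemma pquot_addC : commutative pquot_add.
Proof. by do 2 elim/pquot_ind => ?; rewrite !pq_addE addrC. Qed.

Lemma pquot_add0 : left_id (pq 0) pquot_add.
Proof. by elim/pquot_ind => ?; rewrite !pq_addE add0r. Qed.

Lemma pquot_addN : left_inverse (pq 0) pquot_opp pquot_add.
Proof. by elim/pquot_ind => ?; rewrite pq_oppE !pq_addE addNr. Qed.

HB.instance Definition _ := GRing.isZmodule.Build pquot
  pquot_addA pquot_addC pquot_add0 pquot_addN.

Lemma pquot_mulA : associative pquot_mul.
Proof. by do 3 elim/pquot_ind => ?; rewrite !pq_mulE mulrA. Qed.

Lemma pquot_mulC : commutative pquot_mul.
Proof. by do 2 elim/pquot_ind => ?; rewrite !pq_mulE mulrC. Qed.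

Lemma pquot_mul1 : left_id (pq 1) pquot_mul.
Proof. by elim/pquot_ind => ?; rewrite !pq_mulE mul1r. Qed.

Lemma pquot_mulDl : left_distributive pquot_mul pquot_add.
Proof.
by do 3 elim/pquot_ind => ?; rewrite !(pq_mulE, pq_addE) mulrDl.
Qed.

HB.instance Definition _ := GRing.Zmodule_isComPzRing.Build pquot
  pquot_mulA pquot_mulC pquot_mul1 pquot_mulDl.

Lemma pqB : {morph pq : x y / x - y}.
Proof. by move=> x y; rewrite -[RHS]/(pquot_add _ (pquot_opp _)) pq_oppE pq_addE. Qed.

Lemma pqM : GRing.monoid_morphism pq.
Proof. by split=> // x y; rewrite -[RHS]/(pquot_mul _ _) pq_mulE. Qed.

HB.instance Definition _ := GRing.isZmodMorphism.Build R pquot pq pqB.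
HB.instance Definition _ := GRing.isMonoidMorphism.Build R pquot pq pqM.

End PrincipalQuotient.

Arguments pq {R} a x.

Definition tilt_pred (p : nat) (R : comPzRingType) :
    pred (nat -> pquot (p%:R : R)) :=
  fun x => `[< forall n, x n.+1 ^+ p = x n >].

(* R^flat = lim R / pR along the Frobenius. *)
Record tilt (p : nat) (p_pr : prime p) (R : comPzRingType) : Type := Tilt {
  tilt_seq :> nat -> pquot (p%:R : R);
  _ : tilt_pred tilt_seq
}.

Section TiltRing.
Variables (p : nat) (p_pr : prime p) (R : comPzRingType).
Local Notation T := (tilt p_pr R).

HB.instance Definition _ := [isSub for @tilt_seq p p_pr R].
HB.instance Definition _ := [Choice of T by <:].

Lemma tilt_subring_closed : subring_closed (@tilt_pred p R).
Proof.
have pp : p%:R = 0 :> pquot (p%:R : R).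
  rewrite -(rmorph_nat (pq p%:R)) -(rmorph0 (pq p%:R)); apply/pqP.
  by rewrite subr0; exists 1; rewrite mulr1.
have fD (u v : pquot (p%:R : R)) : (u + v) ^+ p = u ^+ p + v ^+ p.
  by have [w] := rdvd_freshman p_pr u v; rewrite pp mul0r => /subr0_eq.
have f0 : (0 : pquot (p%:R : R)) ^+ p = 0.
  by rewrite expr0n -[(p == 0)%N]negbK -lt0n prime_gt0.
have fN (u : pquot (p%:R : R)) : (- u) ^+ p = - u ^+ p.
  by apply/eqP; rewrite -subr_eq0 opprK -fD addNr f0.
split=> [|x y /asboolP xP /asboolP yP|x y /asboolP xP /asboolP yP].
- by apply/asboolP => n; rewrite expr1n.
- apply/asboolP => n; rewrite -[RHS]/(x n - y n) -(xP n) -(yP n) -fN -fD.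
  by [].
- apply/asboolP => n; rewrite -[RHS]/(x n * y n) -(xP n) -(yP n) -exprMn.
  by [].
Qed.

HB.instance Definition _ :=
  GRing.SubChoice_isSubPzRing.Build _ _ T tilt_subring_closed.

Lemma tilt_mulC : commutative (@GRing.mul T).
Proof.
have fC (u v : nat -> pquot (p%:R : R)) : u * v = v * u.
  by apply/funext => n; exact: pquot_mulC.
by move=> x y; apply/val_inj; rewrite !rmorphM; exact: fC.
Qed.

HB.instance Definition _ := GRing.PzRing_hasCommutativeMul.Build T tilt_mulC.

End TiltRing.

Section Adic.
Variables (A : comPzRingType) (a : A).

Definition adic_lim (u : nat -> A) (l : A) : Prop :=
  forall N, exists M, forall m, (M <= m)%N -> rdvd (a ^+ N) (u m - l).

Definition adic_cauchy (u : nat -> A) : Prop :=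
  forall N, exists M, forall m n, (M <= m)%N -> (M <= n)%N ->
    rdvd (a ^+ N) (u m - u n).

Definition adic_separated : Prop :=
  forall x : A, (forall n, rdvd (a ^+ n) x) -> x = 0.

Definition adic_complete : Prop :=
  adic_separated /\ forall u, adic_cauchy u -> exists l, adic_lim u l.

Definition adic_closed (I : set A) : Prop :=
  forall x, (forall n, exists2 y, I y & rdvd (a ^+ n) (x - y)) -> I x.

(* For an ideal I: multiplication by [a] is injective on A / I. *)
Definition quotient_torsion_free (I : set A) : Prop :=
  forall x, I (a * x) -> I x.

End Adic.

Definition is_ideal (A : comPzRingType) (I : set A) : Prop :=
  [/\ I 0, (forall x y, I x -> I y -> I (x + y)) &
      (forall c x, I x -> I (c * x))].

Definition is_radical (A : comPzRingType) (I : set A) : Prop :=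
  forall x n, I (x ^+ n) -> I x.

Definition char_zero (A : comPzRingType) : Prop :=
  forall n, n.+1%:R != 0 :> A.

Definition unit_multiple (A : comPzRingType) (x y : A) : Prop :=
  exists u v : A, u * v = 1 /\ x = u * y.

Section Perfectoid.
Variables (p : nat) (p_pr : prime p) (R : comPzRingType).
Local Notation Rb := (tilt p_pr R).
Local Notation W := (witt p_pr Rb).

(* The sequence x^(0), x^(1), ... of R which corresponds to x under the
   identification of lim R (along x |-> x^p) with lim R / pR; for R p-adically
   complete there is exactly one, and the default value is not used. *)
Definition tilt_lift (x : Rb) : nat -> R :=
  xget (fun=> 0) [set r | (forall n, r n.+1 ^+ p = r n) /\
                          (forall n, pq p%:R (r n) = x n)].

Definition sharp (x : Rb) : R := tilt_lift x 0.

(* w is the p-adic sum of the [x_n] p^n *)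
Definition teich_expansion (w : W) (x : nat -> Rb) : Prop :=
  adic_lim p%:R (fun N => \sum_(n < N) teich p_pr (x n) * p%:R ^+ n) w.

(* As R^flat is perfect, the expansion x of w exists and is unique; for R
   p-adically complete so does the limit, and the default is not used. *)
Definition theta (w : W) : R :=
  xget 0 [set r | exists2 x, teich_expansion w x &
    adic_lim p%:R (fun N => \sum_(n < N) sharp (x n) * p%:R ^+ n) r].

Definition perfectoid_element (pi : R) : Prop :=
  adic_complete pi /\ rdvd (pi ^+ p) p%:R.

Definition perfectoid : Prop :=
  [/\ exists pi, perfectoid_element pi,
      (forall u : pquot (p%:R : R), exists v, v ^+ p = u) &
      exists xi : W, forall w, theta w = 0 <-> rdvd xi w].

Definition witt_ideal (I : set Rb) : set W :=
  [set w | exists2 x, teich_expansion w x & forall n, I (x n)].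

Definition untilt_ideal (I : set Rb) : set R := theta @` witt_ideal I.

End Perfectoid.

(* iota exhibits A as R[1/t]. *)
Record is_localization (R A : comPzRingType) (iota : {rmorphism R -> A})
    (t : R) : Prop := IsLocalization {
  loc_unit : exists u, iota t * u = 1;
  loc_surj : forall a, exists r n, a * iota t ^+ n = iota r;
  loc_ker : forall r, iota r = 0 -> exists n, t ^+ n * r = 0
}.

Section Norms.
Variables (K : realType) (A : comPzRingType) (nrm : A -> K).

Record is_pm_norm : Prop := IsPmNorm {
  pm_norm_ge0 : forall a, 0 <= nrm a;
  pm_norm_eq0 : forall a, nrm a = 0 <-> a = 0;
  pm_normN : forall a, nrm (- a) = nrm a;
  pm_normD : forall a b, nrm (a + b) <= nrm a + nrm b;
  pm_normM : forall a b, nrm (a * b) <= nrm a * nrm b;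
  pm_normX : forall a n, (0 < n)%N -> nrm (a ^+ n) = nrm a ^+ n
}.

Definition multiplicative_elt (t : A) : Prop :=
  forall a, nrm (t * a) = nrm t * nrm a.

(* [nrm] defines the topology of the Tate ring A = R[1/t], for which the
   images of the t^n R form a basis of neighbourhoods of 0. *)
Definition defines_tate_topology (R : comPzRingType)
    (iota : {rmorphism R -> A}) (t : R) : Prop :=
  (forall n, exists2 e, 0 < e &
     forall a, nrm a < e -> exists r, a = iota (t ^+ n * r)) /\
  (forall e, 0 < e -> exists n, forall r, nrm (iota (t ^+ n * r)) < e).

Record is_bounded_multiplicative_seminorm (phi : A -> K) : Prop :=
  IsBoundedMultiplicativeSeminorm {
  bms_ge0 : forall a, 0 <= phi a;
  bms0 : phi 0 = 0;
  bms1 : phi 1 = 1;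
  bmsD : forall a b, phi (a + b) <= phi a + phi b;
  bmsM : forall a b, phi (a * b) = phi a * phi b;
  bms_bounded : exists C, forall a, phi a <= C * nrm a
}.

(* Points of the Berkovich spectrum M(A) *)
Definition berkovich : set (A -> K) :=
  [set phi | is_bounded_multiplicative_seminorm phi].

End Norms.

Section TiltSpectrum.
Variables (p : nat) (p_pr : prime p) (R : comPzRingType) (pib : tilt p_pr R).
Variables (A B : comPzRingType).
Variables (iota : {rmorphism R -> A}) (j : {rmorphism tilt p_pr R -> B}).

(* The identification of R^flat[1/pi^flat] with lim A (along x |-> x^p) sends
   x / (pi^flat)^k to the sequence x^(n) / ((pi^flat)^(n))^k, whose 0-th
   component is x^# / ((pi^flat)^#)^k. *)
Definition loc_sharp (f : B) : A :=
  xget 0 [set a | exists x k, f * j pib ^+ k = j x /\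
                              a * iota (sharp pib) ^+ k = iota (sharp x)].

Variable K : realType.

(* If phi is bounded and pi, pi^flat are multiplicative for the chosen norms,
   then phi^flat (pi^flat) = phi (pi) = |pi|. Hence phi |-> phi^flat takes values
   in M(A^flat) only for norms with |pi| = |pi^flat|. *)
Definition flat_seminorm (phi : A -> K) : B -> K := phi \o loc_sharp.

(* The inverse of phi |-> phi^flat : M(A) -> M(A^flat); this map is bijective
   for a perfectoid Tate ring A, and the default value is then not used. *)
Definition sharp_seminorm (nrm : A -> K) (psi : B -> K) : A -> K :=
  xget (fun=> 0) [set phi | berkovich nrm phi /\ flat_seminorm phi = psi].

End TiltSpectrum.

(* Main.v *)
(* Let S = R^flat / I, let xi generate ker theta, and let N = I^sharp. Then R / N
   is W(S) / xi. As xi divides an element p - [pib]^p w, and S is perfect,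
   pib-torsion-free and pib-complete, the ring R / N is pi-torsion-free,
   pi-separated and p-root closed: r ^ p in pi^p R / N implies r in pi R / N, and
   likewise for the roots of pib^sharp. So its spectral seminorm is given by
   divisibility, and Berkovich's argument (a minimal seminorm is multiplicative)
   produces points of M(A) which vanish on N.
   If phi lies over psi and psi vanishes on I, then phi vanishes on N by
   continuity. Conversely let r be outside N, and write r = (pib^sharp)^k s mod N
   with s not in pi R + N. As s = x^sharp mod p for some x, there is a phi
   vanishing on N with phi(x^sharp) >= |pi| > |pi|^p >= |p|. Every phi' with the
   same image psi in M(B) has phi'(x^sharp) = psi(x) = phi(x^sharp), hence
   phi'(s) > 0 and phi'(r) > 0. So it does not matter which preimage of
   psi is chosen, and the bijectivity of M(A) -> M(B) is not needed. *)
From HB Require Import structures.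
Require Import Defs.
From mathcomp Require Import all_boot all_order all_algebra ring.
From mathcomp Require Import boolp classical_sets reals.

Set Implicit Arguments.
Unset Strict Implicit.
Unset Printing Implicit Defensive.

Import Order.TTheory GRing.Theory Num.Theory.
Local Open Scope classical_set_scope.
Local Open Scope ring_scope.
Local Open Scope quotient_scope.

(** * Adic topologies and compatible systems of p-power roots *)

(** The algebra rests on a cancellation rule in W(S): over a perfect ring, if [a] divides p g, then
    [a] divides g. With p = xi c + [pib^p] w it lets xi be cancelled against powers of [pib], whence
    torsion-freeness and separatedness of W(S) / xi. Root-closedness needs more, namely that pib^p
    divides the zeroth coordinate of xi. The same fact shows that pi^p divides x^sharp exactly when
    pib^p divides x, and from this comes the pib-adic completeness of R^flat. The seminorm phi must
    satisfy two conditions at once: phi(pib^sharp) = |pi|, which boundedness forces, and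
    phi(x^sharp) >= |pi|. Both follow from a single prescribed value, at the product of pib^sharp
    and x^sharp. The p-power roots of pib^sharp serve to measure divisibility with exponents
    k/p^e. *)

Section AdicTheory.
Variables (A : comPzRingType).
Implicit Types a b x y z : A.

Lemma rdvd_refl a : rdvd a a.
Proof. by exists 1; rewrite mulr1. Qed.

Lemma rdvd1l x : rdvd 1 x.
Proof. by exists x; rewrite mul1r. Qed.

Lemma rdvd_trans b a x : rdvd a b -> rdvd b x -> rdvd a x.
Proof. by move=> ab [u ->]; exact: rdvd_mulr. Qed.

Lemma rdvd_exp a b n : rdvd a b -> rdvd (a ^+ n) (b ^+ n).
Proof. by move=> [u ->]; exists (u ^+ n); rewrite exprMn. Qed.

Lemma rdvd_exp2l a m n : (m <= n)%N -> rdvd (a ^+ m) (a ^+ n).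
Proof. by move=> /subnKC <-; exists (a ^+ (n - m)); rewrite exprD. Qed.

Lemma rdvd_subC a x y : rdvd a (x - y) -> rdvd a (y - x).
Proof. by move=> /rdvdN; rewrite opprB. Qed.

Lemma rdvd_sub_trans a y x z : rdvd a (x - y) -> rdvd a (y - z) -> rdvd a (x - z).
Proof. by move=> xy yz; rewrite -(subrK y x) -addrA; exact: rdvdD. Qed.

Lemma rdvd_sub_refl a x : rdvd a (x - x).
Proof. by rewrite subrr; exact: rdvd0. Qed.

Lemma rdvd_subD a x y z t :
  rdvd a (x - y) -> rdvd a (z - t) -> rdvd a (x + z - (y + t)).
Proof. by move=> xy zt; rewrite opprD addrACA; exact: rdvdD. Qed.

Lemma rdvd_subB a x y z t :
  rdvd a (x - y) -> rdvd a (z - t) -> rdvd a (x - z - (y - t)).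
Proof.
move=> xy zt; have -> : x - z - (y - t) = x - y - (z - t) by ring.
exact: rdvdB.
Qed.

Lemma rdvd_sub_tel a (u : nat -> A) :
  (forall n, rdvd (a ^+ n) (u n.+1 - u n)) ->
  forall m n, (m <= n)%N -> rdvd (a ^+ m) (u n - u m).
Proof.
move=> ua m n /subnKC <-; elim: (n - m)%N => [|k IH].
  by rewrite addn0; exact: rdvd_sub_refl.
rewrite addnS; apply: rdvd_sub_trans IH.
by apply: rdvd_trans (ua _); apply: rdvd_exp2l; exact: leq_addr.
Qed.

Lemma adic_sep_eq a x y : adic_separated a ->
  (forall n, rdvd (a ^+ n) (x - y)) -> x = y.
Proof. by move=> sep /sep /subr0_eq. Qed.

Lemma adic_lim_unique a u x y : adic_separated a ->
  adic_lim a u x -> adic_lim a u y -> x = y.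
Proof.
move=> sep ux uy; apply: (adic_sep_eq sep) => n.
have [M xM] := ux n; have [M' yM'] := uy n.
apply: (@rdvd_sub_trans _ (u (M + M')%N)).
  by apply: rdvd_subC; apply: xM; exact: leq_addr.
by apply: yM'; exact: leq_addl.
Qed.

Lemma adic_lim_tel a u l :
  (forall n, rdvd (a ^+ n) (u n - l)) -> adic_lim a u l.
Proof.
by move=> ul N; exists N => m Nm; apply: rdvd_trans (ul m); exact: rdvd_exp2l.
Qed.

Lemma adic_complete_tel a u : adic_complete a ->
  (forall n, rdvd (a ^+ n) (u n.+1 - u n)) ->
  exists l, forall n, rdvd (a ^+ n) (u n - l).
Proof.
move=> [_ cpl] ua; have tel := rdvd_sub_tel ua.
have [|l ul] := cpl u.
  move=> N; exists N => m n Nm Nn; apply: (@rdvd_sub_trans _ (u N)).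
    exact: tel.
  by apply: rdvd_subC; exact: tel.
exists l => n; have [M lM] := ul n.
apply: (@rdvd_sub_trans _ (u (n + M)%N)).
  by apply: rdvd_subC; apply: tel; exact: leq_addr.
by apply: lM; exact: leq_addl.
Qed.

(* [t N] is the a-adic sum of the series with terms [b ^+ i * d (N + i)]. *)
Lemma adic_horner a b (d : nat -> A) : adic_complete a -> rdvd a b ->
  exists t, forall n, t n = d n + b * t n.+1.
Proof.
move=> cpl ab; pose S N M := \sum_(i < M) b ^+ i * d (N + i)%N.
have Slim N : exists t, forall M, rdvd (a ^+ M) (S N M - t).
  apply: adic_complete_tel => // M; rewrite /S big_ord_recr /= addrAC subrr add0r.
  by apply: rdvd_mulr; exact: rdvd_exp.
have {Slim} [t tP] := choice Slim; exists t => N.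
apply: (adic_sep_eq cpl.1) => M; apply: (@rdvd_sub_trans _ (S N M.+1)).
  apply: rdvd_subC; apply: rdvd_trans (tP N M.+1); exact: rdvd_exp2l.
have -> : S N M.+1 = d N + b * S N.+1 M.
  rewrite /S big_ord_recl expr0 mul1r addn0 mulr_sumr; congr (_ + _).
  by apply: eq_bigr => i _; rewrite lift0 exprS -mulrA addSnnS.
by apply: rdvd_subD (rdvd_sub_refl _ _) _; rewrite -mulrBr; exact: rdvd_mull.
Qed.

(** The ideals generated by the powers of b are not known to be a-adically closed, so an a-adic
    limit need not be a b-adic one. Summing the telescoping series in Horner form makes each tail an
    explicit multiple of [b ^+ N]. *)
Lemma adic_complete_dvd a b : adic_complete a -> rdvd a b -> adic_complete b.
Proof.
move=> cpl ab; split.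
  by move=> x bx; apply: cpl.1 => n; apply: rdvd_trans (bx n); exact: rdvd_exp.
(* [g] is a monotone majorant of the modulus [f]. *)
move=> u /choice[f uf]; pose g n := (\sum_(i < n.+1) f i)%N.
have gS n : (g n <= g n.+1)%N by rewrite /g [leqRHS]big_ord_recr leq_addr.
have gf n : (f n <= g n)%N by rewrite /g big_ord_recr leq_addl.
have /choice[d dP] n : exists d, u (g n.+1) - u (g n) = b ^+ n * d.
  by apply: uf => //; exact: leq_trans (gS n).
have [t tP] := adic_horner d cpl ab.
exists (u (g 0) + t 0) => N.
have -> : u (g 0) + t 0 = u (g N) + b ^+ N * t N.
  elim: N => [|N ->]; first by rewrite mul1r.
  by move/(canRL (subrK _)): (dP N) => ->; rewrite tP exprSr; ring.
exists (f N) => m fm; rewrite opprD addrA; apply: rdvdB.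
  by apply: uf => //; exact: gf.
by apply: rdvd_mulr; exact: rdvd_refl.
Qed.

Lemma adic_complete_inv1B a b : adic_complete a -> rdvd a b ->
  exists t, (1 - b) * t = 1.
Proof.
move=> cpl ab; have [t tP] := adic_horner (fun=> 1) cpl ab.
exists (t 0); apply: (adic_sep_eq cpl.1) => n.
have -> : (1 - b) * t 0 - 1 = b ^+ n * ((1 - b) * t n - 1).
  by elim: n => [|n ->]; [rewrite mul1r|rewrite tP exprSr; ring].
by apply: rdvd_mulr; exact: rdvd_exp.
Qed.

End AdicTheory.

Section CompatibleSystems.
Variables (p : nat) (p_pr : prime p) (A : comPzRingType) (a : A).
Hypothesis a_dvd_p : rdvd a p%:R.

(** The cofactor of x - y in x^p - y^p is congruent to p y^(p-1) modulo a, and a divides p. *)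
Lemma rdvd_sub_expp n x y :
  rdvd (a ^+ n.+1) (x - y) -> rdvd (a ^+ n.+2) (x ^+ p - y ^+ p).
Proof.
move=> h; rewrite subrXX [_ ^+ n.+2]exprSr; apply: rdvd_mul => //.
have hp : rdvd a (x - y) by apply: rdvd_trans h; exact: (@rdvd_exp2l _ _ 1).
rewrite -[X in rdvd _ X](subrK (\sum_(i < p) y ^+ p.-1)); apply: rdvdD.
  rewrite -sumrB; apply: rdvd_sum => i _.
  have {2}-> : p.-1 = (p.-1 - i + i)%N.
    by rewrite subnK // -ltnS prednK ?prime_gt0.
  rewrite exprD; apply: rdvd_sub_mul; first exact: rdvd_sub_exp.
  exact: rdvd_sub_refl.
by rewrite sumr_const card_ord -mulr_natl; exact: rdvd_mulr.
Qed.

Lemma rdvd_sub_exppk k x y : rdvd a (x - y) ->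
  rdvd (a ^+ k.+1) (x ^+ (p ^ k) - y ^+ (p ^ k)).
Proof.
move=> h; elim: k => [|k IH]; first by rewrite expn0 !expr1.
by rewrite expnSr !exprM; exact: rdvd_sub_expp.
Qed.

Lemma compatible_iter (s : nat -> A) : (forall n, s n.+1 ^+ p = s n) ->
  forall k n, s (n + k)%N ^+ (p ^ k) = s n.
Proof.
move=> sP; elim=> [|k IH] n; first by rewrite addn0.
by rewrite addnS expnS exprM sP IH.
Qed.

Lemma compatible_unique (s t : nat -> A) : adic_separated a ->
  (forall n, s n.+1 ^+ p = s n) -> (forall n, t n.+1 ^+ p = t n) ->
  (forall n, rdvd a (s n - t n)) -> s = t.
Proof.
move=> sep sP tP st; apply/funext => n; apply: (adic_sep_eq sep) => k.
rewrite -(compatible_iter sP k) -(compatible_iter tP k).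
by apply: rdvd_trans (rdvd_sub_exppk _ (st _)); exact: rdvd_exp2l.
Qed.

(** The limits in k of [r (n + k) ^+ (p ^ k)]. The modulus may be any divisor of p: p itself
    describes R^flat, and pi^p serves for the completeness of R^flat. *)
Lemma compatible_lift (r : nat -> A) : adic_complete a ->
  (forall n, rdvd a (r n.+1 ^+ p - r n)) ->
  exists2 s, (forall n, s n.+1 ^+ p = s n) & forall n, rdvd a (r n - s n).
Proof.
move=> cpl rP; pose u n k := r (n + k)%N ^+ (p ^ k).
have uS n k : rdvd (a ^+ k.+1) (u n k.+1 - u n k).
  by rewrite /u addnS expnS exprM; apply: rdvd_sub_exppk; exact: rP.
have /choice[s sP] n : exists s, forall k, rdvd (a ^+ k) (u n k - s).
  apply: adic_complete_tel => // k; apply: rdvd_trans (uS n k).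
  exact: rdvd_exp2l.
exists s => n.
  apply: (adic_sep_eq cpl.1) => k.
  apply: (@rdvd_sub_trans _ _ (u n.+1 k ^+ p)).
    by apply: rdvd_subC; apply: rdvd_sub_exp; exact: sP.
  have -> : u n.+1 k ^+ p = u n k.+1 by rewrite /u -exprM -expnSr addSnnS.
  by apply: rdvd_trans (sP n k.+1); exact: rdvd_exp2l.
apply: (@rdvd_sub_trans _ _ (u n 1%N)); last exact: sP n 1%N.
by rewrite /u addn1 expn1; apply: rdvd_subC; exact: rP.
Qed.

End CompatibleSystems.

(** * Tilts *)

Section TiltTheory.
Variables (p : nat) (p_pr : prime p) (R : comPzRingType).
Local Notation T := (tilt p_pr R).
Local Notation P := (p%:R : R).
Implicit Types x y : T.

Lemma tilt_eq x y : (forall n, x n = y n) -> x = y.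
Proof. by move=> xy; apply/val_inj/funext. Qed.

Lemma tiltP x n : x n.+1 ^+ p = x n.
Proof. by case: x => u /= /asboolP. Qed.

Lemma tiltD x y n : (x + y) n = x n + y n. Proof. by []. Qed.
Lemma tiltM x y n : (x * y) n = x n * y n. Proof. by []. Qed.
Lemma tilt0 n : (0 : T) n = 0. Proof. by []. Qed.

Lemma tiltX x k n : (x ^+ k) n = x n ^+ k.
Proof. by elim: k => [|k IH]; rewrite ?expr0 // !exprS tiltM IH. Qed.

(** A named copy of the n-th component, to carry the ring morphism structure that [wmap] asks
    for. *)
Definition tilt_proj n (x : T) : pquot P := x n.

Lemma tilt_projB n : {morph tilt_proj n : x y / x - y}.
Proof. by []. Qed.

Lemma tilt_projM n : GRing.monoid_morphism (tilt_proj n).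
Proof. by []. Qed.

HB.instance Definition _ n :=
  GRing.isZmodMorphism.Build T (pquot P) (tilt_proj n) (tilt_projB n).
HB.instance Definition _ n :=
  GRing.isMonoidMorphism.Build T (pquot P) (tilt_proj n) (tilt_projM n).

Lemma tilt_pchar : p%:R = 0 :> T.
Proof.
apply: tilt_eq => n; rewrite -[LHS]/(tilt_proj n p%:R) rmorph_nat tilt0.
rewrite -(rmorph_nat (pq P)) -(rmorph0 (pq P)); apply/pqP.
by rewrite subr0; exact: rdvd_refl.
Qed.

Lemma tilt_root_subproof x : tilt_pred (fun n => x n.+1).
Proof. by apply/asboolP => n; exact: tiltP. Qed.

Definition tilt_root x : T := Tilt p_pr (tilt_root_subproof x).

Lemma tilt_rootK x : tilt_root x ^+ p = x.
Proof. by apply: tilt_eq => n; rewrite tiltX /= tiltP. Qed.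

Lemma tilt_expp_inj x y : x ^+ p = y ^+ p -> x = y.
Proof.
move=> xy; apply: tilt_eq => n.
by rewrite -!(tiltP _ n) -!tiltX xy.
Qed.

Lemma tilt_of_compatible (s : nat -> R) : (forall n, s n.+1 ^+ p = s n) ->
  {x : T | forall n, x n = pq P (s n)}.
Proof.
move=> sP; have sP' : tilt_pred (fun n => pq P (s n)).
  by apply/asboolP => n; rewrite -rmorphXn sP.
by exists (Tilt p_pr sP').
Qed.

Hypothesis R_complete : adic_complete P.

Lemma tilt_liftP x : (forall n, tilt_lift x n.+1 ^+ p = tilt_lift x n) /\
  (forall n, pq P (tilt_lift x n) = x n).
Proof.
pose S := [set r : nat -> R | (forall n, r n.+1 ^+ p = r n) /\
                          (forall n, pq p%:R (r n) = x n)].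
suff [s sP] : exists s, S s by exact: (xgetPex (fun=> 0) (ex_intro S s sP)).
have [|s sP rs] := compatible_lift p_pr (@rdvd_refl _ P) (r := repr \o x) R_complete.
  by move=> n /=; apply/pqP; rewrite rmorphXn /= !pqK tiltP.
by exists s; split=> // n; rewrite -(pqK (x n)); apply/esym/pqP; exact: rs.
Qed.

Lemma tilt_lift_exp x n : tilt_lift x n.+1 ^+ p = tilt_lift x n.
Proof. exact: (tilt_liftP x).1. Qed.

Lemma tilt_liftK x n : pq P (tilt_lift x n) = x n.
Proof. exact: (tilt_liftP x).2. Qed.

Lemma tilt_lift_expk x n k : tilt_lift x (n + k) ^+ (p ^ k) = tilt_lift x n.
Proof. exact: compatible_iter (tilt_lift_exp x) k n. Qed.

Lemma tilt_lift_unique x (s : nat -> R) : (forall n, s n.+1 ^+ p = s n) ->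
  (forall n, pq P (s n) = x n) -> tilt_lift x = s.
Proof.
move=> sP sx.
apply: (compatible_unique p_pr (@rdvd_refl _ P) R_complete.1) => // n.
  exact: tilt_lift_exp.
by apply/pqP; rewrite tilt_liftK sx.
Qed.

Lemma tilt_lift0 n : tilt_lift (0 : T) n = 0.
Proof.
suff -> : tilt_lift (0 : T) = fun=> 0 by [].
apply: tilt_lift_unique => k; last by rewrite rmorph0.
by rewrite expr0n -[(p == 0)%N]negbK -lt0n prime_gt0.
Qed.

Lemma tilt_lift1 n : tilt_lift (1 : T) n = 1.
Proof.
suff -> : tilt_lift (1 : T) = fun=> 1 by [].
by apply: tilt_lift_unique => k; rewrite ?expr1n ?rmorph1.
Qed.

Lemma tilt_liftM x y n : tilt_lift (x * y) n = tilt_lift x n * tilt_lift y n.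
Proof.
suff -> : tilt_lift (x * y) = fun n => tilt_lift x n * tilt_lift y n by [].
apply: tilt_lift_unique => k; first by rewrite exprMn !tilt_lift_exp.
by rewrite rmorphM /= !tilt_liftK.
Qed.

Lemma tilt_liftX x k n : tilt_lift (x ^+ k) n = tilt_lift x n ^+ k.
Proof. by elim: k => [|k IH]; rewrite ?tilt_lift1 // !exprS tilt_liftM IH. Qed.

Lemma tilt_lift_root x n : tilt_lift (tilt_root x) n = tilt_lift x n.+1.
Proof.
suff -> : tilt_lift (tilt_root x) = fun n => tilt_lift x n.+1 by [].
by apply: tilt_lift_unique => k; [exact: tilt_lift_exp|rewrite tilt_liftK].
Qed.

Lemma sharp_iter_root x n : sharp (iter n tilt_root x) = tilt_lift x n.
Proof.
elim: n x => [|n IH] x //.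
by rewrite iterSr IH tilt_lift_root.
Qed.

Lemma tilt_liftD_mod x y n :
  rdvd P (tilt_lift (x + y) n - (tilt_lift x n + tilt_lift y n)).
Proof. by apply/pqP; rewrite rmorphD /= !tilt_liftK tiltD. Qed.

Lemma tilt_liftB_mod x y n :
  rdvd P (tilt_lift (x - y) n - (tilt_lift x n - tilt_lift y n)).
Proof. by apply/pqP; rewrite rmorphB /= !tilt_liftK tiltD. Qed.

(** Each [tilt_lift x n] is a root of the unit [sharp x], hence a unit; uniqueness of inverses makes
    the inverses a compatible system. *)
Lemma sharp_unit x t : sharp x * t = 1 -> exists y, x * y = 1.
Proof.
move=> xt; have lu n : tilt_lift x n * (tilt_lift x n ^+ (p ^ n).-1 * t) = 1.
  rewrite mulrA -exprS prednK ?expn_gt0 ?prime_gt0 //.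
  by have := tilt_lift_expk x 0 n; rewrite add0n => ->.
have [n|y yP] := @tilt_of_compatible (fun n => tilt_lift x n ^+ (p ^ n).-1 * t).
  set u := _ * t; set v := _ * t.
  have xv : tilt_lift x n * v = 1 by exact: lu.
  have xu : tilt_lift x n * u ^+ p = 1.
    by rewrite -tilt_lift_exp -exprMn lu expr1n.
  by rewrite -[LHS]mul1r -xv mulrAC xu mul1r.
exists y; apply: tilt_eq => n.
by rewrite tiltM yP -tilt_liftK -rmorphM lu rmorph1.
Qed.

End TiltTheory.

(** * Witt vectors *)

Section WittTheory.
Variables (p : nat) (p_pr : prime p).
Local Notation W := (witt p_pr).

Lemma witt_eq (A : comPzRingType) (x y : W A) :
  (forall n, wcoord x n = wcoord y n) -> x = y.
Proof. by case: x y => [x] [y] /= xy; congr Witt; exact/funext. Qed.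

Section Functor.
Variables (A B : comPzRingType) (f : {rmorphism A -> B}).

Definition wmap (x : W A) : W B := Witt p_pr (f \o wcoord x).

Lemma wmapB : {morph wmap : x y / x - y}.
Proof.
move=> x y; congr Witt.
have -> : wcoord (x - y) = wadd (@weval) (wittD_poly p_pr) (wcoord x) (wcoord (- y)).
  by [].
rewrite (wadd_natural _ weval_comp); congr (wadd _ _ _ _).
exact: (wopp_natural _ weval_comp).
Qed.

Lemma wmapM : GRing.monoid_morphism wmap.
Proof.
split; first by congr Witt; exact: wone_natural.
by move=> x y; congr Witt; exact: (wmul_natural _ weval_comp).
Qed.

HB.instance Definition _ := GRing.isZmodMorphism.Build (W A) (W B) wmap wmapB.
HB.instance Definition _ := GRing.isMonoidMorphism.Build (W A) (W B) wmap wmapM.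

Lemma wmapE x n : wcoord (wmap x) n = f (wcoord x n). Proof. by []. Qed.

Lemma wmap_teich a : wmap (teich p_pr a) = teich p_pr (f a).
Proof. by apply: witt_eq => -[|n] //=; rewrite rmorph0. Qed.

End Functor.

Section GhostMap.
Variables (A : comPzRingType).

Definition wghost n (x : W A) : A := ghost p (wcoord x) n.

Lemma wghostD n : {morph wghost n : x y / x + y}.
Proof. by move=> x y; exact: witt_ghostD. Qed.

Lemma wghostB n : {morph wghost n : x y / x - y}.
Proof.
move=> x y; apply: (@addIr _ (wghost n y)).
by rewrite -wghostD !subrK.
Qed.

Lemma wghostM n : GRing.monoid_morphism (wghost n).
Proof.
split; first exact: (ghost_wone p_pr A n).
by move=> x y; exact: witt_ghostM.
Qed.

HB.instance Definition _ n :=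
  GRing.isZmodMorphism.Build (W A) A (wghost n) (wghostB n).
HB.instance Definition _ n :=
  GRing.isMonoidMorphism.Build (W A) A (wghost n) (wghostM n).

Lemma ghost_teich n (a : A) : wghost n (teich p_pr a) = a ^+ (p ^ n).
Proof.
rewrite /wghost /ghost big_ord_recl expr0 mul1r subn0 big1 ?addr0 // => i _.
by rewrite lift0 /= expr0n expn_eq0 -[(p == 0)%N]negbK -lt0n prime_gt0 //= mulr0.
Qed.

Lemma wcoord0D (x y : W A) : wcoord (x + y) 0 = wcoord x 0 + wcoord y 0.
Proof. by have := wghostD 0 x y; rewrite /wghost !ghost0. Qed.

Lemma wcoord0B (x y : W A) : wcoord (x - y) 0 = wcoord x 0 - wcoord y 0.
Proof. by have := wghostB 0 x y; rewrite /wghost !ghost0. Qed.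

Lemma wcoord0M (x y : W A) : wcoord (x * y) 0 = wcoord x 0 * wcoord y 0.
Proof. by have := (wghostM 0).2 x y; rewrite /wghost !ghost0. Qed.

Lemma wcoord0X (x : W A) k : wcoord (x ^+ k) 0 = wcoord x 0 ^+ k.
Proof. by elim: k => [|k IH] //; rewrite !exprS wcoord0M IH. Qed.

Lemma wcoord0_nat k : wcoord (k%:R : W A) 0 = k%:R.
Proof. by rewrite -(rmorph_nat (wghost 0)) /= /wghost ghost0. Qed.

Definition verschiebung (x : nat -> A) : W A :=
  Witt p_pr (fun n => if n is m.+1 then x m else 0).

Lemma ghost_verschiebung0 x : wghost 0 (verschiebung x) = 0.
Proof. exact: ghost0. Qed.

Lemma ghost_verschiebungS n x :
  wghost n.+1 (verschiebung x) = p%:R * ghost p x n.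
Proof.
rewrite /wghost /ghost big_ord_recl /= subn0 expr0 mul1r.
rewrite expr0n expn_eq0 -[(p == 0)%N]negbK -lt0n prime_gt0 //= add0r mulr_sumr.
by apply: eq_bigr => i _; rewrite /bump leq0n add1n subSS exprS -mulrA.
Qed.

(** The i-th term has i factors p in front, and n - i successive p-th powers improve a congruence
    modulo p by as many factors. *)
Lemma ghost_modp (x y : nat -> A) n : (forall i, rdvd p%:R (x i - y i)) ->
  rdvd (p%:R ^+ n.+1) (ghost p x n - ghost p y n).
Proof.
move=> xy; rewrite /ghost -sumrB; apply: rdvd_sum => i _; rewrite -mulrBr.
have {1}-> : n.+1 = (i + (n - i).+1)%N by rewrite addnS subnKC // -ltnS.
by rewrite exprD; apply: rdvd_mul; [exact: rdvd_refl|exact: rdvd_lift_iter].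
Qed.

End GhostMap.

Section TorsionFree.
Variable U : comPzRingType.
Hypothesis pI : forall f g : U, p%:R * f = p%:R * g -> f = g.

Lemma pmulXI n (f g : U) : rdvd (p%:R ^+ n.+1) (p%:R ^+ n * (f - g)) ->
  rdvd p%:R (f - g).
Proof.
move=> [h hE]; exists h; elim: n hE => [|n IH]; first by rewrite mul1r expr1.
by rewrite (exprS _ n) (exprS _ n.+1) -!mulrA => /pI.
Qed.

(** Converse of [ghost_modp] without p-torsion: once the lower coordinates agree modulo p, their
    terms vanish modulo p^(n+1), leaving p^n times the difference of the n-th coordinates. *)
Lemma witt_modp_ghost (x y : W U) :
  (forall n, rdvd (p%:R ^+ n.+1) (wghost n x - wghost n y)) ->
  forall n, rdvd p%:R (wcoord x n - wcoord y n).
Proof.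
move=> xy; elim/ltn_ind=> n IH; apply: (@pmulXI n).
have := xy n; rewrite /wghost /ghost !big_ord_recr /= subnn !expr1 opprD addrACA.
rewrite -mulrBr -sumrB; set s := \sum_(i < n) _ => sP.
have sp : rdvd (p%:R ^+ n.+1) s.
  apply: rdvd_sum => i _; rewrite -mulrBr.
  have {1}-> : n.+1 = (i + (n - i).+1)%N by rewrite addnS subnKC // ltnW.
  rewrite exprD; apply: rdvd_mul; first exact: rdvd_refl.
  by apply: rdvd_lift_iter => //; exact: IH.
by have := rdvdB sP sp; rewrite addrAC subrr add0r.
Qed.

Lemma witt_ghost_inj (x y : W U) : (forall n, wghost n x = wghost n y) -> x = y.
Proof. by move=> xy; apply/witt_eq/(ghost_inj pI). Qed.

Lemma teich_mul_torsion_free (a : U) (x : nat -> U) :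
  teich p_pr a * Witt p_pr x = Witt p_pr (fun n => a ^+ (p ^ n) * x n).
Proof.
apply: witt_ghost_inj => k; rewrite rmorphM /= ghost_teich /wghost /ghost.
rewrite mulr_sumr; apply: eq_bigr => i _ /=.
rewrite exprMn -exprM -expnD subnKC; last by rewrite -ltnS.
by rewrite mulrCA.
Qed.

Lemma teich_verschiebung_torsion_free (a : U) (x : nat -> U) :
  teich p_pr a + verschiebung x =
  Witt p_pr (fun n => if n is m.+1 then x m else a).
Proof.
apply: witt_ghost_inj => k; rewrite rmorphD /= ghost_teich.
case: k => [|k]; first by rewrite ghost_verschiebung0 /wghost ghost0 addr0.
rewrite ghost_verschiebungS /wghost /ghost [RHS]big_ord_recl /=.
rewrite expr0 mul1r subn0 mulr_sumr; congr (_ + _).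
by apply: eq_bigr => i _; rewrite /bump leq0n add1n subSS exprS -mulrA.
Qed.

Lemma pmul_witt_modp (x : nat -> U) n :
  rdvd p%:R (wcoord (p%:R * Witt p_pr x) n -
             wcoord (verschiebung (fun n => x n ^+ p)) n).
Proof.
apply: witt_modp_ghost => k; rewrite rmorphM rmorph_nat.
case: k => [|k].
  rewrite ghost_verschiebung0 subr0 expr1; apply: rdvd_mulr; exact: rdvd_refl.
rewrite ghost_verschiebungS -mulrBr -[GRing.RMorphism.sort _ _]/(ghost p x k.+1) ghostS addrAC subrr add0r.
by rewrite mulrA -exprS; apply: rdvd_mulr; exact: rdvd_refl.
Qed.

End TorsionFree.

Section Universal.
Variable A : comPzRingType.

(** Ghost components determine a Witt vector only in the absence of p-torsion. Identities are
    checked over this U and carried to A by [wmap v]. *)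
Lemma witt_universal (x y : nat -> A) :
  exists (U : comPzRingType) (v : {rmorphism U -> A}) (X Y : nat -> U),
    [/\ (forall f g : U, p%:R * f = p%:R * g -> f = g),
        (forall n, v (X n) = x n) & forall n, v (Y n) = y n].
Proof.
exists wpoly, (weval (wsubst x y)), (wvar 0), (wvar 1); split.
- exact: wpoly_pI.
- by move=> n; exact: weval_var.
- by move=> n; exact: weval_var.
Qed.

Lemma teich_mulE (a : A) (x : W A) n :
  wcoord (teich p_pr a * x) n = a ^+ (p ^ n) * wcoord x n.
Proof.
have [U [v [X [Y [pI vX vY]]]]] := witt_universal (wcoord x) (fun=> a).
have <- : wmap v (Witt p_pr X) = x by apply: witt_eq => k; exact: vX.
have <- : wmap v (teich p_pr (Y 0)) = teich p_pr a by rewrite wmap_teich vY.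
by rewrite -rmorphM teich_mul_torsion_free // !wmapE /= rmorphM rmorphXn /= vY.
Qed.

Lemma teichM (a b : A) : teich p_pr (a * b) = teich p_pr a * teich p_pr b.
Proof. by apply: witt_eq => -[|n]; rewrite teich_mulE ?expr1 ?mulr0. Qed.

Lemma teich1 : teich p_pr (1 : A) = 1.
Proof. by apply: witt_eq => -[|n]. Qed.

Lemma teich0 : teich p_pr (0 : A) = 0.
Proof. by apply: witt_eq => -[|n]. Qed.

Lemma teichX (a : A) k : teich p_pr (a ^+ k) = teich p_pr a ^+ k.
Proof. by elim: k => [|k IH]; rewrite ?teich1 // !exprS teichM IH. Qed.

Lemma teich_verschiebungE (a : A) (x : nat -> A) :
  teich p_pr a + verschiebung x =
  Witt p_pr (fun n => if n is m.+1 then x m else a).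
Proof.
have [U [v [X [Y [pI vX vY]]]]] := witt_universal x (fun=> a).
have <- : wmap v (verschiebung X) = verschiebung x.
  by apply: witt_eq => -[|k] /=; rewrite ?vX ?rmorph0.
have <- : wmap v (teich p_pr (Y 0)) = teich p_pr a by rewrite wmap_teich vY.
rewrite -rmorphD teich_verschiebung_torsion_free //.
by apply: witt_eq => -[|n] /=; rewrite ?vX ?vY.
Qed.

(* In characteristic p, multiplication by p is the composite of Verschiebung
   and Frobenius; universally this holds only modulo p, which suffices. *)
Lemma pmul_wittE (A_pchar : p%:R = 0 :> A) (x : W A) :
  p%:R * x = verschiebung (fun n => wcoord x n ^+ p).
Proof.
have [U [v [X [Y [pI vX _]]]]] := witt_universal (wcoord x) (fun=> 0).
have <- : wmap v (Witt p_pr X) = x by apply: witt_eq => k; exact: vX.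
rewrite -(rmorph_nat (@wmap _ _ v)) -rmorphM; apply: witt_eq => n.
have [h /(congr1 v)] := pmul_witt_modp pI X n.
rewrite rmorphM rmorphB rmorph_nat A_pchar mul0r => /subr0_eq.
by rewrite wmapE => ->; case: n => [|n] /=; rewrite ?rmorph0 ?rmorphXn.
Qed.

End Universal.
End WittTheory.

(** * Witt vectors over a perfect ring of characteristic p *)

Section PerfectWitt.
Variables (p : nat) (p_pr : prime p) (T : comPzRingType).
Hypothesis T_pchar : p%:R = 0 :> T.
Variable root : T -> T.
Hypothesis rootK : forall x, root x ^+ p = x.
Hypothesis expp_inj : forall x y : T, x ^+ p = y ^+ p -> x = y.
Local Notation W := (witt p_pr T).
Local Notation tei := (teich p_pr).

Lemma teich_pmulE (a : T) (g : W) :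
  tei a + p%:R * g = Witt p_pr (fun n => if n is m.+1 then wcoord g m ^+ p else a).
Proof. by rewrite (pmul_wittE T_pchar) teich_verschiebungE. Qed.

Lemma witt_split (w : W) :
  w = tei (wcoord w 0) + p%:R * Witt p_pr (fun n => root (wcoord w n.+1)).
Proof. by rewrite teich_pmulE; apply: witt_eq => -[|n] //=; rewrite rootK. Qed.

Lemma teich_pmul_inj (a b : T) (g h : W) :
  tei a + p%:R * g = tei b + p%:R * h -> a = b /\ g = h.
Proof.
rewrite !teich_pmulE => gh; split; first exact: (congr1 (fun w => wcoord w 0) gh).
by apply: witt_eq => n; apply/expp_inj/(congr1 (fun w => wcoord w n.+1) gh).
Qed.

Definition teich_sum (x : nat -> T) N : W := \sum_(n < N) tei (x n) * p%:R ^+ n.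

Lemma teich_sumS x N :
  teich_sum x N.+1 = tei (x 0) + p%:R * teich_sum (fun n => x n.+1) N.
Proof.
rewrite /teich_sum big_ord_recl expr0 mulr1 mulr_sumr; congr (_ + _).
by apply: eq_bigr => i _; rewrite lift0 exprS; ring.
Qed.

Lemma teich_sum_coord x N g i : (i < N)%N ->
  wcoord (teich_sum x N + p%:R ^+ N * g) i = x i ^+ (p ^ i).
Proof.
elim: N x i => // N IH x i iN.
rewrite teich_sumS exprS -mulrA -addrA -mulrDr teich_pmulE.
case: i iN => [|i] iN; first by rewrite expr1.
by rewrite -[LHS]/(wcoord _ i ^+ p) IH // -exprM -expnSr.
Qed.

(** The Teichmueller digits of w: by [teich_sum_coord], the n-th coordinate of a sum of [[x_i] p^i]
    is [x_n^(p^n)]. *)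
Definition wteich (w : W) n : T := iter n root (wcoord w n).

Lemma wteichK w n : wteich w n ^+ (p ^ n) = wcoord w n.
Proof.
rewrite /wteich; elim: n (wcoord w n) => [|n IH] x //.
by rewrite iterS expnS exprM rootK IH.
Qed.

Lemma witt_expansion w N : exists g, w = teich_sum (wteich w) N + p%:R ^+ N * g.
Proof.
elim: N w => [|N IH] w; first by exists w; rewrite /teich_sum big_ord0 add0r mul1r.
have [g gE] := IH (Witt p_pr (fun n => root (wcoord w n.+1))).
exists g; rewrite teich_sumS exprS -mulrA -addrA -mulrDr {1}(witt_split w).
congr (_ + _ * _); rewrite {1}gE; congr (_ + _); apply: eq_bigr => i _.
by congr (teich _ _ * _); rewrite /wteich /= -iterSr.
Qed.

Lemma witt_coord_eqP (w w' : W) N :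
  rdvd (p%:R ^+ N) (w - w') <-> forall i, (i < N)%N -> wcoord w i = wcoord w' i.
Proof.
have [g wE] := witt_expansion w N; have [g' w'E] := witt_expansion w' N; split.
  move=> [h /(canRL (subrK _))]; rewrite {1}w'E addrCA -mulrDr => ww i iN.
  by rewrite ww teich_sum_coord // wteichK.
move=> ww'; rewrite wE w'E opprD addrACA -mulrBr.
suff -> : teich_sum (wteich w) N = teich_sum (wteich w') N.
  by rewrite subrr add0r; apply: rdvd_mulr; exact: rdvd_refl.
by apply: eq_bigr => i _; rewrite /wteich ww'.
Qed.

Lemma adic_lim_wteich w : adic_lim p%:R (teich_sum (wteich w)) w.
Proof.
apply: adic_lim_tel => N; have [g {2}->] := witt_expansion w N.
by exists (- g); ring.
Qed.

Lemma expp_iter_inj k (x y : T) : x ^+ (p ^ k) = y ^+ (p ^ k) -> x = y.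
Proof.
elim: k => [|k IH]; first by rewrite expn0 !expr1.
by rewrite expnSr !exprM => /expp_inj.
Qed.

Lemma wteich_unique w x : adic_lim p%:R (teich_sum x) w -> x = wteich w.
Proof.
move=> xw; apply/funext => n; apply: (@expp_iter_inj n); rewrite wteichK.
have [M /(_ (n.+1 + M)%N (leq_addl _ _))] := xw n.+1.
move/witt_coord_eqP => /(_ n (ltnSn n)) <-.
rewrite -[teich_sum _ _]addr0 -(mulr0 (p%:R ^+ (n.+1 + M))) teich_sum_coord //.
exact: leq_addr.
Qed.

End PerfectWitt.

(** * The theta map and its kernel *)

Section Theta.
Variables (p : nat) (p_pr : prime p) (R : comPzRingType).
Local Notation P := (p%:R : R).
Local Notation Rb := (tilt p_pr R).
Local Notation W := (witt p_pr Rb).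
Hypothesis R_complete : adic_complete P.

Lemma tilt_teich_unique (w : W) x :
  teich_expansion w x -> x = wteich (@tilt_root p p_pr R) w.
Proof.
exact: (wteich_unique (tilt_pchar p_pr R) (@tilt_rootK _ p_pr R)
  (@tilt_expp_inj _ p_pr R)).
Qed.

Lemma tilt_teich_expansion (w : W) :
  teich_expansion w (wteich (@tilt_root p p_pr R) w).
Proof. exact: (adic_lim_wteich (tilt_pchar p_pr R) (@tilt_rootK _ p_pr R)). Qed.

(** The n-th digit is the p^n-th root of the n-th coordinate, and its sharp is the n-th component of
    the lift of that coordinate. So theta is computed from Witt coordinates without roots. *)
Lemma theta_partial (w : W) N :
  rdvd (P ^+ N) (\sum_(n < N) tilt_lift (wcoord w n) n * P ^+ n - theta w).
Proof.
pose u N := \sum_(n < N) tilt_lift (wcoord w n) n * P ^+ n.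
have [|l ul] := @adic_complete_tel _ P u R_complete.
  move=> n; rewrite /u big_ord_recr /= addrAC subrr add0r.
  by apply: rdvd_mull; exact: rdvd_refl.
suff -> : theta w = l by exact: ul.
have limE x : teich_expansion w x ->
    (fun N => \sum_(n < N) sharp (x n) * P ^+ n) = u.
  move=> /tilt_teich_unique ->; apply/funext => M; apply: eq_bigr => n _.
  by rewrite /wteich sharp_iter_root.
have ex : exists r, exists2 x, teich_expansion w x &
    adic_lim P (fun N => \sum_(n < N) sharp (x n) * P ^+ n) r.
  exists l, (wteich (@tilt_root p p_pr R) w); first exact: tilt_teich_expansion.
  by rewrite limE; [exact: adic_lim_tel|exact: tilt_teich_expansion].
have [x xw] := xgetPex 0 ex; rewrite limE // => uth.
by apply: adic_lim_unique R_complete.1 uth _; exact: adic_lim_tel.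
Qed.

Definition witt_lift n (w : W) : witt p_pr R :=
  Witt p_pr (fun i => tilt_lift (wcoord w i) n).

(* Modulo p^(n+1), theta is the n-th ghost map applied to the lifts of the n-th
   components; as a map out of W(R/p) this is a ring homomorphism. *)
Lemma theta_ghost (w : W) n :
  rdvd (P ^+ n.+1) (theta w - wghost n (witt_lift n w)).
Proof.
apply: rdvd_subC; have := theta_partial w n.+1; congr (rdvd _ (_ - _)).
apply: eq_bigr => i _; rewrite mulrC /=; congr (_ * _).
have le_in : (i <= n)%N by rewrite -ltnS.
by rewrite -(tilt_lift_expk R_complete _ i (n - i)) subnKC.
Qed.

Lemma wghost_pq n (x y : witt p_pr R) : wmap (pq P) x = wmap (pq P) y ->
  rdvd (P ^+ n.+1) (wghost n x - wghost n y).
Proof.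
move=> xy; apply: ghost_modp => // i; apply/pqP.
exact: (congr1 (fun w => wcoord w i) xy).
Qed.

Lemma wmap_witt_lift n (w : W) :
  wmap (pq P) (witt_lift n w) = wmap (@tilt_proj p p_pr R n) w.
Proof. by apply: witt_eq => i /=; rewrite tilt_liftK. Qed.

Lemma thetaB : {morph @theta p p_pr R : x y / x - y}.
Proof.
move=> x y; apply: (adic_sep_eq R_complete.1) => n.
apply: rdvd_trans (rdvd_exp2l _ (leqnSn n)) _.
apply: rdvd_sub_trans (theta_ghost _ n) _.
(* [witt_lift n] is not additive, but its reduction modulo p is, and modulo p^(n+1) the n-th ghost
   component sees only that reduction. *)
apply: (@rdvd_sub_trans _ _ (wghost n (witt_lift n x - witt_lift n y))).
  by apply: wghost_pq; rewrite rmorphB /= !wmap_witt_lift rmorphB.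
by rewrite rmorphB /=; apply/rdvd_subC/rdvd_subB; exact: theta_ghost.
Qed.

Lemma thetaM : GRing.monoid_morphism (@theta p p_pr R).
Proof.
split.
  apply: (adic_sep_eq R_complete.1) => n.
  apply: rdvd_trans (rdvd_exp2l _ (leqnSn n)) _.
  apply: rdvd_sub_trans (theta_ghost _ n) _.
  rewrite -[X in _ - X](rmorph1 (@wghost p p_pr R n)); apply: wghost_pq.
  by rewrite wmap_witt_lift !rmorph1.
move=> x y; apply: (adic_sep_eq R_complete.1) => n.
apply: rdvd_trans (rdvd_exp2l _ (leqnSn n)) _.
apply: rdvd_sub_trans (theta_ghost _ n) _.
apply: (@rdvd_sub_trans _ _ (wghost n (witt_lift n x * witt_lift n y))).
  by apply: wghost_pq; rewrite rmorphM /= !wmap_witt_lift rmorphM.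
rewrite rmorphM /=; apply: rdvd_subC.
by apply: rdvd_sub_mul; exact: theta_ghost.
Qed.

(** The completeness proof is an argument because the morphism structure on this term depends on
    it. *)
Definition theta_rmorph of adic_complete P : W -> R := @theta p p_pr R.

HB.instance Definition _ :=
  GRing.isZmodMorphism.Build W R (theta_rmorph R_complete) thetaB.
HB.instance Definition _ :=
  GRing.isMonoidMorphism.Build W R (theta_rmorph R_complete) thetaM.

Lemma theta_teich (x : Rb) : theta (teich p_pr x) = sharp x.
Proof.
apply: (adic_sep_eq R_complete.1) => n.
apply: rdvd_trans (rdvd_exp2l _ (leqnSn n)) _.
apply: rdvd_subC; have := theta_partial (teich p_pr x) n.+1.
rewrite big_ord_recl big1 => [|i _]; last by rewrite lift0 /= tilt_lift0 // mul0r.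
by rewrite mulr1 addr0.
Qed.

Hypothesis frob_surj : forall u : pquot P, exists v, v ^+ p = u.

Lemma sharp_surj_modp r : exists x : Rb, rdvd P (r - sharp x).
Proof.
have [g gP] := choice frob_surj.
pose u n := iter n g (pq P r).
have uP : tilt_pred u by apply/asboolP => n; exact: gP.
exists (Tilt p_pr uP); apply/pqP.
by rewrite /sharp tilt_liftK.
Qed.

Lemma theta_surj r : exists w : W, theta w = r.
Proof.
have /choice[f fP] (s : R) : exists xs : Rb * R, s = sharp xs.1 + P * xs.2.
  by have [x [t xt]] := sharp_surj_modp s; exists (x, t) => /=; rewrite -xt addrC subrK.
pose s n := iter n (fun t => (f t).2) r; pose x n := (f (s n)).1.
(* These are the coordinates of the sum of the [[x n] p^n], where r is the p-adic sum of the
   [sharp (x n) * p^n]. *)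
exists (Witt p_pr (fun n => x n ^+ (p ^ n))).
apply: (adic_sep_eq R_complete.1) => N; set w := Witt _ _.
apply: rdvd_sub_trans (rdvd_subC (theta_partial w N)) _.
have -> : r = \sum_(n < N) tilt_lift (wcoord w n) n * P ^+ n + P ^+ N * s N.
  elim: N => [|N IH]; first by rewrite big_ord0 add0r mul1r.
  rewrite {1}IH big_ord_recr -addrA /=; congr (_ + _).
  rewrite tilt_liftX // -[n in tilt_lift _ n](add0n N) tilt_lift_expk //.
  by rewrite {1}(fP (s N)) exprSr; rewrite /x /sharp; ring.
by rewrite opprD addrA subrr add0r; apply/rdvdN/rdvd_mulr/rdvd_refl.
Qed.

End Theta.

Section SharpMod.
Variables (p : nat) (p_pr : prime p) (R : comPzRingType) (a : R).
Local Notation Rb := (tilt p_pr R).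
Hypothesis R_complete : adic_complete (p%:R : R).
Hypothesis a_dvd_p : rdvd a p%:R.

(** [sharp] is additive only modulo p, which is enough modulo a divisor of p. *)
Definition sharp_mod of adic_complete (p%:R : R) & rdvd a p%:R :=
  fun x : Rb => pq a (sharp x) : pquot a.
Local Notation rho := (sharp_mod R_complete a_dvd_p).

Lemma sharp_modB : {morph rho : x y / x - y}.
Proof.
move=> x y; rewrite /sharp_mod -rmorphB; apply/pqP.
by apply: rdvd_trans a_dvd_p _; exact: tilt_liftB_mod.
Qed.

Lemma sharp_modM : GRing.monoid_morphism rho.
Proof.
rewrite /sharp_mod /sharp; split=> [|x y]; first by rewrite tilt_lift1 // rmorph1.
by rewrite tilt_liftM // rmorphM.
Qed.

HB.instance Definition _ :=
  GRing.isZmodMorphism.Build Rb (pquot a) rho sharp_modB.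
HB.instance Definition _ :=
  GRing.isMonoidMorphism.Build Rb (pquot a) rho sharp_modM.

Lemma sharp_mod_eq0 x : rho x = 0 <-> rdvd a (sharp x).
Proof. by rewrite -(rmorph0 (pq a)) /sharp_mod pqP subr0. Qed.

End SharpMod.

(** * The generator of the kernel of theta, and pib-adic completeness of the tilt *)

Section KernelTheta.
Variables (p : nat) (p_pr : prime p) (R : comPzRingType).
Local Notation Rb := (tilt p_pr R).
Local Notation W := (witt p_pr Rb).
Local Notation tei := (teich p_pr).
Variables (pi : R) (pib : Rb).
Hypothesis pi_complete : adic_complete pi.
Hypothesis pip_dvd_p : rdvd (pi ^+ p) p%:R.
Hypothesis pib_sharp : unit_multiple (sharp pib) pi.
Hypothesis frob_surj : forall u : pquot (p%:R : R), exists v, v ^+ p = u.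
Variable xi : W.
Hypothesis xiP : forall w, theta w = 0 <-> rdvd xi w.

Lemma pi_dvd_p : rdvd pi p%:R.
Proof.
apply: rdvd_trans pip_dvd_p; rewrite -[X in rdvd X _]expr1.
by apply: rdvd_exp2l; exact: prime_gt0.
Qed.

Lemma p_complete : adic_complete (p%:R : R).
Proof. exact: adic_complete_dvd pi_complete pi_dvd_p. Qed.

Let Rc := p_complete.
Local Notation th := (theta_rmorph Rc).

Lemma pi_pib_sharp k : exists2 v, pi ^+ k = v * sharp pib ^+ k & rdvd v 1.
Proof.
have [u [v [uv ->]]] := pib_sharp.
exists (v ^+ k); first by rewrite exprMn mulrA -exprMn [v * u]mulrC uv expr1n mul1r.
by exists (u ^+ k); rewrite -exprMn mulrC uv expr1n.
Qed.

Lemma theta_dvd_pib k s : rdvd (pi ^+ k) s -> exists w, s = theta (tei (pib ^+ k) * w).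
Proof.
move=> [t ->]; have [v -> _] := pi_pib_sharp k.
have [w wE] := theta_surj p_pr Rc frob_surj (v * t); exists w.
rewrite [RHS](rmorphM th) /= /theta_rmorph wE theta_teich // /sharp tilt_liftX //.
by rewrite mulrCA mulrA.
Qed.

(** As pi^p divides p, surjectivity of theta writes p as the image of some [[pib^p] w]. *)
Lemma xi_dvd_p_sub_teich : exists w c, p%:R - tei (pib ^+ p) * w = xi * c.
Proof.
have [w wE] := theta_dvd_pib pip_dvd_p; exists w; apply/xiP.
rewrite [LHS](rmorphB th) /= rmorph_nat /theta_rmorph -wE; exact: subrr.
Qed.

(** The sharp of 1 - z is congruent to 1 modulo pi, hence a unit of the pi-complete ring R;
    [sharp_unit] lifts this to R^flat. *)
Lemma one_sub_unit z : rdvd pi (sharp z) -> exists y, (1 - z : Rb) * y = 1.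
Proof.
move=> piz.
have h : rdvd pi (1 - sharp (1 - z)).
  have := rdvdB piz (rdvd_trans pi_dvd_p (tilt_liftB_mod Rc 1 z 0)).
  rewrite tilt_lift1 //; congr rdvd; rewrite /sharp; ring.
have [t tE] := adic_complete_inv1B pi_complete h.
by apply: (@sharp_unit _ _ _ Rc (1 - z) t); rewrite -tE; ring.
Qed.

(** Write xi = [x0] + p xi'. Then p (1 - xi' c) = [pib^p] w + [x0] c, and reduction by [sharp_mod]
    modulo pi shows that the zeroth coordinate of c is a unit. The zeroth coordinates of p - [pib^p]
    w = xi c then give the claim. *)
Lemma xi0_dvd : rdvd (pib ^+ p) (wcoord xi 0).
Proof.
have [w [c wc]] := xi_dvd_p_sub_teich.
have pchar := tilt_pchar p_pr R.
set x0 := wcoord xi 0.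
have [xi' xiE] : exists xi', xi = tei x0 + p%:R * xi'.
  by eexists; exact: (witt_split pchar (@tilt_rootK _ p_pr R) xi).
have pix0 : rdvd pi (sharp x0).
  have : theta xi = 0 by apply/xiP; exact: rdvd_refl.
  rewrite {1}xiE [LHS](rmorphD th) /= (rmorphM th) /= rmorph_nat.
  rewrite /theta_rmorph theta_teich // => /eqP; rewrite addr_eq0 => /eqP ->.
  by apply/rdvdN/rdvd_mulr/pi_dvd_p.
pose g := 1 - xi' * c.
have gE : p%:R * g = tei (pib ^+ p) * w + tei x0 * c.
  rewrite /g mulrBr mulr1 mulrA.
  have -> : p%:R * xi' = xi - tei x0 by rewrite xiE addrC addKr.
  by rewrite mulrBl -wc; ring.
pose rho : {rmorphism Rb -> pquot pi} := @sharp_mod p p_pr R pi Rc pi_dvd_p.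
have rho0 x : rho x = 0 <-> rdvd pi (sharp x) by exact: sharp_mod_eq0.
have pib0 : rho (pib ^+ p) = 0.
  apply/rho0; rewrite /sharp tilt_liftX //.
  have [u [v [_ e]]] := pib_sharp; rewrite -/(sharp _) e.
  rewrite -(prednK (prime_gt0 p_pr)) exprS; apply/rdvd_mulr/rdvd_mull/rdvd_refl.
(* Coordinate 1 of p g is the p-th power of coordinate 0 of g, and [rho] kills both Teichmueller
   factors on the right of [gE]. *)
have g0 : rho (wcoord g 0 ^+ p) = 0.
  have -> : wcoord g 0 ^+ p = wcoord (p%:R * g) 1 by rewrite (pmul_wittE pchar).
  rewrite gE -wmapE; set v := (X in wmap _ X); suff -> : wmap rho v = 0 by [].
  rewrite rmorphD !rmorphM /= !wmap_teich pib0.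
  by rewrite (iffRL (rho0 x0) pix0) teich0 !mul0r addr0.
have [y yE] := one_sub_unit (iffLR (rho0 _) g0).
(* The unit 1 - g_0^p has the factor 1 - g_0, which is the product of the zeroth coordinates of xi'
   and c. *)
have cu : exists y, wcoord c 0 * y = 1.
  move: yE; rewrite -{1}(expr1n _ p) subrXX.
  set s := \sum_(i < p) _.
  have -> : 1 - wcoord g 0 = wcoord xi' 0 * wcoord c 0.
    by rewrite /g wcoord0B wcoord0M opprB addrC subrK.
  by move=> yE; exists (wcoord xi' 0 * s * y); rewrite !mulrA [_ * wcoord xi' 0]mulrC.
have [z cz] := cu; exists (- (wcoord w 0 * z)).
have := congr1 (fun x => wcoord x 0) wc; rewrite wcoord0B !wcoord0M wcoord0_nat.
rewrite pchar sub0r -/x0.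
move=> /(congr1 (fun x => x * z)); rewrite -mulrA cz mulr1 => <-.
by rewrite mulNr -mulrA mulrN.
Qed.

(** For n = 0, some [[z] - [pib^p] w] is a multiple of xi, and [xi0_dvd] controls its zeroth
    coordinate. Taking p^n-th roots of z reduces to this case. *)
Lemma dvd_tilt_lift n (z : Rb) :
  rdvd (pi ^+ p) (tilt_lift z n) <-> rdvd (pib ^+ (p ^ n.+1)) z.
Proof.
split.
  rewrite -(sharp_iter_root Rc); set y := iter n _ z => yP.
  have zE : z = y ^+ (p ^ n).
    rewrite /y; elim: (n) => [|k IH]; first by rewrite expr1.
    by rewrite expnS exprM iterS tilt_rootK.
  rewrite zE expnS exprM; apply: rdvd_exp.
  have [w wE] := theta_dvd_pib yP.
  have /xiP[c cE] : theta (tei y - tei (pib ^+ p) * w) = 0.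
    by rewrite [LHS](rmorphB th) /= /theta_rmorph -wE theta_teich //; exact: subrr.
  have := congr1 (fun x => wcoord x 0) cE.
  rewrite wcoord0B !wcoord0M => /(canRL (subrK _)); rewrite -[wcoord (tei y) 0]/y => ->.
  apply: rdvdD; first by apply: rdvd_mulr; exact: xi0_dvd.
  by apply: rdvd_mulr; exact: rdvd_refl.
move=> [y ->]; rewrite tilt_liftM // tilt_liftX //; apply: rdvd_mulr.
rewrite expnSr exprM.
have -> : tilt_lift pib n ^+ (p ^ n) = sharp pib.
  by rewrite -[RHS](tilt_lift_expk Rc pib 0 n) add0n.
have [u [v [_ ->]]] := pib_sharp.
by apply: rdvd_exp; apply: rdvd_mull; exact: rdvd_refl.
Qed.

Lemma tilt_complete_tel (u : nat -> Rb) :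
  (forall n, rdvd (pib ^+ n) (u n.+1 - u n)) ->
  exists l, forall n, rdvd (pib ^+ n) (u n - l).
Proof.
move=> /rdvd_sub_tel utel.
have diffP n x y : rdvd (pib ^+ (p ^ n.+1)) (x - y) ->
    rdvd (pi ^+ p) (tilt_lift x n - tilt_lift y n).
  move=> /dvd_tilt_lift xy; rewrite -[X in rdvd _ X](subrK (tilt_lift (x - y) n)).
  apply: rdvdD xy; apply/rdvd_subC; apply: rdvd_trans pip_dvd_p _.
  exact: tilt_liftB_mod.
(* With the index p^(n+1) the differences of u are divisible by the power of pib that
   [dvd_tilt_lift] requires at level n, so r is compatible modulo pi^p. *)
pose r n := tilt_lift (u (p ^ n.+1)%N) n.
have pip_complete : adic_complete (pi ^+ p).
  apply: adic_complete_dvd pi_complete _.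
  rewrite -[X in rdvd X _]expr1; apply: rdvd_exp2l; exact: prime_gt0.
have leX m n : (m <= n)%N -> (p ^ m <= p ^ n)%N.
  by move=> mn; rewrite leq_exp2l // prime_gt1.
have [n|s sP rs] := compatible_lift p_pr pip_dvd_p (r := r) pip_complete.
  by rewrite /r tilt_lift_exp //; apply/diffP/utel/leX.
have [l lE] := tilt_of_compatible p_pr sP.
have ls : tilt_lift l = s by apply: tilt_lift_unique.
have ul n : rdvd (pib ^+ (p ^ n.+1)) (u (p ^ n.+1)%N - l).
  apply/dvd_tilt_lift; rewrite -[X in rdvd _ X](subrK (r n - s n)).
  apply: rdvdD (rs n); rewrite -ls; apply: rdvd_trans pip_dvd_p _.
  exact: tilt_liftB_mod.
exists l => n; have nn : (n <= p ^ n.+1)%N.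
  by apply/ltnW/(leq_trans (ltn_expl _ (prime_gt1 p_pr)))/leX.
apply: rdvd_sub_trans (rdvd_subC (utel _ _ nn)) _.
by apply: rdvd_trans (ul n); exact: rdvd_exp2l.
Qed.

End KernelTheta.

(** * Witt vectors modulo the generator of the kernel of theta *)

Section PerfectQuotient.
Variables (p : nat) (p_pr : prime p) (S : comPzRingType).
Hypothesis S_pchar : p%:R = 0 :> S.
Variable root : S -> S.
Hypothesis rootK : forall x, root x ^+ p = x.
Hypothesis expp_inj : forall x y : S, x ^+ p = y ^+ p -> x = y.
Local Notation W := (witt p_pr S).
Local Notation tei := (teich p_pr).

Lemma perfect_dvd_expp (a x : S) : rdvd (a ^+ p) (x ^+ p) -> rdvd a x.
Proof.
move=> [y xy]; exists (root y); apply: expp_inj.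
by rewrite exprMn rootK.
Qed.

Lemma dvd_teichP (a : S) (f : W) :
  (forall n, rdvd (a ^+ (p ^ n)) (wcoord f n)) -> rdvd (tei a) f.
Proof.
move=> /choice[g gP]; exists (Witt p_pr g).
by apply: witt_eq => n; rewrite teich_mulE.
Qed.

(** Coordinate n + 1 of p g is the p-th power of coordinate n of g, and in a perfect ring p-th roots
    can be extracted from a divisibility. *)
Lemma dvd_teich_pmul (a : S) (g : W) : rdvd (tei a) (p%:R * g) -> rdvd (tei a) g.
Proof.
move=> [h gh]; apply: dvd_teichP => n; apply: perfect_dvd_expp.
exists (wcoord h n.+1); rewrite -exprM -expnSr -teich_mulE -gh.
by rewrite (pmul_wittE S_pchar).
Qed.

Variable tau : S.
Hypothesis tau_tf : forall x, tau * x = 0 -> x = 0.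
Hypothesis tau_sep : adic_separated tau.
Hypothesis tau_tel : forall u : nat -> S,
  (forall n, rdvd (tau ^+ n) (u n.+1 - u n)) ->
  exists l, forall n, rdvd (tau ^+ n) (u n - l).
Variables xi w c : W.
Hypothesis xi_eq : p%:R - tei (tau ^+ p) * w = xi * c.
Hypothesis xi0 : rdvd (tau ^+ p) (wcoord xi 0).

Lemma p_eq_xi_teich : p%:R = xi * c + tei (tau ^+ p) * w.
Proof. by rewrite -xi_eq subrK. Qed.

Lemma dvd_teich_tau m n : (m <= n)%N -> rdvd (tei (tau ^+ m)) (tei (tau ^+ n)).
Proof. by move=> mn; rewrite !teichX; exact: rdvd_exp2l. Qed.

Lemma tau_expp : rdvd (tei tau) (tei (tau ^+ p)).
Proof. by rewrite -{1}(expr1 tau); apply: dvd_teich_tau; exact: prime_gt0. Qed.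

Lemma teich_tau_tf (f : W) : tei tau * f = 0 -> f = 0.
Proof.
move=> f0; apply: witt_eq => n.
have := congr1 (fun f => wcoord f n) f0; rewrite teich_mulE /=.
elim: (p ^ n)%N => [|k IH]; first by rewrite mul1r.
by rewrite exprS -mulrA => /tau_tf.
Qed.

(** If [tau] f = xi g, then p g = xi c g + [tau^p] w g is a multiple of [tau]. Hence so is g, and
    [tau] cancels. *)
Lemma xi_tau_tf (f : W) : rdvd xi (tei tau * f) -> rdvd xi f.
Proof.
move=> [g fg].
have /dvd_teich_pmul [h gh] : rdvd (tei tau) (p%:R * g).
  rewrite p_eq_xi_teich mulrDl mulrAC -fg -!mulrA; apply: rdvdD.
    by apply: rdvd_mulr; exact: rdvd_refl.
  by apply: rdvd_mulr; exact: tau_expp.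
exists h; apply: subr0_eq; apply: teich_tau_tf.
by rewrite mulrBr fg gh mulrCA subrr.
Qed.

(** In p h = xi c h + [tau^p] w h the last term has at least one factor [tau] more than h, so the
    power of [tau] dividing h climbs step by step up to m. *)
Lemma dvd_teich_xi_mul m (h : W) :
  rdvd (tei (tau ^+ m)) (xi * h) -> rdvd (tei (tau ^+ m)) h.
Proof.
move=> xh; suff H k : (k <= m)%N -> rdvd (tei (tau ^+ k)) h by exact: H.
elim: k => [|k IH] km; first by rewrite expr0 teich1; exact: rdvd1l.
apply: dvd_teich_pmul; rewrite p_eq_xi_teich mulrDl mulrAC; apply: rdvdD.
  by apply: rdvd_mulr; apply: rdvd_trans xh; exact: dvd_teich_tau.
rewrite -mulrA exprS teichM; apply: rdvd_mul; first exact: tau_expp.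
by apply: rdvd_mull; apply: IH; exact: ltnW.
Qed.

Lemma wmap_pq_eqP (a : S) (f g : W) :
  wmap (pq a) f = wmap (pq a) g <-> forall n, rdvd a (wcoord f n - wcoord g n).
Proof.
split=> [fg n|fg]; first by apply/pqP; exact: (congr1 (fun f => wcoord f n) fg).
by apply: witt_eq => n; apply/pqP.
Qed.

Lemma wmap_pq_teich (a : S) (f : W) : rdvd (tei a) f -> wmap (pq a) f = 0.
Proof.
move=> [g ->]; rewrite rmorphM /= wmap_teich /=.
have -> : pq a a = pq a 0 by apply/pqP; rewrite subr0; exact: rdvd_refl.
by rewrite rmorph0 teich0 mul0r.
Qed.

(** By [dvd_teich_xi_mul] the cofactors [h m] form a Cauchy sequence, whose coordinates converge in
    S. That f is xi times the limit is tested modulo each tau^m, where [tau^m] vanishes. *)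
Lemma xi_tau_sep (f : W) :
  (forall m, exists g h, f = tei (tau ^+ m) * g + xi * h) -> rdvd xi f.
Proof.
move=> /choice[g /choice[h fE]].
have hS m : rdvd (tei (tau ^+ m)) (h m.+1 - h m).
  apply: dvd_teich_xi_mul.
  have -> : xi * (h m.+1 - h m) =
      tei (tau ^+ m) * g m - tei (tau ^+ m.+1) * g m.+1.
    apply: (@addrI _ (xi * h m + tei (tau ^+ m.+1) * g m.+1)).
    by transitivity f; [rewrite [RHS](fE m.+1)|rewrite (fE m)]; ring.
  apply: rdvdB; apply: rdvd_mulr; first exact: rdvd_refl.
  by apply: dvd_teich_tau.
have /choice[l lP] n : exists l, forall m, rdvd (tau ^+ m) (wcoord (h m) n - l).
  apply: tau_tel => m; apply: (iffLR (wmap_pq_eqP _ _ _)).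
  by apply/eqP; rewrite -subr_eq0 -rmorphB; apply/eqP/wmap_pq_teich.
exists (Witt p_pr l); apply: witt_eq => n; apply: (adic_sep_eq tau_sep) => m.
apply: (iffLR (wmap_pq_eqP _ _ _)).
have hl : wmap (pq (tau ^+ m)) (h m) = wmap (pq (tau ^+ m)) (Witt p_pr l).
  by apply/wmap_pq_eqP => k; exact: lP.
rewrite {1}(fE m) rmorphD !rmorphM /= hl.
rewrite -[X in X + _](rmorphM (@wmap _ _ _ _ (pq (tau ^+ m)))) /=.
by rewrite wmap_pq_teich ?add0r //; apply: rdvd_mulr; exact: rdvd_refl.
Qed.

(** Coordinate 0 of f^p is divisible by a^p, as a^p divides tau^p and hence coordinate 0 of xi. So a
    divides coordinate 0 of f, and the rest of f is a multiple of p = xi c + [tau^p] w. *)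
Lemma xi_root_closed (a : S) (f : W) : rdvd a tau ->
  (exists g h, f ^+ p = tei (a ^+ p) * g + xi * h) ->
  exists g h, f = tei a * g + xi * h.
Proof.
move=> a_tau [g [h fE]].
have /perfect_dvd_expp[y f0] : rdvd (a ^+ p) (wcoord f 0 ^+ p).
  rewrite -wcoord0X fE wcoord0D !wcoord0M.
  apply: rdvdD; first exact/rdvd_mulr/rdvd_refl.
  by apply: rdvd_mulr; apply: rdvd_trans xi0; exact: rdvd_exp.
have := witt_split S_pchar rootK f; rewrite f0 => ->; set k := Witt _ _.
have [z za] : rdvd (tei a) (tei (tau ^+ p)).
  apply: rdvd_trans tau_expp; have [t ->] := a_tau.
  by rewrite teichM; apply: rdvd_mulr; exact: rdvd_refl.
exists (tei y + z * w * k), (c * k).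
by rewrite p_eq_xi_teich za teichM; ring.
Qed.

Local Notation Q := (pquot xi).
(** For tau the image of pib, these are compatible p-power roots of the image of pib^sharp. *)
Definition varpi e : Q := pq xi (tei (iter e root tau)).

Lemma rdvd_pq (a f : W) :
  rdvd (pq xi a) (pq xi f) <-> exists g h, f = a * g + xi * h.
Proof.
split=> [[u]|[g [h ->]]].
  rewrite -(pqK u) -rmorphM => /pqP[h /(canRL (subrK _)) ->].
  by exists (repr u), h; rewrite addrC.
exists (pq xi g); rewrite -rmorphM; apply/pqP.
by exists h; rewrite addrAC subrr add0r.
Qed.

Lemma varpiS e : varpi e.+1 ^+ p = varpi e.
Proof. by rewrite /varpi -rmorphXn /= -teichX rootK. Qed.

Lemma pq_eq0 (f : W) : pq xi f = 0 <-> rdvd xi f.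
Proof. by rewrite -(rmorph0 (pq xi)) pqP subr0. Qed.

Lemma varpi_tf (u : Q) : varpi 0 * u = 0 -> u = 0.
Proof. by rewrite -(pqK u) -rmorphM => /pq_eq0/xi_tau_tf/pq_eq0. Qed.

Lemma varpi_sep (u : Q) : (forall n, rdvd (varpi 0 ^+ n) u) -> u = 0.
Proof.
rewrite -(pqK u) => h; apply/pq_eq0/xi_tau_sep => m.
by rewrite teichX; apply/rdvd_pq; rewrite rmorphXn.
Qed.

Lemma varpi_root_closed e (u : Q) :
  rdvd (varpi e ^+ p) (u ^+ p) -> rdvd (varpi e) u.
Proof.
rewrite -(pqK u) -!rmorphXn => /rdvd_pq h; apply/rdvd_pq/xi_root_closed.
  elim: e {h} => [|e IH]; first exact: rdvd_refl.
  apply: rdvd_trans IH; rewrite -[iter e root tau]rootK -[X in rdvd X _]expr1.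
  by apply: rdvd_exp2l; exact: prime_gt0.
by rewrite teichX.
Qed.

End PerfectQuotient.

(** * Multiplicative seminorms *)

Section RealFacts.
Variable K : realType.
Implicit Types (x y z c : K) (E F : set K).

Definition nonneg_set E := forall x, E x -> 0 <= x.

Lemma nonneg_inf_le E x : nonneg_set E -> E x -> inf E <= x.
Proof. by move=> E0 Ex; apply: ge_inf => //; exists 0 => y; exact: E0. Qed.

Lemma le_inf_mul E F z : E !=set0 -> F !=set0 -> nonneg_set E -> nonneg_set F ->
  (forall x y, E x -> F y -> z <= x * y) -> z <= inf E * inf F.
Proof.
move=> nE nF E0 F0 zEF.
have scal x G : 0 <= x -> G !=set0 -> (forall y, G y -> z <= x * y) -> z <= x * inf G.
  move=> x0 nG zG; have [x_eq0|x_neq0] := eqVneq x 0.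
    by have [y /zG] := nG; rewrite x_eq0 !mul0r.
  have x_gt0 : 0 < x by rewrite lt_neqAle eq_sym x_neq0.
  rewrite -ler_pdivrMl //; apply: lb_le_inf => // y /zG.
  by rewrite ler_pdivrMl.
rewrite mulrC; apply: (scal) => //; first exact: lb_le_inf.
move=> x Ex; rewrite mulrC; apply: (scal) => //; first exact: E0.
by move=> y Fy; exact: zEF.
Qed.

Lemma exp_lt_small c e : 0 < c < 1 -> 0 < e -> exists n, c ^+ n < e.
Proof.
move=> /andP[c0 c1] e0.
pose d := c^-1 - 1.
have d0 : 0 < d by rewrite subr_gt0 invf_gt1.
have bern n : 1 + n%:R * d <= c^-1 ^+ n.
  elim: n => [|n IH]; first by rewrite mul0r addr0 expr0.
  rewrite exprS; have cE : c^-1 = 1 + d by rewrite /d addrC subrK.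
  have nd : 0 <= n%:R * d by rewrite mulr_ge0 ?ler0n // ltW.
  rewrite -natr1; move: IH nd; set u := _ ^+ n; set v := n%:R => IH nd.
  rewrite cE.
  have uvd : 0 <= u - (1 + v * d) by rewrite subr_ge0.
  have -> : (1 + d) * u = 1 + (v + 1) * d +
      ((u - (1 + v * d)) * (1 + d) + v * d * d) by ring.
  by rewrite lerDl addr_ge0 ?mulr_ge0 // ltW // addr_gt0.
exists (Num.bound (e^-1 * d^-1)); set n := Num.bound _.
have : e^-1 * d^-1 < n%:R by apply: archi_boundP; rewrite mulr_ge0 ?invr_ge0 ?ltW.
rewrite ltr_pdivrMr // => en.
have : e^-1 < c^-1 ^+ n by apply: lt_le_trans en (le_trans _ (bern n)); rewrite lerDr.
by rewrite exprVn ltf_pV2 ?posrE ?exprn_gt0.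
Qed.

Lemma nth_root_exists n t : (0 < n)%N -> 0 <= t -> exists2 s : K, 0 <= s & s ^+ n = t.
Proof.
move=> n0 t0; pose P : {poly K} := 'X^n - t%:P.
have PE x : P.[x] = x ^+ n - t by rewrite /P !hornerE.
have t1 : 0 <= t + 1 by rewrite addr_ge0.
have [|s /andP[s0 _]] := poly_ivt (p := P) t1.
  rewrite !PE expr0n -[(n == 0)%N]negbK -lt0n n0 sub0r oppr_le0 t0 subr_ge0 /=.
  apply: le_trans (_ : t + 1 <= _); first by rewrite lerDl.
  by apply: ler_eXnr => //; rewrite lerDr.
by rewrite /root PE subr_eq0 => /eqP; exists s.
Qed.

End RealFacts.

(** * Smoothing and minimal seminorms *)

Section Ultrametric.
Variables (p : nat) (p_pr : prime p) (K : realType) (Q : comPzRingType).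

(** The exponent p is enough in [ultraX]: its iterates keep the value at 1 equal to 1 under
    smoothing. *)
Record ultra_seminorm (q : Q -> K) : Prop := UltraSeminorm {
  ultra_ge0 : forall a, 0 <= q a;
  ultra0 : q 0 = 0;
  ultra1 : q 1 = 1;
  ultraD : forall a b, q (a + b) <= Num.max (q a) (q b);
  ultraM : forall a b, q (a * b) <= q a * q b;
  ultraX : forall a, q (a ^+ p) = q a ^+ p
}.

Definition scales (q : Q -> K) (h : Q) := forall a, q (h * a) = q h * q a.

Lemma ultraXn q a n : ultra_seminorm q -> q (a ^+ n) <= q a ^+ n.
Proof.
move=> qP; elim: n => [|n IH]; first by rewrite ultra1.
rewrite !exprS; apply: le_trans (ultraM qP _ _) _.
by rewrite ler_wpM2l // ultra_ge0.
Qed.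

Lemma ultraXpk q a k : ultra_seminorm q -> q (a ^+ (p ^ k)) = q a ^+ (p ^ k).
Proof.
move=> qP; elim: k => [|k IH]; first by rewrite !expr1.
by rewrite expnSr !exprM ultraX // IH.
Qed.

Section Smoothing.
Variables (q : Q -> K) (g : Q).
Hypotheses (qP : ultra_seminorm q) (g0 : 0 < q g).

Let u a n := q (a * g ^+ n) / q g ^+ n.
Let U a := [set x | exists n, x = u a n].
(** The sequence [u a] decreases, so this is its limit. Smoothing makes g multiplicative, preserves
    [q g], and keeps the elements that were multiplicative before. *)
Definition smoothing a : K := inf (U a).

Let U0 a : nonneg_set (U a).
Proof. by move=> _ [n ->]; rewrite mulr_ge0 ?invr_ge0 ?exprn_ge0 ?ultra_ge0. Qed.

Let Uu a n : U a (u a n). Proof. by exists n. Qed.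

Let nU a : U a !=set0. Proof. by exists (u a 0); exact: Uu. Qed.

Let le_u a n : smoothing a <= u a n.
Proof. exact: nonneg_inf_le. Qed.

Let ge_smoothing a z : (forall n, z <= u a n) -> z <= smoothing a.
Proof. by move=> zu; apply: lb_le_inf => // _ [n ->]. Qed.

Let gn0 n : 0 < q g ^+ n. Proof. exact: exprn_gt0. Qed.

Let u_decr a m n : (m <= n)%N -> u a n <= u a m.
Proof.
move=> /subnKC <-; move: (n - m)%N => k.
rewrite /u !exprD mulrA ler_pdivrMr ?mulr_gt0 // mulrA divfK ?gt_eqF //.
apply: le_trans (ultraM qP _ _) _.
by rewrite ler_wpM2l ?ultra_ge0 // ultraXn.
Qed.

Lemma smoothing_le a : smoothing a <= q a.
Proof. by apply: le_trans (le_u a 0) _; rewrite /u !expr0 mulr1 divr1. Qed.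

Lemma smoothing_ultra : ultra_seminorm smoothing.
Proof.
have sM a b : smoothing (a * b) <= smoothing a * smoothing b.
  apply: le_inf_mul => // _ _ [m ->] [n ->]; apply: le_trans (le_u _ (m + n)) _.
  rewrite /u mulf_div -exprD ler_pM2r ?invr_gt0 // exprD mulrACA.
  exact: ultraM.
have s0 a : 0 <= smoothing a by apply: lb_le_inf => //; exact: U0.
have s1 : smoothing 1 = 1.
  apply/eqP; rewrite eq_le; apply/andP; split.
    by apply: le_trans (smoothing_le 1) _; rewrite ultra1.
  apply: ge_smoothing => n.
  have np : (n <= p ^ n)%N by apply/ltnW/ltn_expl/prime_gt1.
  apply: le_trans (u_decr 1 np).
  by rewrite /u mul1r ultraXpk // divff // gt_eqF.
split=> //.
- by apply/eqP; rewrite eq_le s0 andbT -(ultra0 qP) smoothing_le.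
- move=> a b; rewrite leNgt; apply/negP => h.
  have [m ua] : exists m, u a m < smoothing (a + b).
    have /inf_lt[//|_ [m ->] ?] : smoothing a < smoothing (a + b).
      by apply: le_lt_trans h; rewrite le_max lexx.
    by exists m.
  have [n ub] : exists n, u b n < smoothing (a + b).
    have /inf_lt[//|_ [n ->] ?] : smoothing b < smoothing (a + b).
      by apply: le_lt_trans h; rewrite le_max lexx orbT.
    by exists n.
  have := le_u (a + b) (m + n)%N; apply/negP; rewrite -ltNge.
  apply: (@le_lt_trans _ _ (Num.max (u a (m + n)%N) (u b (m + n)%N))).
    rewrite /u mulrDl ler_pdivrMr // maxr_pMl; last exact: ltW.
    by rewrite !divfK ?gt_eqF // ultraD.
  rewrite gt_max (le_lt_trans (u_decr _ (leq_addr _ _)) ua).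
  by rewrite (le_lt_trans (u_decr _ (leq_addl _ _)) ub).
- move=> a; apply/eqP; rewrite eq_le; apply/andP; split.
    elim: (p) => [|k IH]; first by rewrite s1.
    by rewrite !exprS; apply: le_trans (sM _ _) _; rewrite ler_wpM2l.
  apply: ge_smoothing => n.
  (* At the index n p the argument a^p g^(n p) is a p-th power, to which [ultraX] applies. *)
  have np : (n <= n * p)%N by rewrite leq_pmulr // prime_gt0.
  apply: le_trans (u_decr _ np).
  have -> : u (a ^+ p) (n * p) = u a n ^+ p.
    by rewrite /u !exprM -exprMn ultraX // expr_div_n.
  by rewrite lerXn2r ?nnegrE ?le_u //; apply: le_trans (s0 a) (le_u a n).
Qed.

Lemma smoothing_scales h : scales q h -> scales smoothing h /\ smoothing h = q h.
Proof.
move=> hq.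
have ge a : q h * smoothing a <= smoothing (h * a).
  by apply: ge_smoothing => n; rewrite /u -mulrA hq -mulrA ler_wpM2l ?ultra_ge0 ?le_u.
have hE : smoothing h = q h.
  apply/eqP; rewrite eq_le smoothing_le /=.
  by have := ge 1; rewrite mulr1 (ultra1 smoothing_ultra) mulr1.
split=> // a; apply/eqP; rewrite eq_le (ultraM smoothing_ultra) /=.
by rewrite hE ge.
Qed.

Lemma smoothing_scales_self : scales smoothing g /\ smoothing g = q g.
Proof.
have ge a : q g * smoothing a <= smoothing (g * a).
  apply: ge_smoothing => n; have -> : u (g * a) n = q g * u a n.+1.
    rewrite /u !exprS; have -> : g * a * g ^+ n = a * (g * g ^+ n) by ring.
    by field; rewrite !gt_eqF.
  by rewrite ler_pM2l.
have gE : smoothing g = q g.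
  apply/eqP; rewrite eq_le smoothing_le /=.
  by have := ge 1; rewrite mulr1 (ultra1 smoothing_ultra) mulr1.
split=> // a; apply/eqP; rewrite eq_le (ultraM smoothing_ultra) /=.
by rewrite gE ge.
Qed.

End Smoothing.

(* A minimal power-multiplicative seminorm below [q0] coincides with all of its
   smoothings, and is therefore multiplicative. *)
Lemma multiplicative_below (q0 : Q -> K) (h : Q) :
  ultra_seminorm q0 -> 0 < q0 h ->
  exists q, [/\ ultra_seminorm q, (forall a, q a <= q0 a),
                (forall a b, q (a * b) = q a * q b) & q h = q0 h].
Proof.
move=> q0P h0.
(* Multiplicativity of h is part of the condition because it makes further smoothings preserve
   [q h]. *)
pose F q := [/\ ultra_seminorm q, (forall a, q a <= q0 a), scales q h & q h = q0 h].
have F1 : F (smoothing q0 h).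
  have [sc sh] := smoothing_scales_self q0P h0.
  by split=> //; [exact: smoothing_ultra|exact: smoothing_le].
pose T := {q : Q -> K | F q}.
(* The order is reversed: maximal elements are minimal seminorms. *)
pose R (s t : T) := `[< forall a, sval t a <= sval s a >].
have [|||[q [qP qq0 qh qhE]] qmin] := @ZL_preorder T (exist _ _ F1) R.
- by move=> t; apply/asboolP.
- move=> r s t /asboolP rs /asboolP st; apply/asboolP => a.
  exact: le_trans (st a) (rs a).
- move=> C Ctot; have [C0|nC] := pselect (C = set0).
    by exists (exist _ _ F1) => s; rewrite C0.
  have [t0 Ct0] : C !=set0 by apply/set0P/eqP.
  pose V a := [set x | exists2 t, C t & x = sval t a].
  pose q a := inf (V a).
  have tP (t : T) : F (sval t) by exact: svalP.
  have tU (t : T) : ultra_seminorm (sval t) by case: (tP t).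
  have V0 a : nonneg_set (V a).
    by move=> _ [t Ct ->]; apply: ultra_ge0; exact: tU.
  have nV a : V a !=set0 by exists (sval t0 a), t0.
  have le_V t a : C t -> q a <= sval t a.
    by move=> Ct; apply: nonneg_inf_le => //; exists t.
  have ge_q a z : (forall t, C t -> z <= sval t a) -> z <= q a.
    by move=> zV; apply: lb_le_inf => // _ [t Ct ->]; exact: zV.
  have lt_q a z : q a < z -> exists2 t, C t & sval t a < z.
    by move=> /inf_lt[//|_ [t Ct ->] tz]; exists t.
  have dir s t : C s -> C t -> exists2 r, C r &
      forall a, sval r a <= sval s a /\ sval r a <= sval t a.
    move=> Cs Ct; have [/asboolP st|/asboolP ts] := Ctot _ _ Cs Ct.
      by exists t.
    by exists s.
  have qU : ultra_seminorm q.
    have q_ge0 a : 0 <= q a by apply: lb_le_inf => //; exact: V0.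
    have q1 : q 1 = 1.
      apply/eqP; rewrite eq_le; apply/andP; split.
        by rewrite -(ultra1 (tU t0)); exact: le_V.
      by apply: ge_q => t _; rewrite ultra1.
    have qM a b : q (a * b) <= q a * q b.
      apply: le_inf_mul => // _ _ [s Cs ->] [t Ct ->].
      have [r Cr rst] := dir s t Cs Ct.
      apply: le_trans (le_V r _ Cr) _; apply: le_trans (ultraM (tU r) _ _) _.
      have [ra _] := rst a; have [_ rb] := rst b.
      by apply: ler_pM => //; apply: ultra_ge0; exact: tU.
    split=> //.
    + by apply/eqP; rewrite eq_le q_ge0 andbT -(ultra0 (tU t0)) le_V.
    + move=> a b; rewrite leNgt; apply/negP; rewrite gt_max => /andP[].
      move=> /lt_q[s Cs sa] /lt_q[t Ct tb]; have [r Cr rst] := dir s t Cs Ct.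
      have := le_V r (a + b) Cr; apply/negP; rewrite -ltNge.
      apply: le_lt_trans (ultraD (tU r) _ _) _; rewrite gt_max.
      rewrite (le_lt_trans (rst a).1 sa) (le_lt_trans (rst b).2 tb).
      by [].
    + move=> a; apply/eqP; rewrite eq_le; apply/andP; split.
        elim: (p) => [|k IH]; first by rewrite q1.
        by rewrite !exprS; apply: le_trans (qM _ _) _; rewrite ler_wpM2l.
      apply: ge_q => t Ct; rewrite ultraX // lerXn2r ?nnegrE //.
        exact: ultra_ge0.
      exact: le_V.
  have qh : q h = q0 h.
    apply/eqP; rewrite eq_le; apply/andP; split.
      by have [_ _ _ <-] := tP t0; exact: le_V.
    by apply: ge_q => t _; have [_ _ _ ->] := tP t.
  suff Fq : F q by exists (exist _ q Fq) => s Cs; apply/asboolP => a; exact: le_V.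
  split=> //.
    by move=> a; have [_ le0 _ _] := tP t0; exact: le_trans (le_V _ _ Ct0) (le0 a).
  move=> a; apply/eqP; rewrite eq_le (ultraM qU) /=; apply: ge_q => t Ct.
  have [_ _ sc tq] := tP t; rewrite sc qh tq ler_wpM2l ?le_V //.
  by rewrite -tq; apply: ultra_ge0; exact: tU.
exists q; split=> // g a; have [g0|] := ltP 0 (q g); last first.
  move=> g0; have {}g0 : q g = 0 by apply/eqP; rewrite eq_le g0 ultra_ge0.
  apply/eqP; rewrite g0 mul0r eq_le ultra_ge0 // andbT.
  by apply: le_trans (ultraM qP _ _) _; rewrite g0 mul0r.
have [sc sg] := smoothing_scales_self qP g0.
have [sch sh] := smoothing_scales qP g0 qh.
have Fs : F (smoothing q g).
  split=> //; last by rewrite sh.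
    exact: smoothing_ultra.
  by move=> b; apply: le_trans (smoothing_le g qP b) _.
have /asboolP /= qs := qmin (exist _ _ Fs) (asboolT (smoothing_le g qP)).
have {}qs : q = smoothing q g.
  by apply/funext => b; apply/eqP; rewrite eq_le qs smoothing_le.
by rewrite qs sc.
Qed.

End Ultrametric.

(** * The spectral seminorm of a root-closed ring *)

Section Gauge.
Variables (p : nat) (p_pr : prime p) (K : realType) (Q : comPzRingType).
Variable varpi : nat -> Q.
Hypothesis varpiS : forall e, varpi e.+1 ^+ p = varpi e.
Hypothesis varpi0_tf : forall r, varpi 0 * r = 0 -> r = 0.
Hypothesis root_closed : forall e r, rdvd (varpi e ^+ p) (r ^+ p) -> rdvd (varpi e) r.
Variable c : K.
Hypothesis c01 : 0 < c < 1.

Let c0 : 0 < c. Proof. by case/andP: c01. Qed.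
Let c1 : c < 1. Proof. by case/andP: c01. Qed.

Lemma varpi_expk e d : varpi (e + d) ^+ (p ^ d) = varpi e.
Proof. exact: compatible_iter varpiS d e. Qed.

Lemma varpi_tors_free e k r : varpi e ^+ k * r = 0 -> r = 0.
Proof.
elim: k r => [|k IH] r; first by rewrite mul1r.
rewrite exprS -mulrA => /(congr1 ( *%R (varpi e ^+ (p ^ e).-1))).
rewrite mulr0 mulrA -exprSr prednK ?expn_gt0 ?prime_gt0 //.
by have := varpi_expk 0 e; rewrite add0n => -> /varpi0_tf/IH.
Qed.

Lemma rdvd_varpi_cancel e k r s :
  rdvd (varpi e ^+ k * r) (varpi e ^+ k * s) -> rdvd r s.
Proof.
move=> [t st]; exists t; apply: subr0_eq; apply: (@varpi_tors_free e k).
by rewrite mulrBr st mulrA subrr.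
Qed.

Lemma root_closedX e k r : rdvd (varpi e ^+ (p * k)) (r ^+ p) -> rdvd (varpi e ^+ k) r.
Proof.
elim: k r => [|k IH] r; first by move=> _; exact: rdvd1l.
move=> h; have [|s rE] := @root_closed e r.
  by apply: rdvd_trans h; apply: rdvd_exp2l; rewrite mulnS leq_addr.
rewrite rE exprS; apply: rdvd_mul; first exact: rdvd_refl.
apply/IH/(@rdvd_varpi_cancel e p).
by rewrite -exprD -mulnS -exprMn -rE.
Qed.

(* [gauge r] is the spectral seminorm of r for the [varpi 0]-adic filtration,
   normalised by [gauge (varpi 0) = c]; root-closedness allows to express
   [r ^+ (p ^ e)] being divisible by [varpi 0 ^+ k] as divisibility of r by
   [varpi e ^+ k], which makes it visibly ultrametric. *)
Definition gauge_set (r : Q) : set K :=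
  [set t | 0 <= t /\ exists e k, rdvd (varpi e ^+ k) r /\ c ^+ k <= t ^+ (p ^ e)].

Definition gauge r : K := inf (gauge_set r).

Lemma gauge_set_up r t t' : t <= t' -> gauge_set r t -> gauge_set r t'.
Proof.
move=> tt' [t0 [e [k [dv ct]]]]; split; first exact: le_trans tt'.
exists e, k; split=> //; apply: le_trans ct _.
by rewrite lerXn2r ?nnegrE // (le_trans t0).
Qed.

(** The exponent k / p^e is rewritten with the denominator p^(e+d), which brings two witnesses to a
    common level. *)
Lemma gauge_set_lift r t d e k : 0 <= t ->
  rdvd (varpi e ^+ k) r /\ c ^+ k <= t ^+ (p ^ e) ->
  rdvd (varpi (e + d) ^+ (p ^ d * k)) r /\ c ^+ (p ^ d * k) <= t ^+ (p ^ (e + d)).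
Proof.
move=> t0 [dv ct]; rewrite exprM varpi_expk; split=> //.
by rewrite mulnC exprM expnD exprM lerXn2r ?nnegrE ?exprn_ge0 // ltW.
Qed.

Lemma gauge_set_common r s t u : gauge_set r t -> gauge_set s u ->
  exists e k l, [/\ rdvd (varpi e ^+ k) r, c ^+ k <= t ^+ (p ^ e),
                    rdvd (varpi e ^+ l) s & c ^+ l <= u ^+ (p ^ e)].
Proof.
move=> [t0 [e [k tP]]] [u0 [f [l uP]]].
have [d1 t1] := gauge_set_lift f t0 tP; have [d2 u1] := gauge_set_lift e u0 uP.
rewrite (addnC f e) in d2 u1.
by exists (e + f)%N, (p ^ f * k)%N, (p ^ e * l)%N.
Qed.

Lemma gauge_set_ge0 r : nonneg_set (gauge_set r).
Proof. by move=> t []. Qed.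

Lemma gauge_set1 r : gauge_set r 1.
Proof.
split=> //; exists 0%N, 0%N; rewrite expr0 expr1n; split=> //; exact: rdvd1l.
Qed.

Lemma gauge_le r t : gauge_set r t -> gauge r <= t.
Proof. by apply: nonneg_inf_le; exact: gauge_set_ge0. Qed.

Lemma gauge_ge r z : (forall t, gauge_set r t -> z <= t) -> z <= gauge r.
Proof. by apply: lb_le_inf; exists 1; exact: gauge_set1. Qed.

Lemma gauge_ge0 r : 0 <= gauge r.
Proof. by apply: gauge_ge => t []. Qed.

Lemma gauge_le1 r : gauge r <= 1.
Proof. exact/gauge_le/gauge_set1. Qed.

Lemma gauge0 : gauge 0 = 0.
Proof.
apply/eqP; rewrite eq_le gauge_ge0 andbT leNgt; apply/negP => g0.
have [n cn] := exp_lt_small c01 g0.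
have := @gauge_le 0 (c ^+ n); rewrite leNgt cn => /(_ _)/negP; apply; split.
  by rewrite exprn_ge0 // ltW.
by exists 0%N, n; rewrite expr1; split=> //; exact: rdvd0.
Qed.

Lemma gaugeD r s : gauge (r + s) <= Num.max (gauge r) (gauge s).
Proof.
rewrite leNgt; apply/negP; rewrite gt_max => /andP[rz sz].
have [//|t rt tz] := @inf_lt _ (gauge_set r) (gauge (r + s)) _ rz.
  by exists 1; exact: gauge_set1.
have [//|u su uz] := @inf_lt _ (gauge_set s) (gauge (r + s)) _ sz.
  by exists 1; exact: gauge_set1.
pose m := Num.max t u.
have mz : m < gauge (r + s) by rewrite gt_max tz uz.
have rm : gauge_set r m by apply: gauge_set_up rt; rewrite le_max lexx.
have sm : gauge_set s m by apply: gauge_set_up su; rewrite le_max lexx orbT.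
have [e [k [l [dr cr ds cs]]]] := gauge_set_common rm sm.
have : gauge (r + s) <= m.
  apply: gauge_le; split; first by case: rm.
  exists e, (minn k l); split.
    apply: rdvdD; [apply: rdvd_trans dr|apply: rdvd_trans ds].
      by apply: rdvd_exp2l; exact: geq_minl.
    by apply: rdvd_exp2l; exact: geq_minr.
  by case: (leqP k l).
by rewrite leNgt mz.
Qed.

Lemma gaugeM r s : gauge (r * s) <= gauge r * gauge s.
Proof.
apply: le_inf_mul; try exact: gauge_set_ge0; try by exists 1; exact: gauge_set1.
move=> t u rt su; have [e [k [l [dr cr ds cs]]]] := gauge_set_common rt su.
have [t0 _] := rt; have [u0 _] := su.
apply: gauge_le; split; first exact: mulr_ge0.
exists e, (k + l)%N; rewrite !exprD exprMn; split; first exact: rdvd_mul.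
by rewrite ler_pM // exprn_ge0 // ltW.
Qed.

(** For the lower bound, a witness (e, k) for r^p and t becomes a witness (e + 1, k) for r and the
    p-th root of t, by root-closedness. *)
Lemma gaugeX r : gauge (r ^+ p) = gauge r ^+ p.
Proof.
apply/eqP; rewrite eq_le; apply/andP; split.
  elim: (p) => [|n IH]; first by rewrite expr0 gauge_le1.
  rewrite !exprS; apply: le_trans (gaugeM _ _) _.
  by rewrite ler_wpM2l // gauge_ge0.
apply: gauge_ge => t [t0 [e [k [dv ct]]]].
have [s s0 st] := nth_root_exists (prime_gt0 p_pr) t0.
rewrite -st lerXn2r ?nnegrE ?gauge_ge0 //; apply: gauge_le; split=> //.
exists e.+1, k; rewrite expnS exprM st; split=> //.
by apply: root_closedX; rewrite exprM varpiS.
Qed.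

Variable x : Q.
Hypothesis x_ndvd : ~ rdvd (varpi 0) x.

Lemma gauge1 : gauge 1 = 1.
Proof.
apply/eqP; rewrite eq_le gauge_le1 /=; apply: gauge_ge => t [t0 [e [k [dv ct]]]].
case: k dv ct => [|k] dv ct.
  move: ct; rewrite expr0 leNgt => /negP; rewrite leNgt => ct; apply/negP => t1.
  by apply: ct; rewrite exprn_ilt1 // -lt0n expn_gt0 prime_gt0.
(* A positive power of [varpi e] dividing 1 would make [varpi 0] a unit. *)
case: x_ndvd; rewrite -(varpi_expk 0 e) add0n -[x]mul1r; apply: rdvd_mulr.
rewrite -(expr1n _ (p ^ e)); apply: rdvd_exp; apply: rdvd_trans dv.
by rewrite exprS; apply: rdvd_mulr; exact: rdvd_refl.
Qed.

Lemma gauge_ultra : ultra_seminorm p gauge.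
Proof.
split; [exact: gauge_ge0|exact: gauge0|exact: gauge1|exact: gaugeD|
        exact: gaugeM|exact: gaugeX].
Qed.

Lemma gauge_varpi : gauge (varpi 0) <= c.
Proof.
apply: gauge_le; split; first exact: ltW.
by exists 0%N, 1%N; rewrite !expr1; split=> //; exact: rdvd_refl.
Qed.

Lemma gauge_varpiM r : c * gauge r <= gauge (varpi 0 * r).
Proof.
apply: gauge_ge => t [t0 [e [k [dv ct]]]].
rewrite -ler_pdivlMl //; apply: gauge_le; split.
  by rewrite mulr_ge0 // invr_ge0 ltW.
(* The subtraction is truncated: for k <= p^e the divisibility is trivial, and p^e + (k - p^e) >= k
   holds in any case. *)
exists e, (k - p ^ e)%N; split; last first.
  rewrite exprMn exprVn ler_pdivlMl ?exprn_gt0 // -exprD.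
  apply: le_trans ct; apply: ler_wiXn2l; rewrite ?ltW //.
  by rewrite -leq_subLR.
have [ek|/ltnW ke] := leqP (p ^ e) k; last first.
  by move: ke; rewrite -subn_eq0 => /eqP ->; exact: rdvd1l.
apply: (@rdvd_varpi_cancel e (p ^ e)); rewrite -exprD subnKC //.
by have := varpi_expk 0 e; rewrite add0n => ->.
Qed.

Lemma gauge_ndvd : c <= gauge x.
Proof.
apply: gauge_ge => t [t0 [e [k [dv ct]]]]; rewrite leNgt; apply/negP => tc.
case: x_ndvd; rewrite -(varpi_expk 0 e) add0n; apply: rdvd_trans dv.
apply: rdvd_exp2l; apply: ltnW; rewrite -(ltr_iXn2l c0 c1).
apply: le_lt_trans ct _; rewrite ltrXn2r ?nnegrE // ?ltW //.
by rewrite -lt0n expn_gt0 prime_gt0.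
Qed.

(** [phi] keeps the value of the gauge at [varpi 0 * x], which is at least [c * gauge x]. Being
    below the gauge at both factors, it must take the value c at [varpi 0] and [gauge x] at x. *)
Lemma exists_multiplicative : exists phi : Q -> K,
  [/\ ultra_seminorm p phi, (forall a b, phi (a * b) = phi a * phi b),
      (forall a, phi a <= 1), phi (varpi 0) = c & c <= phi x].
Proof.
have gx : 0 < gauge x by apply: lt_le_trans c0 gauge_ndvd.
have gh : 0 < gauge (varpi 0 * x).
  by apply: lt_le_trans (gauge_varpiM x); rewrite mulr_gt0.
have [phi [phiP phi_le phiM phih]] := multiplicative_below p_pr gauge_ultra gh.
exists phi.
have phi_pi : phi (varpi 0) <= c := le_trans (phi_le _) gauge_varpi.
have phi_x := phi_le x.
have prod : c * gauge x <= phi (varpi 0) * phi x.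
  by rewrite -phiM phih gauge_varpiM.
split=> //.
- by move=> a; apply: le_trans (phi_le a) (gauge_le1 a).
- apply/eqP; rewrite eq_le phi_pi /= -(ler_pM2r gx); apply: le_trans prod _.
  by rewrite ler_wpM2l // (ultra_ge0 phiP).
- apply: le_trans gauge_ndvd _; rewrite -(ler_pM2l c0); apply: le_trans prod _.
  by rewrite ler_wpM2r // (ultra_ge0 phiP).
Qed.

End Gauge.

(** * The quotient of R by the untilt of an ideal *)

Section IdealQuotient.
Variables (A : comPzRingType) (I : set A) (I_ideal : is_ideal I).

Lemma idealN x : I x -> I (- x).
Proof. by move=> Ix; rewrite -mulN1r; case: I_ideal => _ _; exact. Qed.

Lemma idealD x y : I x -> I y -> I (x + y).
Proof. by case: I_ideal => _ + _; exact. Qed.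

Lemma idealMl c x : I x -> I (c * x).
Proof. by case: I_ideal => _ _; exact. Qed.

(** The proof that I is an ideal is an argument because the structures on the quotient depend on
    it. *)
Definition iquot_rel of is_ideal I := fun x y : A => `[< I (x - y) >].
Local Notation rel := (iquot_rel I_ideal).

Lemma iquot_rel_refl : reflexive rel.
Proof. by move=> x; apply/asboolP; rewrite subrr; case: I_ideal. Qed.

Lemma iquot_rel_sym : symmetric rel.
Proof. by move=> x y; apply/asboolP/asboolP => /idealN; rewrite opprB. Qed.

Lemma iquot_rel_trans : transitive rel.
Proof.
move=> y x z /asboolP xy /asboolP yz; apply/asboolP.
by rewrite -(subrK y x) -addrA; exact: idealD.
Qed.

Canonical iquot_equiv :=
  EquivRel rel iquot_rel_refl iquot_rel_sym iquot_rel_trans.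

Definition iquot := {eq_quot rel}.

HB.instance Definition _ : EqQuotient A rel iquot := EqQuotient.on iquot.
HB.instance Definition _ := Choice.on iquot.

Definition iq (x : A) : iquot := (\pi_iquot x)%qT.

Lemma iqP x y : iq x = iq y <-> I (x - y).
Proof. by split=> [/eqquotP/asboolP|h] //; apply/eqquotP/asboolP. Qed.

Lemma iqK (u : iquot) : iq (repr u) = u. Proof. exact: reprK. Qed.

Lemma iquot_ind (P : iquot -> Prop) : (forall x, P (iq x)) -> forall u, P u.
Proof. by move=> h u; rewrite -(iqK u). Qed.

Lemma ideal_repr x : I (repr (iq x) - x).
Proof. by apply/iqP; rewrite iqK. Qed.

Definition iquot_add (u v : iquot) := iq (repr u + repr v).
Definition iquot_mul (u v : iquot) := iq (repr u * repr v).
Definition iquot_opp (u : iquot) := iq (- repr u).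

Lemma iq_addE x y : iquot_add (iq x) (iq y) = iq (x + y).
Proof. by apply/iqP; rewrite opprD addrACA; apply: idealD; exact: ideal_repr. Qed.

Lemma iq_mulE x y : iquot_mul (iq x) (iq y) = iq (x * y).
Proof.
apply/iqP; set a := repr _; set b := repr _.
have -> : a * b - x * y = a * (b - y) + y * (a - x) by ring.
by apply: idealD; apply: idealMl; exact: ideal_repr.
Qed.

Lemma iq_oppE x : iquot_opp (iq x) = iq (- x).
Proof. by apply/iqP; rewrite -opprD; apply/idealN/ideal_repr. Qed.

Lemma iquot_addA : associative iquot_add.
Proof. by do 3 elim/iquot_ind => ?; rewrite !iq_addE addrA. Qed.

Lemma iquot_addC : commutative iquot_add.
Proof. by do 2 elim/iquot_ind => ?; rewrite !iq_addE addrC. Qed.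

Lemma iquot_add0 : left_id (iq 0) iquot_add.
Proof. by elim/iquot_ind => ?; rewrite !iq_addE add0r. Qed.

Lemma iquot_addN : left_inverse (iq 0) iquot_opp iquot_add.
Proof. by elim/iquot_ind => ?; rewrite iq_oppE !iq_addE addNr. Qed.

HB.instance Definition _ := GRing.isZmodule.Build iquot
  iquot_addA iquot_addC iquot_add0 iquot_addN.

Lemma iquot_mulA : associative iquot_mul.
Proof. by do 3 elim/iquot_ind => ?; rewrite !iq_mulE mulrA. Qed.

Lemma iquot_mulC : commutative iquot_mul.
Proof. by do 2 elim/iquot_ind => ?; rewrite !iq_mulE mulrC. Qed.

Lemma iquot_mul1 : left_id (iq 1) iquot_mul.
Proof. by elim/iquot_ind => ?; rewrite !iq_mulE mul1r. Qed.

Lemma iquot_mulDl : left_distributive iquot_mul iquot_add.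
Proof. by do 3 elim/iquot_ind => ?; rewrite !(iq_mulE, iq_addE) mulrDl. Qed.

HB.instance Definition _ := GRing.Zmodule_isComPzRing.Build iquot
  iquot_mulA iquot_mulC iquot_mul1 iquot_mulDl.

Lemma iqB : {morph iq : x y / x - y}.
Proof.
by move=> x y; rewrite -[RHS]/(iquot_add _ (iquot_opp _)) iq_oppE iq_addE.
Qed.

Lemma iqM : GRing.monoid_morphism iq.
Proof. by split=> // x y; rewrite -[RHS]/(iquot_mul _ _) iq_mulE. Qed.

HB.instance Definition _ := GRing.isZmodMorphism.Build A iquot iq iqB.
HB.instance Definition _ := GRing.isMonoidMorphism.Build A iquot iq iqM.

Lemma iq_eq0 x : iq x = 0 <-> I x.
Proof. by rewrite -(rmorph0 iq) iqP subr0. Qed.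

End IdealQuotient.

(** * The quotient by the untilt as W(S) / xi *)

Section UntiltQuotient.
Variables (p : nat) (p_pr : prime p) (R : comPzRingType).
Local Notation Rb := (tilt p_pr R).
Local Notation W := (witt p_pr Rb).
Variables (pi : R) (pib : Rb).
Hypothesis R_perfectoid : perfectoid p_pr R.
Hypothesis pi_perfectoid : perfectoid_element p pi.
Hypothesis pib_sharp : unit_multiple (sharp pib) pi.
Variable I : set Rb.
Hypotheses (I_ideal : is_ideal I) (I_radical : is_radical I).
Hypotheses (I_closed : adic_closed pib I) (I_tf : quotient_torsion_free pib I).

Let pi_complete : adic_complete pi. Proof. by case: pi_perfectoid. Qed.
Let pip_dvd_p : rdvd (pi ^+ p) p%:R. Proof. by case: pi_perfectoid. Qed.
Let Rc : adic_complete (p%:R : R).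
Proof. exact: (p_complete p_pr pi_complete pip_dvd_p). Qed.
Let frob_surj (u : pquot (p%:R : R)) : exists v, v ^+ p = u.
Proof. by case: R_perfectoid => _ + _; exact. Qed.
Local Notation th := (theta_rmorph Rc).

(** Coordinates are p^n-th powers of Teichmueller digits: an ideal that contains the digits contains
    the coordinates, and a radical one conversely. *)
Lemma witt_idealE (w : W) : witt_ideal I w <-> forall n, I (wcoord w n).
Proof.
split=> [[x /tilt_teich_unique -> Ix] n|Iw].
  rewrite -(wteichK (@tilt_rootK _ p_pr R)).
  by rewrite -(prednK (_ : 0 < p ^ n)%N) ?expn_gt0 ?prime_gt0 // exprSr; exact: idealMl.
exists (wteich (@tilt_root p p_pr R) w); first exact: tilt_teich_expansion.
move=> n; apply: (I_radical (n := (p ^ n)%N)).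
by rewrite (wteichK (@tilt_rootK _ p_pr R)).
Qed.

Local Notation S := (iquot I_ideal).
Local Notation sigma := (iq I_ideal).

Lemma iquot_pchar : p%:R = 0 :> S.
Proof. by rewrite -(rmorph_nat sigma) tilt_pchar rmorph0. Qed.

Definition iquot_root (u : S) : S := sigma (tilt_root (repr u)).

Lemma iquot_rootK u : iquot_root u ^+ p = u.
Proof. by rewrite /iquot_root -rmorphXn tilt_rootK /= iqK. Qed.

Lemma iquot_expp_inj (u v : S) : u ^+ p = v ^+ p -> u = v.
Proof.
rewrite -(iqK u) -(iqK v) -!rmorphXn; set a := repr u; set b := repr v.
move=> /iqP ab; apply/iqP; apply: (I_radical (n := p)); move: ab.
have [w] := rdvd_freshman p_pr (a - b) b.
rewrite tilt_pchar mul0r subrK => /subr0_eq ->.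
by rewrite addrK.
Qed.

Lemma iquot_pib_tf (u : S) : sigma pib * u = 0 -> u = 0.
Proof. by rewrite -(iqK u) -rmorphM => /iq_eq0/I_tf/iq_eq0. Qed.

Lemma iquot_pib_sep : adic_separated (sigma pib).
Proof.
move=> u; rewrite -(iqK u); set x := repr u => ux; apply/iq_eq0/I_closed => n.
have [v] := ux n; rewrite -(iqK v) -rmorphXn -rmorphM => /iqP Ixv.
exists (x - pib ^+ n * repr v) => //.
by rewrite opprB addrC subrK; apply: rdvd_mulr; exact: rdvd_refl.
Qed.

Variable xi : W.
Hypothesis xiP : forall w, theta w = 0 <-> rdvd xi w.

(** Lifting the quotients [d] exhibits u as the image of partial sums in R^flat, where
    [tilt_complete_tel] applies. *)
Lemma iquot_pib_tel (u : nat -> S) :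
  (forall n, rdvd (sigma pib ^+ n) (u n.+1 - u n)) ->
  exists l, forall n, rdvd (sigma pib ^+ n) (u n - l).
Proof.
move=> /choice[d dP].
pose v n := repr (u 0) + \sum_(i < n) pib ^+ i * repr (d i).
have vu n : sigma (v n) = u n.
  elim: n => [|n IH]; first by rewrite /v big_ord0 addr0 iqK.
  rewrite /v big_ord_recr /= addrA -/(v n) rmorphD /= IH rmorphM rmorphXn /=.
  by rewrite iqK -dP addrC subrK.
have [n|l lP] := tilt_complete_tel pi_complete pip_dvd_p pib_sharp frob_surj xiP (u := v).
  have -> : v n.+1 - v n = pib ^+ n * repr (d n).
    by rewrite /v big_ord_recr /= addrA [_ + pib ^+ n * _]addrC addrK.
  by apply: rdvd_mulr; exact: rdvd_refl.
exists (sigma l) => n; rewrite -vu -rmorphXn -rmorphB.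
exact: rdvd_rmorph (lP n).
Qed.

Local Notation xib := (wmap sigma xi).
Local Notation Q := (pquot xib).

(** Preimages under theta differ by multiples of xi, so the choice made by [f] is harmless modulo
    [xib]. *)
Lemma untilt_quotient_map : exists chi : {rmorphism R -> Q},
  forall w : W, chi (theta w) = pq xib (wmap sigma w).
Proof.
have [f fP] := choice (theta_surj p_pr Rc frob_surj).
pose chi r := pq xib (wmap sigma (f r)).
have chiE w : chi (theta w) = pq xib (wmap sigma w).
  apply/pqP; rewrite -rmorphB; apply: rdvd_rmorph; apply/xiP.
  by rewrite [LHS](rmorphB th) /= /theta_rmorph fP; exact: subrr.
have chiB : {morph chi : x y / x - y}.
  move=> x y; rewrite -{1}(fP x) -{1}(fP y) -[_ - _](rmorphB th) /= chiE.
  by rewrite !rmorphB.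
have chiM : GRing.monoid_morphism chi.
  split=> [|x y].
    by rewrite -[1 in LHS](rmorph1 th) /= chiE !rmorph1.
  by rewrite -{1}(fP x) -{1}(fP y) -[_ * _](rmorphM th) /= chiE !rmorphM.
pose m1 := GRing.isZmodMorphism.Build R Q chi chiB.
pose m2 := GRing.isMonoidMorphism.Build R Q chi chiM.
by exists (HB.pack_for {rmorphism R -> Q} chi m1 m2).
Qed.

Lemma untilt_quotient_ker (chi : {rmorphism R -> Q}) :
  (forall w : W, chi (theta w) = pq xib (wmap sigma w)) ->
  forall r, chi r = 0 <-> untilt_ideal I r.
Proof.
move=> chiE r; have [w <-] := theta_surj p_pr Rc frob_surj r.
rewrite chiE pq_eq0; split; last first.
  move=> [v /witt_idealE Iv tvw]; have := chiE v; rewrite tvw chiE.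
  have -> : wmap sigma v = 0 by apply: witt_eq => n /=; apply/iq_eq0.
  by rewrite rmorph0 => /pq_eq0.
(* A coordinatewise lift of g: then w - xi g' has the same theta as w, and its coordinates lie in
   I. *)
move=> [g gE]; pose g' : W := Witt p_pr (fun n => repr (wcoord g n)).
have g'E : wmap sigma g' = g by apply: witt_eq => n /=; exact: iqK.
exists (w - xi * g').
  apply/witt_idealE => n; apply/(iq_eq0 I_ideal).
  rewrite -[LHS]/(wcoord (wmap sigma (w - xi * g')) n).
  suff -> : wmap sigma (w - xi * g') = 0 by [].
  by rewrite rmorphB rmorphM /= g'E gE; exact: subrr.
rewrite [LHS](rmorphB th) /= /theta_rmorph.
have -> : theta (xi * g') = 0 by apply/xiP; exists g'.
exact: subr0.
Qed.

End UntiltQuotient.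

Lemma untilt_quotient (p : nat) (p_pr : prime p) (R : comPzRingType)
    (pi : R) (pib : tilt p_pr R) (I : set (tilt p_pr R)) :
  perfectoid p_pr R -> perfectoid_element p pi ->
  unit_multiple (sharp pib) pi ->
  is_ideal I -> is_radical I -> adic_closed pib I -> quotient_torsion_free pib I ->
  exists (Q : comPzRingType) (chi : {rmorphism R -> Q}) (varpi : nat -> Q),
  [/\ (forall u, exists r, chi r = u),
      (forall r, chi r = 0 <-> untilt_ideal I r) &
   [/\ varpi 0 = chi (sharp pib),
      (forall e, varpi e.+1 ^+ p = varpi e),
      (forall u, varpi 0 * u = 0 -> u = 0),
      (forall u, (forall n, rdvd (varpi 0 ^+ n) u) -> u = 0) &
      (forall e u, rdvd (varpi e ^+ p) (u ^+ p) -> rdvd (varpi e) u)]].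
Proof.
move=> R_perf pi_perf pib_sharp I_id I_rad I_cl I_tf.
have [_ frob_surj [xi xiP]] := R_perf.
have [pi_complete pip] := pi_perf.
have Rc := p_complete p_pr pi_complete pip.
have [chi chiE] := untilt_quotient_map R_perf pi_perf I_id xiP.
have [w [c wc]] := xi_dvd_p_sub_teich pi_complete pip pib_sharp frob_surj xiP.
have x0 := xi0_dvd pi_complete pip pib_sharp frob_surj xiP.
have pchar := iquot_pchar I_id.
have rootK := @iquot_rootK _ _ _ _ I_id.
have inj := iquot_expp_inj (I_ideal := I_id) I_rad.
have tf := iquot_pib_tf (I_ideal := I_id) I_tf.
have sep := iquot_pib_sep (I_ideal := I_id) I_cl.
have tel := iquot_pib_tel R_perf pi_perf pib_sharp (I_ideal := I_id) xiP.
have wcb : p%:R - teich p_pr (iq I_id pib ^+ p) * wmap (iq I_id) w =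
    wmap (iq I_id) xi * wmap (iq I_id) c.
  by rewrite -rmorphM -wc rmorphB rmorph_nat rmorphM /= wmap_teich rmorphXn.
have x0b : rdvd (iq I_id pib ^+ p) (wcoord (wmap (iq I_id) xi) 0).
  by rewrite -rmorphXn; exact: rdvd_rmorph x0.
exists _, chi, (varpi (@iquot_root _ _ _ _ I_id) (iq I_id pib) (wmap (iq I_id) xi)).
split.
- move=> u; rewrite -(pqK u); set v := repr u.
  exists (theta (Witt p_pr (fun n => repr (wcoord v n)))).
  by rewrite chiE; congr pq; apply: witt_eq => n /=; exact: iqK.
- exact: (untilt_quotient_ker R_perf pi_perf I_rad xiP chiE).
split.
- by rewrite -(theta_teich Rc) chiE wmap_teich.
- exact: varpiS rootK _ _.
- exact: (varpi_tf pchar rootK inj tf wcb).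
- exact: (varpi_sep pchar rootK inj sep tel wcb).
- exact: (varpi_root_closed pchar rootK inj wcb x0b).
Qed.

(** * Seminorms on the Tate rings *)

Section BoundedSeminorms.
Variables (K : realType) (A : comPzRingType) (nrm : A -> K).
Hypothesis nrm_pm : is_pm_norm nrm.

Lemma bms_exp (phi : A -> K) a n :
  is_bounded_multiplicative_seminorm nrm phi -> phi (a ^+ n) = phi a ^+ n.
Proof.
move=> phiP; elim: n => [|n IH]; first by rewrite (bms1 phiP).
by rewrite !exprS (bmsM phiP) IH.
Qed.

(** Comparing phi(a)^n = phi(a^n) with C |a|^n for large n removes the constant C. *)
Lemma bms_le_norm (phi : A -> K) a :
  is_bounded_multiplicative_seminorm nrm phi -> phi a <= nrm a.
Proof.
move=> phiP; rewrite leNgt; apply/negP => lt_np.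
have [C CP] := bms_bounded phiP.
have n0 := pm_norm_ge0 nrm_pm a.
have phi0 : 0 < phi a by exact: le_lt_trans lt_np.
have [a0|a0] := eqVneq (nrm a) 0.
  move: phi0; rewrite (iffLR (pm_norm_eq0 nrm_pm a) a0) (bms0 phiP).
  by rewrite ltxx.
have na0 : 0 < nrm a by rewrite lt_neqAle eq_sym a0.
have t01 : 0 < nrm a / phi a < 1 by rewrite divr_gt0 //= ltr_pdivrMr // mul1r.
have C0 : 0 < C.
  rewrite ltNge; apply/negP => C0; have := CP a; rewrite leNgt => /negP; apply.
  by apply: le_lt_trans phi0; rewrite mulr_le0_ge0.
have Ci : 0 < C^-1 by rewrite invr_gt0.
have [n tn] := exp_lt_small t01 Ci.
have tn1 : (nrm a / phi a) ^+ n.+1 < C^-1.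
  apply: le_lt_trans tn; case/andP: t01 => t0 t1.
  by rewrite exprS ler_piMl ?exprn_ge0 ?ltW.
move: tn1; rewrite expr_div_n ltr_pdivrMr ?exprn_gt0 //.
rewrite -ltr_pdivrMl // invrK -pm_normX // -bms_exp //.
by rewrite ltNge CP.
Qed.

End BoundedSeminorms.

Section TateNorm.
Variables (K : realType) (R A : comPzRingType) (iota : {rmorphism R -> A}) (t : R).
Variable nrm : A -> K.
Hypothesis A_loc : is_localization iota t.
Hypothesis nrm_pm : is_pm_norm nrm.
Hypothesis nrm_top : defines_tate_topology nrm iota t.
Hypothesis nrm_t : multiplicative_elt nrm (iota t).
Hypothesis A_neq0 : (1 : A) != 0.
Local Notation c := (nrm (iota t)).

Lemma norm1 : nrm 1 = 1.
Proof.
have h : nrm 1 * nrm 1 = nrm 1.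
  by rewrite -expr2 -(pm_normX nrm_pm) // expr1n.
have n0 : nrm 1 != 0.
  by apply/eqP => /(pm_norm_eq0 nrm_pm) /eqP; exact/negP.
by apply: (mulIf n0); rewrite h mul1r.
Qed.

Lemma norm_tX n a : nrm (iota t ^+ n * a) = c ^+ n * nrm a.
Proof.
elim: n => [|n IH]; first by rewrite !mul1r.
by rewrite !exprS -!mulrA nrm_t IH.
Qed.

Lemma norm_t01 : 0 < c < 1.
Proof.
have [u tu] := loc_unit A_loc; apply/andP; split.
  rewrite lt_neqAle pm_norm_ge0 // andbT eq_sym; apply/eqP => c0.
  have := norm1; rewrite -tu nrm_t c0 mul0r => /esym/eqP; exact/negP/oner_neq0.
have [n /(_ 1)] := nrm_top.2 1 ltr01.
rewrite mulr1 rmorphXn /= -[_ ^+ n]mulr1 norm_tX norm1 mulr1.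
by rewrite !ltNge; apply: contra => c1; exact: exprn_ege1.
Qed.

(** Some t^n R lies in the open unit ball; the elements t^n r^k would leave it for large k if r had
    norm above 1. *)
Lemma norm_iota_le1 r : nrm (iota r) <= 1.
Proof.
have [c0 c1] := andP norm_t01; have [n nP] := nrm_top.2 1 ltr01.
rewrite leNgt; apply/negP => x1; set x := nrm _ in x1.
have x0 : 0 < x := lt_trans ltr01 x1.
have xi01 : 0 < x^-1 < 1 by rewrite invr_gt0 x0 invf_lt1.
have [k xk] := exp_lt_small xi01 (exprn_gt0 n c0).
have := nP (r ^+ k.+1); rewrite rmorphM !rmorphXn /= norm_tX.
rewrite (pm_normX nrm_pm) // -/x ltNge => /negP; apply.
move: xk; rewrite exprVn -div1r ltr_pdivrMr ?exprn_gt0 // => /ltW h.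
by rewrite exprS mulrCA; apply: le_trans h _; rewrite ler_peMl ?ltW // mulr_gt0 ?exprn_gt0.
Qed.

Lemma norm_iota_tX n r : nrm (iota (t ^+ n * r)) <= c ^+ n.
Proof.
have [c0 _] := andP norm_t01.
rewrite rmorphM rmorphXn /= norm_tX; apply: ler_piMr; last exact: norm_iota_le1.
by rewrite exprn_ge0 // ltW.
Qed.

End TateNorm.

(* Scaling by a power of [iota t] moves any element to the part of the ball of
   radius e contained in R on which the norm is bounded below. *)
Lemma tate_bounded (K : realType) (R A : comPzRingType)
    (iota : {rmorphism R -> A}) (t : R) (nrm phi : A -> K) :
  is_localization iota t -> is_pm_norm nrm ->
  defines_tate_topology nrm iota t -> multiplicative_elt nrm (iota t) ->
  0 < nrm (iota t) < 1 -> phi 0 = 0 ->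
  (forall a b, phi (a * b) = phi a * phi b) ->
  (forall r, phi (iota r) <= 1) -> phi (iota t) = nrm (iota t) ->
  exists C, forall a, phi a <= C * nrm a.
Proof.
move=> A_loc nrm_pm nrm_top nrm_t c01 phi0 phiM phi_le1 phi_t.
set c := nrm (iota t) in c01 phi_t; have /andP[c0 c1] := c01.
have [e e0 eP] := nrm_top.1 0%N.
have nX := norm_tX nrm_t.
have pX n a : phi (iota t ^+ n * a) = c ^+ n * phi a.
  elim: n => [|n IH]; first by rewrite !mul1r.
  by rewrite !exprS -!mulrA phiM IH phi_t.
have [u tu] := loc_unit A_loc.
have tuX k a : iota t ^+ k * (u ^+ k * a) = a.
  by rewrite mulrA -exprMn tu expr1n mul1r.
(* After scaling, [c * e <= nrm b' < e]; then b' comes from R, and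
   [phi b' <= 1 <= (c * e)^-1 * nrm b']. *)
exists (c * e)^-1 => a; have [a0|a_neq0] := eqVneq (nrm a) 0.
  by rewrite a0 mulr0 (iffLR (pm_norm_eq0 nrm_pm a) a0) phi0.
have a0 : 0 < nrm a by rewrite lt_neqAle eq_sym a_neq0 pm_norm_ge0.
have [N aN] := exp_lt_small c01 (divr_gt0 e0 a0).
pose b := iota t ^+ N * a.
have b0 : 0 < nrm b by rewrite nX mulr_gt0 ?exprn_gt0.
have be : nrm b < e by move: aN; rewrite nX ltr_pdivlMr.
suff : phi b <= (c * e)^-1 * nrm b.
  by rewrite pX nX mulrCA ler_pM2l // exprn_gt0.
have ex : exists n, c ^+ n * e <= nrm b.
  have [n nb] := exp_lt_small c01 (divr_gt0 b0 e0).
  by exists n; apply: ltW; rewrite -ltr_pdivlMr.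
case: (ex_minnP ex) => -[|k]; first by rewrite mul1r leNgt be.
move=> kb kmin; have {kmin}bk : nrm b < c ^+ k * e.
  by rewrite ltNge; apply/negP => /kmin; rewrite ltnn.
rewrite -(tuX k b) in kb bk *; set b' := u ^+ k * b in kb bk *.
rewrite nX ltr_pM2l ?exprn_gt0 // in bk.
rewrite nX exprSr -mulrA ler_pM2l ?exprn_gt0 // in kb.
have [r b'E] := eP _ bk.
rewrite pX nX mulrCA ler_pM2l ?exprn_gt0 //.
apply: (@le_trans _ _ 1); first by rewrite b'E phi_le1.
by rewrite mulrC ler_pdivlMr ?mulr_gt0 // mul1r.
Qed.

Section ExtendSeminorm.
Variables (K : realType) (R A : comPzRingType) (iota : {rmorphism R -> A}) (t : R).
Hypothesis A_loc : is_localization iota t.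
Variable Phi : R -> K.
Hypothesis Phi_ge0 : forall r, 0 <= Phi r.
Hypothesis Phi1 : Phi 1 = 1.
Hypothesis PhiM : forall r s, Phi (r * s) = Phi r * Phi s.
Hypothesis PhiD : forall r s, Phi (r + s) <= Num.max (Phi r) (Phi s).
Hypothesis Phi_t : 0 < Phi t.

Lemma seminormX r n : Phi (r ^+ n) = Phi r ^+ n.
Proof. by elim: n => [|n IH]; rewrite ?Phi1 // !exprS PhiM IH. Qed.

Lemma extend_seminorm : exists phi : A -> K,
  [/\ (forall r, phi (iota r) = Phi r), (forall a, 0 <= phi a),
      (forall a b, phi (a * b) = phi a * phi b) &
      (forall a b, phi (a + b) <= Num.max (phi a) (phi b))].
Proof.
have /choice[f fP] (a : A) : exists rn : R * nat, a * iota t ^+ rn.2 = iota rn.1.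
  by have [r [n ar]] := loc_surj A_loc a; exists (r, n).
pose phi a := Phi (f a).1 / Phi t ^+ (f a).2.
have tn0 n : Phi t ^+ n != 0 by rewrite expf_neq0 // gt_eqF.
have phiE a r n : a * iota t ^+ n = iota r -> phi a = Phi r / Phi t ^+ n.
  move=> ar; have := fP a; rewrite /phi; case: (f a) => s m /= as_.
  have /(loc_ker A_loc)[k] : iota (s * t ^+ n - r * t ^+ m) = 0.
    by rewrite rmorphB !rmorphM !rmorphXn /= -ar -as_ mulrAC subrr.
  rewrite mulrBr => /subr0_eq/(congr1 Phi); rewrite !PhiM !seminormX.
  by move=> /(mulfI (tn0 k)) h; apply/eqP; rewrite eqr_div // h.
exists phi; split.
- by move=> r; rewrite (@phiE _ r 0%N) ?expr0 ?divr1 // mulr1.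
- by move=> a; rewrite mulr_ge0 ?invr_ge0 ?exprn_ge0 // ltW.
- move=> a b; rewrite (@phiE _ ((f a).1 * (f b).1) ((f a).2 + (f b).2)%N).
    by rewrite PhiM exprD -mulf_div.
  by rewrite exprD mulrACA !fP rmorphM.
- move=> a b; set n := ((f a).2 + (f b).2)%N.
  have aE : a * iota t ^+ n = iota ((f a).1 * t ^+ (f b).2).
    by rewrite exprD mulrA fP rmorphM rmorphXn.
  have bE : b * iota t ^+ n = iota ((f b).1 * t ^+ (f a).2).
    by rewrite /n addnC exprD mulrA fP rmorphM rmorphXn.
  have abE : (a + b) * iota t ^+ n =
      iota ((f a).1 * t ^+ (f b).2 + (f b).1 * t ^+ (f a).2).
    by rewrite mulrDl aE bE rmorphD.
  rewrite (phiE _ _ _ aE) (phiE _ _ _ bE) (phiE _ _ _ abE).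
  have ti : 0 <= (Phi t ^+ n)^-1 by rewrite invr_ge0 exprn_ge0.
  by rewrite -(maxr_pMl _ _ ti) ler_wpM2r.
Qed.

End ExtendSeminorm.

(** * Seminorms and the sharp map *)

Section SharpSeminorm.
Variables (p : nat) (p_pr : prime p) (R : comPzRingType).
Local Notation Rb := (tilt p_pr R).
Hypothesis Rc : adic_complete (p%:R : R).

Lemma sharpM (x y : Rb) : sharp (x * y) = sharp x * sharp y.
Proof. exact: tilt_liftM. Qed.

Lemma sharpX (x : Rb) k : sharp (x ^+ k) = sharp x ^+ k.
Proof. exact: tilt_liftX. Qed.

(** Modulo p^(n+1), the sharp of x + y is the p^n-th power of the sum of the n-th components. As
    Phi(p) <= c < 1, a nonzero value at that sharp exceeds the error for large n. *)
Lemma sharpD_max (K : realType) (Phi : R -> K) c (x y : Rb) :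
  0 < c < 1 -> (forall r, 0 <= Phi r) -> (forall r, Phi r <= 1) ->
  Phi 1 = 1 -> (forall r s, Phi (r * s) = Phi r * Phi s) ->
  (forall r s, Phi (r + s) <= Num.max (Phi r) (Phi s)) -> Phi p%:R <= c ->
  Phi (sharp (x + y)) <= Num.max (Phi (sharp x)) (Phi (sharp y)).
Proof.
move=> c01 Phi0 Phi_le1 Phi1 PhiM PhiD Phip.
have PhiX := seminormX Phi1 PhiM.
rewrite leNgt; apply/negP => lt_max.
have z0 : 0 < Phi (sharp (x + y)).
  by apply: le_lt_trans lt_max; rewrite le_max Phi0.
have [n zn] := exp_lt_small c01 z0.
have liftE (z : Rb) : tilt_lift z n ^+ (p ^ n) = sharp z.
  by rewrite -[n in tilt_lift z n]add0n tilt_lift_expk.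
have [s sE] := rdvd_sub_exppk p_pr (rdvd_refl _) n (tilt_liftD_mod Rc x y n).
have Phiz : Phi (sharp (x + y)) <=
    Num.max (Phi (p%:R ^+ n.+1 * s)) (Phi ((tilt_lift x n + tilt_lift y n) ^+ (p ^ n))).
  by rewrite -liftE -(subrK ((tilt_lift x n + tilt_lift y n) ^+ (p ^ n)) (_ ^+ _)) sE.
have Phips : Phi (p%:R ^+ n.+1 * s) < Phi (sharp (x + y)).
  apply: le_lt_trans zn; case/andP: c01 => c0 c1; rewrite PhiM PhiX.
  apply: (@le_trans _ _ (Phi p%:R ^+ n.+1)); first by rewrite ler_piMr ?exprn_ge0.
  apply: (@le_trans _ _ (c ^+ n.+1)); first by rewrite lerXn2r ?nnegrE // ltW.
  by rewrite exprS; apply: ler_piMl; rewrite ?exprn_ge0 // ltW.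
have : Phi (sharp (x + y)) < Phi (sharp (x + y)).
  apply: le_lt_trans Phiz _; rewrite gt_max Phips /= PhiX.
  apply: le_lt_trans lt_max; rewrite -!liftE !PhiX.
  have := PhiD (tilt_lift x n) (tilt_lift y n); rewrite !le_max.
  by move=> /orP[h|h]; apply/orP; [left|right]; rewrite lerXn2r ?nnegrE.
by rewrite ltxx.
Qed.

Variables (A B : comPzRingType) (iota : {rmorphism R -> A}).
Variables (pib : Rb) (j : {rmorphism Rb -> B}).
Hypothesis B_loc : is_localization j pib.
Variable u : A.
Hypothesis pib_unit : iota (sharp pib) * u = 1.
Local Notation ls := (loc_sharp pib iota j).

(** The fraction picked by [loc_sharp] does not matter, as [sharp] is multiplicative and the image
    of [sharp pib] is a unit. *)
Lemma loc_sharp_eq f x k : f * j pib ^+ k = j x ->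
  ls f * iota (sharp pib) ^+ k = iota (sharp x).
Proof.
move=> fx; have unX n a b : a * iota (sharp pib) ^+ n = b * iota (sharp pib) ^+ n -> a = b.
  move=> /(congr1 (fun z => z * u ^+ n)).
  by rewrite -!mulrA -exprMn pib_unit expr1n !mulr1.
have : exists a, exists x k, f * j pib ^+ k = j x /\
    a * iota (sharp pib) ^+ k = iota (sharp x).
  exists (iota (sharp x) * u ^+ k), x, k; split=> //.
  by rewrite -mulrA -exprMn [u * _]mulrC pib_unit expr1n mulr1.
move=> /(xgetPex 0)[y [l [fy ay]]]; rewrite -/(loc_sharp pib iota j f) in ay.
have /(loc_ker B_loc)[m] : j (x * pib ^+ l - y * pib ^+ k) = 0.
  by rewrite rmorphB !rmorphM !rmorphXn /= -fx -fy mulrAC subrr.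
rewrite mulrBr => /subr0_eq/(congr1 (fun z => iota (sharp z))).
rewrite !sharpM !sharpX !rmorphM !rmorphXn -ay => h.
apply: (@unX (m + l)%N); rewrite exprD [RHS]mulrCA.
by move: h => /= ->; ring.
Qed.

Lemma loc_sharp_j x : ls (j x) = iota (sharp x).
Proof. by have := @loc_sharp_eq (j x) x 0; rewrite !mulr1; apply. Qed.

Lemma loc_sharp_unique f x k a : f * j pib ^+ k = j x ->
  a * iota (sharp pib) ^+ k = iota (sharp x) -> ls f = a.
Proof.
move=> /loc_sharp_eq <- /(congr1 (fun z => z * u ^+ k)).
by rewrite -!mulrA -!exprMn pib_unit expr1n !mulr1.
Qed.

Lemma loc_sharpM f g : ls (f * g) = ls f * ls g.
Proof.
have [x [k fx]] := loc_surj B_loc f; have [y [l gy]] := loc_surj B_loc g.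
apply: (@loc_sharp_unique _ (x * y) (k + l)).
  by rewrite exprD mulrACA fx gy rmorphM.
by rewrite exprD mulrACA (loc_sharp_eq fx) (loc_sharp_eq gy) sharpM rmorphM.
Qed.

Lemma loc_sharpD_max (K : realType) (phi : A -> K) f g :
  (forall a, 0 <= phi a) -> (forall a b, phi (a * b) = phi a * phi b) ->
  (forall x y : Rb, phi (iota (sharp (x + y))) <=
     Num.max (phi (iota (sharp x))) (phi (iota (sharp y)))) ->
  phi (ls (f + g)) <= Num.max (phi (ls f)) (phi (ls g)).
Proof.
move=> phi0 phiM phiD.
have [x [k fx]] := loc_surj B_loc f; have [y [l gy]] := loc_surj B_loc g.
have {}fx : f * j pib ^+ (k + l) = j (x * pib ^+ l).
  by rewrite exprD mulrA fx rmorphM rmorphXn.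
have {}gy : g * j pib ^+ (k + l) = j (y * pib ^+ k).
  by rewrite addnC exprD mulrA gy rmorphM rmorphXn.
have fg : (f + g) * j pib ^+ (k + l) = j (x * pib ^+ l + y * pib ^+ k).
  by rewrite mulrDl fx gy rmorphD.
have lsE h z : h * j pib ^+ (k + l) = j z ->
    phi (ls h) = phi (iota (sharp z)) * phi (u ^+ (k + l)).
  move=> /loc_sharp_eq <-; rewrite -phiM -mulrA -exprMn pib_unit expr1n.
  by rewrite mulr1.
rewrite (lsE _ _ fx) (lsE _ _ gy) (lsE _ _ fg).
by rewrite -(maxr_pMl _ _ (phi0 _)) ler_wpM2r.
Qed.

End SharpSeminorm.

Lemma untilt_sub_ker (p : nat) (p_pr : prime p) (R : comPzRingType) (pi : R)
    (I : set (tilt p_pr R)) (K : realType) (A : comPzRingType)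
    (iota : {rmorphism R -> A}) (nrm phi : A -> K) (r : R) :
  adic_complete (p%:R : R) -> rdvd pi p%:R ->
  0 < nrm (iota pi) < 1 ->
  (forall n s, nrm (iota (pi ^+ n * s)) <= nrm (iota pi) ^+ n) ->
  is_pm_norm nrm -> is_bounded_multiplicative_seminorm nrm phi ->
  (forall x, I x -> phi (iota (sharp x)) = 0) ->
  untilt_ideal I r -> phi (iota r) = 0.
Proof.
move=> Rc pi_p c01 nX nrm_pm phiP phiI [w [x wx Ix] <-].
have xE := tilt_teich_unique wx.
apply/eqP; rewrite eq_le (bms_ge0 phiP) andbT leNgt; apply/negP => r0.
have [N rN] := exp_lt_small c01 r0.
have := rdvd_subC (theta_partial Rc w N).
set s := \sum_(n < N) _ => /(rdvd_trans (rdvd_exp N pi_p))[t tE].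
have s0 : phi (iota s) <= 0.
  rewrite /s rmorph_sum /=; elim/big_rec: _ => [|i y _ y0].
    by rewrite (bms0 phiP).
  apply: le_trans (bmsD phiP _ _) _.
  rewrite rmorphM (bmsM phiP) /= -(sharp_iter_root Rc).
  by rewrite phiI ?mul0r ?add0r // -[iter _ _ _]/(wteich _ w _) -xE.
move: rN; rewrite ltNge => /negP; apply; apply: le_trans (nX N t).
apply: le_trans (bms_le_norm nrm_pm _ phiP).
by rewrite -tE -{1}(subrK s (theta w)) rmorphD (le_trans (bmsD phiP _ _)) // gerDl.
Qed.

(** Otherwise t, and with it p, would be nilpotent in R, which characteristic 0 excludes. *)
Lemma localization_neq0 (p : nat) (p_pr : prime p) (R A : comPzRingType)
    (iota : {rmorphism R -> A}) (t : R) :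
  is_localization iota t -> char_zero R -> rdvd t p%:R -> (1 : A) != 0.
Proof.
move=> A_loc R0 tp; apply/eqP => A0.
have [n] : exists n, t ^+ n * 1 = 0 by apply: (loc_ker A_loc); rewrite rmorph1.
rewrite mulr1 => tn.
have [s sE] := rdvd_exp n tp; move: sE; rewrite tn mul0r -natrX.
by rewrite -(prednK (_ : 0 < p ^ n)%N) ?expn_gt0 ?prime_gt0 //; exact/eqP/R0.
Qed.

Theorem proposition5p6
    (p : nat) (p_pr : prime p) (R : comPzRingType)
    (R_perfectoid : perfectoid p_pr R) (R_char0 : char_zero R)
    (pi : R) (pi_perfectoid : perfectoid_element p pi)
    (pib : tilt p_pr R) (pib_sharp : unit_multiple (sharp pib) pi)
    (I : set (tilt p_pr R)) (I_ideal : is_ideal I) (I_radical : is_radical I)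
    (I_closed : adic_closed pib I) (I_tf : quotient_torsion_free pib I)
    (A : comPzRingType) (iota : {rmorphism R -> A})
    (A_loc : is_localization iota pi)
    (B : comPzRingType) (j : {rmorphism tilt p_pr R -> B})
    (B_loc : is_localization j pib)
    (K : realType) (nrmA : A -> K) (nrmB : B -> K)
    (nrmA_pm : is_pm_norm nrmA) (nrmB_pm : is_pm_norm nrmB)
    (nrmA_top : defines_tate_topology nrmA iota pi)
    (nrmB_top : defines_tate_topology nrmB j pib)
    (nrmA_pi : multiplicative_elt nrmA (iota pi))
    (nrmB_pib : multiplicative_elt nrmB (j pib))
    (nrm_compat : nrmA (iota pi) = nrmB (j pib)) :
  untilt_ideal I =
  \bigcap_(psi in [set psi | berkovich nrmB psi /\
                            (forall x, I x -> psi (j x) = 0)])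
    [set r | sharp_seminorm pib iota j nrmA psi (iota r) = 0].
Proof.
have [pi_complete pip] := pi_perfectoid.
have [_ frob_surj _] := R_perfectoid.
have pi_p := pi_dvd_p p_pr pip.
have Rc := p_complete p_pr pi_complete pip.
have A0 := localization_neq0 p_pr A_loc R_char0 pi_p.
have c01 := norm_t01 A_loc nrmA_pm nrmA_top nrmA_pi A0.
have nX n s := norm_iota_tX A_loc nrmA_pm nrmA_top nrmA_pi A0 n s.
set c := nrmA (iota pi) in c01 nX nrm_compat.
have /andP[c0 c1] := c01.
have [v [v' [vv' pibE]]] := pib_sharp.
have [u pib_unit] : exists u, iota (sharp pib) * u = 1.
  have [u0 u0E] := loc_unit A_loc; exists (iota v' * u0).
  by rewrite pibE rmorphM mulrACA -rmorphM vv' rmorph1 mul1r.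
have ls_j := loc_sharp_j Rc B_loc pib_unit.
have ker phi psi r : berkovich nrmA phi -> flat_seminorm pib iota j phi = psi ->
    (forall x, I x -> psi (j x) = 0) -> untilt_ideal I r -> phi (iota r) = 0.
  move=> phiP phipsi psiI.
  apply: (untilt_sub_ker Rc pi_p c01 nX nrmA_pm phiP) => x Ix.
  by rewrite -ls_j -(psiI x Ix) -phipsi.
apply/seteqP; split=> [r Ir psi [psiP psiI]|r].
  (* If psi had no preimage, the default seminorm 0 would make the inclusion trivial. *)
  rewrite /= /sharp_seminorm; case: xgetP => [phi _ [phiP phipsi]|//].
  exact: ker phiP phipsi psiI Ir.
move=> r_ker; apply: contrapT => Ir.
have [Q [chi [varpi [chi_surj chi_ker [varpi0 varpiS Q_tf Q_sep Q_root]]]]] :=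
  untilt_quotient R_perfectoid pi_perfectoid pib_sharp I_ideal I_radical I_closed I_tf.
(* k is maximal with [varpi 0 ^+ k] dividing [chi r]; it exists because Q is separated. *)
have [k [s [rE s_ndvd]]] : exists k s,
    chi r = chi (sharp pib ^+ k * s) /\ ~ rdvd (varpi 0) (chi s).
  have ex : exists n, `[< ~ rdvd (varpi 0 ^+ n) (chi r) >].
    apply: contrapT => h; apply/Ir/chi_ker/Q_sep => n.
    by apply: contrapT => hn; apply: h; exists n; apply/asboolP.
  case: (ex_minnP ex) => -[|k] /asboolP kP kmin.
    by case: kP; exact: rdvd1l.
  have [y yE] : rdvd (varpi 0 ^+ k) (chi r).
    by apply: contrapT => /asboolP /kmin; rewrite ltnn.
  have [s sE] := chi_surj y.
  exists k, s; rewrite rmorphM rmorphXn /= -varpi0 sE yE; split=> // -[z zE].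
  by apply: kP; exists z; rewrite yE zE exprSr mulrA.
have [x [y sx]] := sharp_surj_modp p_pr Rc frob_surj s.
have x_ndvd : ~ rdvd (varpi 0) (chi (sharp x)).
  move=> h; apply: s_ndvd; rewrite -(subrK (sharp x) s) sx rmorphD rmorphM.
  apply: rdvdD h; apply: rdvd_mulr; rewrite varpi0; apply: rdvd_rmorph.
  apply: rdvd_trans pi_p; exists v'.
  by rewrite pibE mulrAC vv' mul1r.
have [phiQ [phiQ_ultra phiQM phiQ_le1 phiQ_c phiQ_x]] :=
  exists_multiplicative p_pr varpiS Q_tf Q_root c01 x_ndvd.
pose Phi a := phiQ (chi a).
have Phi0 a : 0 <= Phi a by exact: ultra_ge0 phiQ_ultra _.
have Phi_le1 a : Phi a <= 1 by exact: phiQ_le1.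
have Phi1 : Phi 1 = 1 by rewrite /Phi rmorph1 (ultra1 phiQ_ultra).
have PhiM a b : Phi (a * b) = Phi a * Phi b by rewrite /Phi rmorphM phiQM.
have PhiD a b : Phi (a + b) <= Num.max (Phi a) (Phi b).
  by rewrite /Phi rmorphD (ultraD phiQ_ultra).
have Phi_pib : Phi (sharp pib) = c by rewrite /Phi -varpi0.
have Phi_pi : Phi pi = c.
  apply/eqP; rewrite eq_le; apply/andP; split; last first.
    by rewrite -Phi_pib pibE PhiM ler_piMl.
  have -> : pi = v' * sharp pib by rewrite pibE mulrA [v' * v]mulrC vv' mul1r.
  by rewrite PhiM Phi_pib ler_piMl // ltW.
have Phi_p : Phi p%:R <= c.
  by have [t ->] := pi_p; rewrite PhiM Phi_pi ler_piMr // ltW.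
have [|phi [phi_iota phi0 phiM phiD]] := extend_seminorm A_loc Phi0 Phi1 PhiM PhiD.
  by rewrite Phi_pi.
have le_maxD (a b : K) : 0 <= a -> 0 <= b -> Num.max a b <= a + b.
  by move=> a0 b0; rewrite ge_max lerDl lerDr a0 b0.
have phi00 : phi 0 = 0 by rewrite -(rmorph0 iota) phi_iota /Phi rmorph0 (ultra0 phiQ_ultra).
have phiP : berkovich nrmA phi.
  split=> //.
  - by rewrite -(rmorph1 iota) phi_iota.
  - by move=> a b; exact: le_trans (phiD a b) (le_maxD _ _ _ _).
  - apply: (tate_bounded A_loc nrmA_pm nrmA_top nrmA_pi c01) => //.
      by move=> a; rewrite phi_iota.
    by rewrite phi_iota Phi_pi.
pose psi := flat_seminorm pib iota j phi.
have psi_j z : psi (j z) = Phi (sharp z) by rewrite /psi /flat_seminorm /= ls_j phi_iota.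
have psiM a b : psi (a * b) = psi a * psi b.
  by rewrite /psi /flat_seminorm /= (loc_sharpM Rc B_loc pib_unit) phiM.
have psi0 : psi 0 = 0.
  by rewrite -(rmorph0 j) psi_j /sharp tilt_lift0 // /Phi rmorph0 (ultra0 phiQ_ultra).
have psiP : berkovich nrmB psi.
  split=> //.
  - by move=> a; exact: phi0.
  - by rewrite -(rmorph1 j) psi_j /sharp tilt_lift1.
  - move=> a b; apply: le_trans (le_maxD _ _ (phi0 _) (phi0 _)).
    apply: (loc_sharpD_max Rc B_loc pib_unit) => // z z'.
    by rewrite !phi_iota; apply: (sharpD_max Rc _ _ c01 Phi0).
  (* Boundedness on B requires psi to agree with the norm at pib; this is where [nrm_compat]
     enters. *)
  - apply: (tate_bounded B_loc nrmB_pm nrmB_top nrmB_pib) => //.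
    + by rewrite -nrm_compat.
    + by move=> z; rewrite psi_j.
    + by rewrite psi_j Phi_pib.
have psiI z : I z -> psi (j z) = 0.
  move=> Iz; rewrite psi_j /Phi (_ : chi (sharp z) = 0) ?(ultra0 phiQ_ultra) //.
  apply/chi_ker; exists (teich p_pr z); last exact: theta_teich.
  apply/(witt_idealE I_ideal I_radical) => -[|n] //=.
  by case: I_ideal.
have := r_ker psi (conj psiP psiI); rewrite /= /sharp_seminorm.
(* The default does not occur here, since [phi] is a preimage of psi. *)
case: xgetP => [phi' _ [phi'P phi'psi]|/(_ phi)]; last by case.
move=> phi'r.
(* The difference of [sharp pib ^+ k * s] and r lies in the untilt, where phi' vanishes, and phi' is
   nonzero at the unit [iota (sharp pib)]. *)
have phi's : phi' (iota s) = 0.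
  have : phi' (iota (sharp pib ^+ k * s)) = 0.
    apply/eqP; rewrite eq_le (bms_ge0 phi'P) andbT.
    rewrite -(subrK r (_ * s)) rmorphD (le_trans (bmsD phi'P _ _)) // phi'r addr0.
    rewrite (ker phi' psi) //; apply/chi_ker.
    by rewrite rmorphB -rE subrr.
  rewrite rmorphM (bmsM phi'P) rmorphXn /= (bms_exp _ _ phi'P).
  move/eqP; rewrite mulf_eq0 expf_eq0 => /orP[/andP[_]|/eqP //].
  move=> /eqP z0; have := bms1 phi'P; rewrite -pib_unit (bmsM phi'P) z0 mul0r.
  by move=> /esym/eqP; rewrite oner_eq0.
have phi'x : phi' (iota (sharp x)) = Phi (sharp x).
  by rewrite -ls_j -psi_j -phi'psi.
have : c <= c ^+ p.
  apply: le_trans phiQ_x _; rewrite -[phiQ _]/(Phi (sharp x)) -phi'x.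
  rewrite -(subrK s (sharp x)) rmorphD (le_trans (bmsD phi'P _ _)) // phi's addr0.
  apply: le_trans (bms_le_norm nrmA_pm _ phi'P) _.
  have [t ->] : rdvd (pi ^+ p) (sharp x - s).
    by apply: rdvd_subC; rewrite sx; exact: rdvd_mulr.
  exact: nX.
rewrite leNgt => /negP; apply.
by rewrite -[ltRHS]expr1 ltr_iXn2l // prime_gt1.
Qed.
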